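(* Let $\mathcal{O}$ be a dg operad over $\mathbb{Q}$, $\mathcal{H}:=H^{\bullet}(\mathcal{O})$, let $P$ be a dg pseudo-cooperad, and let $\rho:\mathrm{Cobar}(P^{\diamondsuit})\to\mathcal{H}$ be a cobar resolution of $\mathcal{H}$, i.e. a quasi-isomorphism of dg operads. Assume that: (1) $P$ carries a grading $P=\bigoplus_{k\ge 1}\mathcal{G}^kP$, $\mathcal{G}^{\le 0}P=0$, with $\partial_P(\mathcal{G}^kP)\subset\mathcal{G}^{k-1}P$ and $\Delta_{\mathbf{t}}(\mathcal{G}^mP)\subset\bigoplus_{r_1+\dots+r_q=m}\mathcal{G}^{r_1}P\otimes\dots\otimes\mathcal{G}^{r_q}P$ for every $\Xi$-colored tree $\mathbf{t}$ with $q$ nodal vertices; (2) each $\mathcal{G}^kP$ is finite dimensional, and for every $\Xi$-colored corolla $\mathbf{q}$ the graded components of $\mathcal{O}(\mathbf{q})$ are finite dimensional; (3) the operad $\mathcal{H}$ is generated by $\rho(\mathbf{s}\,\mathcal{G}^1P)$, and $\rho|_{\mathbf{s}\,\mathcal{G}^kP}=0$ for all $k\ge 2$. Assume moreover that $\mathcal{O}\otimes\mathbb{K}$ is formal for some field extension $\mathbb{K}$ of $\mathbb{Q}$. Let $n\ge 2$ be an integer and let $$\alpha=\alpha_1+\dots+\alpha_n\in\mathrm{Conv}(P,\mathcal{O}),\qquad \alpha_k\in\mathrm{Hom}_{\mathsf{Coll}}(\mathcal{G}^kP,\mathcal{O}),$$ be an $n$-th MC-sprout in $\mathrm{Conv}(P,\mathcal{O})$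 such that $\pi_{\mathcal{H}}(\alpha(X))=\alpha_{\mathcal{H}}(X)$ for all $X\in\mathcal{G}^1P$. Then there exists an $(n+1)$-th MC-sprout $\tilde\alpha$ in $\mathrm{Conv}(P,\mathcal{O})$, with components $\tilde\alpha_k\in\mathrm{Hom}_{\mathsf{Coll}}(\mathcal{G}^kP,\mathcal{O})$, such that $$\tilde\alpha_k=\alpha_k\qquad\forall\ k<n.$$ Moreover, the unknown vectors $\tilde\alpha_n$ and $\tilde\alpha_{n+1}$ can be found by solving a finite dimensional linear system.
   Context: Conventions. $\mathbb{K}$ denotes a field extension of $\mathbb{Q}$ and $\otimes=\otimes_{\mathbb{Q}}$. Complexes are cochain complexes; $\mathbf{s}$ shifts degree up by one, $(\mathbf{s}V)^{\bullet}=V^{\bullet-1}$; $\mathcal{Z}(V)$ is the subspace of cocycles; ''dg'' means differential graded. Fix an ordinal $\Xi$ of colors; all operads, cooperads and collections are $\Xi$-colored (for one color one gets ordinary operads). A collection $V$ is a family of cochain complexes $V(\mathbf{q})$ indexed by $\Xi$-colored corollas $\mathbf{q}$ (with standard labeling), with a left action of $S_{k_1(\mathbf{q})}\times\dots\times S_{k_m(\mathbf{q})}$, where $m$ is the number of colors of the incoming edges and $k_i(\mathbf{q})$ is the number of incoming edges of the $i$-th color (for one color: complexes $V(n)$, $n\ge0$, with $S_n$-action). $\mathrm{Hom}_{\mathsf{Coll}}(Q_1,Q_2)$ is the graded vector space of homomorphisms of all degrees between the underlying collections of graded vector spaces (the product over corollas of the spaces of equivariant linear maps). A dg pseudo-cooperad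 $P$ is a ''dg cooperad without counit'': a collection with differential $\partial_P$ and compatible, equivariant, coassociative comultiplications $\Delta_{\mathbf{t}}$ indexed by $\Xi$-colored planar trees $\mathbf{t}$ with labeled leaves, $\Delta_{\mathbf{t}}$ landing in the tensor product of components of $P$ over the nodal vertices of $\mathbf{t}$. $P^{\diamondsuit}$ is the coaugmented dg cooperad obtained from $P$ by formally adjoining the counit. $\mathrm{Cobar}(P^{\diamondsuit})$ is the cobar construction: as a graded operad it is the free operad on $\mathbf{s}P$, with the standard differential determined by $\partial_P$ and the comultiplications $\Delta_{\mathbf{t}}$ for trees with two nodal vertices. For a dg operad $\mathcal{O}$, $\mathrm{Conv}(P,\mathcal{O})$ is the convolution dg Lie algebra: its graded vector space is $\mathrm{Hom}_{\mathsf{Coll}}(P,\mathcal{O})$, its differential is $\partial f=\partial_{\mathcal{O}}\circ f-(-1)^{|f|}f\circ\partial_P$, and $[f,g]=f\bullet g-(-1)^{|f||g|}g\bullet f$, where $f\bullet g$ is the standard pre-Lie product (comultiply in $P$ along two-vertex trees, apply $f\otimes g$, multiply in $\mathcal{O}$). $\mathrm{Curv}(\alpha)=\partial\alpha+\frac12[\alpha,\alpha]$ for $\alpha$ of degree $1$; MC elements are degree $1$ elements with $\mathrm{Curv}=0$. MC elements $\alpha$ of $\mathrm{Conv}(P,\mathcal{O})$ are in bijection with dg operad maps $F_\alpha:\mathrm{Cobar}(P^{\diamondsuit})\to\mathcal{O}$, via $F_\alpha(\mathbf{s}X)=\alpha(X)$. Given the grading on $P$, every $\alpha\in\mathrm{Conv}(P,\mathcal{O})$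 is uniquely $\sum_{k\ge1}\alpha_k$ with $\alpha_k\in\mathrm{Hom}_{\mathsf{Coll}}(\mathcal{G}^kP,\mathcal{O})$, the latter being identified with elements of $\mathrm{Conv}(P,\mathcal{O})$ vanishing on $\mathcal{G}^mP$ for $m\ne k$. For $n\ge1$ an $n$-th MC-sprout in $\mathrm{Conv}(P,\mathcal{O})$ is a degree $1$ element $\alpha$ with $\mathrm{Curv}(\alpha)(X)=0$ for all $X\in\mathcal{G}^{\le n}P:=\bigoplus_{k\le n}\mathcal{G}^kP$. $\pi_{\mathcal{H}}:\mathcal{Z}(\mathcal{O})\to\mathcal{H}$ is the canonical projection, and $\alpha_{\mathcal{H}}\in\mathrm{Conv}(P,\mathcal{H})$ is the MC element corresponding to $\rho$, i.e. $\alpha_{\mathcal{H}}(X)=\rho(\mathbf{s}X)$. ($\mathcal{H}$ has zero differential. Any MC-sprout maps $\mathcal{G}^1P$ to $\mathcal{Z}(\mathcal{O})$.) A dg operad is formal if it is connected to its cohomology operad by a zig-zag of quasi-isomorphisms of dg operads (over the base field). *)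

(* Defs.v *)
From HB Require Import structures.
From Stdlib Require Import Relation_Operators.
From mathcomp Require Import all_boot all_order all_algebra fingroup perm.
From mathcomp Require Import boolp classical_sets fsbigop.
From mathcomp Require Import generic_quotient ring_quotient.

Set Implicit Arguments.
Unset Strict Implicit.
Unset Printing Implicit Defensive.

Import Order.TTheory GRing.Theory.
Local Open Scope classical_set_scope.
Local Open Scope quotient_scope.
Local Open Scope ring_scope.

Section RawLinear.
Variables (K : pzRingType) (U V : lmodType K) (f : U -> V).
Hypothesis Hf : linear f.
Lemma rawD x y : f (x + y) = f x + f y.
Proof. by rewrite -[x]scale1r Hf !scale1r. Qed.
Lemma rawB x y : f (x - y) = f x - f y.
Proof. by rewrite addrC -scaleN1r Hf scaleN1r addrC. Qed.
Lemma raw0 : f 0 = 0.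
Proof. by rewrite -[X in f X](subrr 0) rawB subrr. Qed.
Lemma rawZ a x : f (a *: x) = a *: f x.
Proof. by rewrite -[a *: x]addr0 Hf raw0 addr0. Qed.
End RawLinear.

(* The K-module generated by T, subject to exactly those relations which make
   the functions g : T -> U satisfying Adm universal. Its elements are formal
   linear combinations; two of them are identified when no admissible function
   into a K-module distinguishes them. *)
Section UniversalModule.
Variables (K : fieldType) (T : Type).
Variable Adm : forall U : lmodType K, (T -> U) -> Prop.

Definition lincomb : Type := {classic seq (K * T)}.
HB.instance Definition _ := Choice.on lincomb.

Definition lsum (U : lmodType K) (g : T -> U) (s : lincomb) : U :=
  \sum_(p <- (s : seq (K * T))) p.1 *: g p.2.

Definition lequiv (s1 s2 : lincomb) : bool :=
  `[< forall (U : lmodType K) (g : T -> U), Adm g -> lsum g s1 = lsum g s2 >].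

Lemma lequiv_is_equiv : equiv_class_of lequiv.
Proof.
split=> [x|x y|y x z].
- by apply/asboolP.
- by apply/asboolP/asboolP => H U g Hg; rewrite H.
- by move=> /asboolP H1 /asboolP H2; apply/asboolP => U g Hg; rewrite H1 // H2.
Qed.
Canonical lequiv_equiv := EquivRelPack lequiv_is_equiv.
Canonical lequiv_encModRel := defaultEncModRel lequiv.

Definition umod : Type := {eq_quot lequiv}.
HB.instance Definition _ : EqQuotient lincomb lequiv umod := EqQuotient.on umod.
HB.instance Definition _ := Choice.on umod.

Definition ulift (U : lmodType K) (g : T -> U) (z : umod) : U :=
  lsum g (repr z).

Lemma ulift_pi (U : lmodType K) (g : T -> U) s :
  Adm g -> ulift g (\pi_umod s) = lsum g s.
Proof.
move=> Hg; rewrite /ulift; case: piP => s' /eqmodP /asboolP H.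
by rewrite -H.
Qed.

Lemma umodP (x y : umod) :
  (forall (U : lmodType K) (g : T -> U), Adm g -> ulift g x = ulift g y) ->
  x = y.
Proof.
by move=> H; rewrite -[x]reprK -[y]reprK; apply/eqmodP/asboolP => U g /H.
Qed.

Definition uadd (x y : umod) : umod :=
  \pi_umod ((repr x : seq _) ++ (repr y : seq _) : lincomb).
Definition uscale (a : K) (x : umod) : umod :=
  \pi_umod ([seq (a * p.1, p.2) | p <- (repr x : seq _)] : lincomb).
Definition uzero : umod := \pi_umod ([::] : lincomb).

Lemma lsum_cat (U : lmodType K) (g : T -> U) (s1 s2 : seq (K * T)) :
  lsum g (s1 ++ s2 : lincomb) = lsum g s1 + lsum g s2.
Proof. by rewrite /lsum big_cat. Qed.

Lemma lsum_scale (U : lmodType K) (g : T -> U) a (s : seq (K * T)) :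
  lsum g ([seq (a * p.1, p.2) | p <- s] : lincomb) = a *: lsum g s.
Proof.
rewrite /lsum big_map scaler_sumr; apply: eq_bigr => p _ /=.
by rewrite scalerA.
Qed.

Lemma ulift_add (U : lmodType K) (g : T -> U) x y :
  Adm g -> ulift g (uadd x y) = ulift g x + ulift g y.
Proof. by move=> Hg; rewrite ulift_pi // lsum_cat. Qed.

Lemma ulift_scale (U : lmodType K) (g : T -> U) a x :
  Adm g -> ulift g (uscale a x) = a *: ulift g x.
Proof. by move=> Hg; rewrite ulift_pi // lsum_scale. Qed.

Lemma ulift_zero (U : lmodType K) (g : T -> U) :
  Adm g -> ulift g uzero = 0.
Proof. by move=> Hg; rewrite ulift_pi // /lsum big_nil. Qed.

Lemma uaddA : associative uadd.
Proof. by move=> x y z; apply: umodP => U g Hg; rewrite !ulift_add // addrA. Qed.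
Lemma uaddC : commutative uadd.
Proof. by move=> x y; apply: umodP => U g Hg; rewrite !ulift_add // addrC. Qed.
Lemma uadd0 : left_id uzero uadd.
Proof.
by move=> x; apply: umodP => U g Hg; rewrite ulift_add // ulift_zero // add0r.
Qed.
Lemma uaddN : left_inverse uzero (uscale (-1)) uadd.
Proof.
move=> x; apply: umodP => U g Hg.
by rewrite ulift_add // ulift_zero // ulift_scale // scaleN1r addNr.
Qed.
HB.instance Definition _ := GRing.isZmodule.Build umod uaddA uaddC uadd0 uaddN.

Lemma uscaleA a b v : uscale a (uscale b v) = uscale (a * b) v.
Proof. by apply: umodP => U g Hg; rewrite !ulift_scale // scalerA. Qed.
Lemma uscale1 : left_id 1 uscale.
Proof. by move=> x; apply: umodP => U g Hg; rewrite ulift_scale // scale1r. Qed.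
Lemma uscaleDr : right_distributive uscale +%R.
Proof.
move=> a x y; apply: umodP => U g Hg.
by rewrite ulift_scale // !ulift_add // !ulift_scale // scalerDr.
Qed.
Lemma uscaleDl v : {morph uscale^~ v : a b / a + b}.
Proof.
move=> a b; apply: umodP => U g Hg.
by rewrite ulift_add // !ulift_scale // scalerDl.
Qed.
HB.instance Definition _ :=
  GRing.Zmodule_isLmodule.Build K umod uscaleA uscale1 uscaleDr uscaleDl.

Definition ugen (t : T) : umod := \pi_umod ([:: (1, t)] : lincomb).

Lemma ulift_gen (U : lmodType K) (g : T -> U) t :
  Adm g -> ulift g (ugen t) = g t.
Proof. by move=> Hg; rewrite ulift_pi // /lsum big_seq1 scale1r. Qed.

Lemma ulift_lin (U : lmodType K) (g : T -> U) : Adm g -> linear (ulift g).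
Proof. by move=> Hg a x y; rewrite ulift_add // ulift_scale. Qed.

Lemma umod_gen (x : umod) : exists s : seq (K * T),
  x = \sum_(p <- s) p.1 *: ugen p.2.
Proof.
exists (repr x); apply: umodP => U g Hg.
have H0 : ulift g (0 : umod) = 0 by rewrite ulift_zero.
have HD a b : ulift g (a + b : umod) = ulift g a + ulift g b.
  by rewrite ulift_add.
rewrite (big_morph (ulift g) HD H0).
rewrite {1}/ulift /lsum; apply: eq_bigr => p _.
by rewrite ulift_scale // ulift_gen.
Qed.

Lemma umod_lin_ext (U : lmodType K) (F G : umod -> U) :
  linear F -> linear G -> (forall t, F (ugen t) = G (ugen t)) -> F =1 G.
Proof.
move=> HF HG H x; have [s ->] := umod_gen x.
pose F' : {linear umod -> U} := HB.pack F (GRing.isLinear.Build _ _ _ _ F HF).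
pose G' : {linear umod -> U} := HB.pack G (GRing.isLinear.Build _ _ _ _ G HG).
rewrite -[F]/(F' : _ -> _) -[G]/(G' : _ -> _) !linear_sum.
by apply: eq_bigr => p _; rewrite !linearZ /= H.
Qed.
End UniversalModule.

Definition graded (K : fieldType) := int -> lmodType K.

Section Tensor.
Variables (K : fieldType) (V W : graded K).

Record pureTensor (k : int) := PureTensor {
  pt_i : int; pt_j : int; pt_deg : pt_i + pt_j = k;
  pt_fst : V pt_i; pt_snd : W pt_j }.

Definition tensorFun k (U : lmodType K) (g : pureTensor k -> U) : Prop :=
  (forall (i j : int) (h : i + j = k) y, linear (fun x => g (PureTensor h x y))) /\
  (forall (i j : int) (h : i + j = k) x, linear (fun y => g (PureTensor h x y))).

Definition gtens : graded K := fun k => umod (@tensorFun k).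

Definition tens (i j k : int) (h : i + j = k) (x : V i) (y : W j) : gtens k :=
  ugen (@tensorFun k) (PureTensor h x y).

(* The linear map out of the degree k part of the tensor product induced by
   maps B; meaningful when B is bilinear in each pair of degrees. *)
Definition tlift k (U : lmodType K)
    (B : forall i j : int, i + j = k -> V i -> W j -> U) : gtens k -> U :=
  ulift (fun p => B _ _ (pt_deg p) (pt_fst p) (pt_snd p)).
End Tensor.

Definition sgn (K : fieldType) (n : int) : K := (-1) ^+ `|n|%N.

Lemma deg_assoc (a b c m k : int) : a + b = m -> m + c = k -> a + (b + c) = k.
Proof. by move=> <- <-; rewrite addrA. Qed.

Lemma deg_swap (a b c m k : int) : a + b = m -> m + c = k -> (a + c) + b = k.
Proof. by move=> <- <-; rewrite addrAC. Qed.

Definition tens_assoc (K : fieldType) (U V W : graded K) k :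
    gtens (gtens U V) W k -> gtens U (gtens V W) k :=
  tlift (fun m c h z w => tlift (fun a b h' x y =>
    tens (deg_assoc h' h) x (tens (erefl (b + c)) y w)) z).

Definition tens_swap (K : fieldType) (U V W : graded K) k :
    gtens (gtens U V) W k -> gtens (gtens U W) V k :=
  tlift (fun m c h z w => tlift (fun a b h' x y =>
    sgn K b ^+ `|c|%N *: tens (deg_swap h' h) (tens (erefl (a + c)) x w) y) z).

Definition tmap (K : fieldType) (V W V' W' : graded K)
    (f : forall i, V i -> V' i) (g : forall i, W i -> W' i) k :
    gtens V W k -> gtens V' W' k :=
  tlift (fun i j h x y => tens h (f i x) (g j y)).

Section Colored.
Context {disp : Order.disp_t} {Xi : orderType disp}.

(* A corolla with standard labeling: the input colors listed in increasing
   order, and the output color. *)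
Definition corolla : Type := {p : seq Xi * Xi | sorted <=%O p.1}.
HB.instance Definition _ := Choice.on corolla.

Definition ins (q : corolla) : seq Xi := (val q).1.
Definition out (q : corolla) : Xi := (val q).2.
Definition arity (q : corolla) : nat := size (ins q).
Definition inp (q : corolla) (l : 'I_(arity q)) : Xi :=
  tnth (in_tuple (ins q)) l.

(* The color preserving permutations of the inputs; they form the group
   S_{k_1(q)} x ... x S_{k_m(q)}. *)
Definition colperm (q : corolla) (s : 'S_(arity q)) : bool :=
  [forall l, inp (s l) == inp l].

Definition ucor (c : Xi) : corolla := exist _ ([:: c], c) isT.

Definition slot (q1 q2 : corolla) := ('I_(arity q1) + 'I_(arity q2))%type.
Definition slotcol q1 q2 (e : slot q1 q2) : Xi :=
  match e with inl a => inp a | inr b => inp b end.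

(* A colored tree with two nodal vertices, with root vertex q1, upper vertex q2
   grafted to the input v of q1, and with leaves labeled by the inputs of q:
   pos l is the place of the leaf labeled l. *)
Definition is_tree2 (q q1 q2 : corolla)
    (p : 'I_(arity q1) * {ffun 'I_(arity q) -> slot q1 q2}) : bool :=
  [&& out q1 == out q, out q2 == inp p.1, injectiveb p.2,
      [forall e, (e \in codom p.2) == (e != inl p.1)] &
      [forall l, inp l == slotcol (p.2 l)]].

Definition tree2 (q q1 q2 : corolla) : Type := {p | @is_tree2 q q1 q2 p}.
HB.instance Definition _ q q1 q2 := Finite.on (tree2 q q1 q2).

Definition node q q1 q2 (t : tree2 q q1 q2) : 'I_(arity q1) := (val t).1.
Definition pos q q1 q2 (t : tree2 q q1 q2) (l : 'I_(arity q)) : slot q1 q2 :=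
  (val t).2 l.

Definition slotmap q1 q2 (s1 : 'S_(arity q1)) (s2 : 'S_(arity q2))
    (e : slot q1 q2) : slot q1 q2 :=
  match e with inl a => inl (s1 a) | inr b => inr (s2 b) end.

(* t' is t with leaves relabeled by s, and inputs of its two vertices permuted
   by s1 and s2. *)
Definition tree2_iso q q1 q2 (s : 'S_(arity q)) (s1 : 'S_(arity q1))
    (s2 : 'S_(arity q2)) (t t' : tree2 q q1 q2) : Prop :=
  node t' = s1 (node t) /\ forall l, pos t' (s l) = slotmap s1 s2 (pos t l).

(* Each isomorphism class of labeled trees with two nodal vertices has exactly
   one representative satisfying the following. *)
Definition canonical_tree2 q q1 q2 (t : tree2 q q1 q2) : bool :=
  [&& [forall l : 'I_(arity q), forall l' : 'I_(arity q), (l < l')%N ==>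
        match pos t l, pos t l' with
        | inl a, inl a' => (a < a')%N
        | inr b, inr b' => (b < b')%N
        | _, _ => true
        end] &
      [forall a : 'I_(arity q1), (inp a == inp (node t)) ==> (node t <= a)%N]].

Definition nestl (A B C M : Type) (f : M -> A + B) (e : M + C) : A + B + C :=
  match e with inl m => inl (f m) | inr c => inr c end.
Definition nestr (A B C M : Type) (f : M -> B + C) (e : A + M) : A + (B + C) :=
  match e with inl a => inl a | inr m => inr (f m) end.
Definition sumA (A B C : Type) (e : A + B + C) : A + (B + C) :=
  match e with
  | inl (inl a) => inl a | inl (inr b) => inr (inl b) | inr c => inr (inr c)
  end.
Definition sumAC (A B C : Type) (e : A + B + C) : A + C + B :=
  match e with
  | inl (inl a) => inl (inl a) | inl (inr b) => inr b | inr c => inl (inr c)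
  end.

(* The two ways of building, in two steps, a tree with three vertices q0, q1,
   q2, where q1 is attached to q0 and q2 is attached to q1. *)
Definition stacked q m m' q0 q1 q2 (u : tree2 q m q2) (t : tree2 m q0 q1)
    (u' : tree2 q q0 m') (t' : tree2 m' q1 q2) : Prop :=
  [/\ pos t (node u) = inr (node t'), node u' = node t &
      forall l, sumA (nestl (pos t) (pos u l)) = nestr (pos t') (pos u' l)].

(* The same, where both q1 and q2 are attached to q0. *)
Definition parallel q m m' q0 q1 q2 (u : tree2 q m q2) (t : tree2 m q0 q1)
    (u' : tree2 q m' q1) (t' : tree2 m' q0 q2) : Prop :=
  [/\ pos t (node u) = inl (node t'), pos t' (node u') = inl (node t) &
      forall l, sumAC (nestl (pos t) (pos u l)) = nestl (pos t') (pos u' l)].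

(* Every tree with at least one nodal vertex, decomposed by successively
   cutting internal edges. *)
Inductive dtree : corolla -> Type :=
| DCor q : dtree q
| DGraft q q1 q2 : tree2 q q1 q2 -> dtree q1 -> dtree q2 -> dtree q.

Section Algebra.
Variable K : fieldType.

Record gColl := GColl {
  gc_V :> corolla -> graded K;
  act : forall q (s : 'S_(arity q)), colperm s -> forall i, gc_V q i -> gc_V q i;
  act_lin : forall q s (hs : @colperm q s) i, linear (@act q s hs i);
  act1 : forall q (h1 : @colperm q 1%g) i x, @act q 1%g h1 i x = x;
  (* mathcomp composes permutations from left to right: (s * t) x = t (s x) *)
  actM : forall q s t (hs : @colperm q s) (ht : colperm t) (hst : colperm (s * t)%g)
    i x, @act q _ hst i x = act ht (act hs x) }.

(* A collection of cochain complexes. Degrees of values of maps are given up to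
   a proof of equality, so that no transport is ever needed. *)
Record dgColl := DGColl {
  dg_coll :> gColl;
  dif : forall q (i j : int), i + 1 = j -> dg_coll q i -> dg_coll q j;
  dif_lin : forall q (i j : int) (h : i + 1 = j), linear (@dif q i j h);
  dif_dif : forall q (i j k : int) (h : i + 1 = j) (h' : j + 1 = k) x,
    @dif q j k h' (dif h x) = 0;
  dif_act : forall q s (hs : @colperm q s) (i j : int) (h : i + 1 = j) x,
    dif h (act hs x) = act hs (@dif q i j h x) }.

Record operad_on (V : gColl) := OperadOn {
  mu : forall q q1 q2 (t : tree2 q q1 q2) (i j k : int), i + j = k ->
    V q1 i -> V q2 j -> V q k;
  oid : forall c, V (ucor c) 0;
  mu_linl : forall q q1 q2 (t : tree2 q q1 q2) (i j k : int) (h : i + j = k) y,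
    linear (fun x => mu t h x y);
  mu_linr : forall q q1 q2 (t : tree2 q q1 q2) (i j k : int) (h : i + j = k) x,
    linear (mu t h x);
  mu_act : forall q q1 q2 (t t' : tree2 q q1 q2) s s1 s2
    (hs : colperm s) (hs1 : colperm s1) (hs2 : colperm s2),
    tree2_iso s s1 s2 t t' -> forall (i j k : int) (h : i + j = k) x y,
    mu t' h (act hs1 x) (act hs2 y) = act hs (mu t h x y);
  mu_stacked : forall q m m' q0 q1 q2 (u : tree2 q m q2) (t : tree2 m q0 q1)
    (u' : tree2 q q0 m') (t' : tree2 m' q1 q2), stacked u t u' t' ->
    forall (i j l ij jl k : int) (hij : i + j = ij) (hjl : j + l = jl)
      (h : ij + l = k) (h' : i + jl = k) x y z,
    mu u h (mu t hij x y) z = mu u' h' x (mu t' hjl y z);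
  mu_parallel : forall q m m' q0 q1 q2 (u : tree2 q m q2) (t : tree2 m q0 q1)
    (u' : tree2 q m' q1) (t' : tree2 m' q0 q2), parallel u t u' t' ->
    forall (i j l ij il k : int) (hij : i + j = ij) (hil : i + l = il)
      (h : ij + l = k) (h' : il + j = k) x y z,
    mu u h (mu t hij x y) z =
    sgn K j ^+ `|l|%N *: mu u' h' (mu t' hil x z) y;
  mu_idl : forall q c (t : tree2 q (ucor c) q),
    (forall l, pos t l = inr l) ->
    forall (i : int) (h : 0 + i = i) x, mu t h (oid c) x = x;
  mu_idr : forall q c (t : tree2 q q (ucor c)),
    (forall l, pos t l = if l == node t then inr ord0 else inl l) ->
    forall (i : int) (h : i + 0 = i) x, mu t h x (oid c) = x }.

Record operad := Operad { op_coll :> gColl; op_str : operad_on op_coll }.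

Record dgOperad := DGOperad {
  dgo_coll :> dgColl;
  dgo_str : operad_on dgo_coll;
  dif_oid : forall c (j : int) (h : 0 + 1 = j), dif h (oid dgo_str c) = 0;
  dif_mu : forall q q1 q2 (t : tree2 q q1 q2) (i j k i' j' k' : int)
    (h : i + j = k) (hi : i + 1 = i') (hj : j + 1 = j') (hk : k + 1 = k')
    (h1 : i' + j = k') (h2 : i + j' = k') x y,
    dif hk (mu dgo_str t h x y) =
    mu dgo_str t h1 (dif hi x) y + sgn K i *: mu dgo_str t h2 x (dif hj y) }.

Definition dgo_operad (O : dgOperad) : operad := Operad (dgo_str O).

Record operad_map (A B : operad) := OperadMap {
  om :> forall q i, A q i -> B q i;
  om_lin : forall q i, linear (@om q i);
  om_act : forall q s (hs : @colperm q s) i x, @om q i (act hs x) = act hs (om x);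
  om_mu : forall q q1 q2 (t : tree2 q q1 q2) (i j k : int) (h : i + j = k) x y,
    om (mu (op_str A) t h x y) = mu (op_str B) t h (om x) (om y);
  om_oid : forall c, om (oid (op_str A) c) = oid (op_str B) c }.

Record dg_map (A B : dgOperad) := DGMap {
  dgm :> operad_map (dgo_operad A) (dgo_operad B);
  dgm_dif : forall q (i j : int) (h : i + 1 = j) (x : A q i),
    dgm q j (dif h x) = dif h (dgm q i x) }.

Section Cohomology.
Variables (V : dgColl) (q : corolla) (i : int).

Definition cocycle : {pred V q i} := fun x => dif (erefl (i + 1)) x == 0.
Definition coboundary (x : V q i) : Prop :=
  exists (j : int) (h : j + 1 = i) (y : V q j), x = dif h y.

Lemma cocycleE x : (x \in cocycle) = (dif (erefl (i + 1)) x == 0).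
Proof. by []. Qed.

Lemma cocycleP x j (h : i + 1 = j) : x \in cocycle -> dif h x = 0.
Proof. by subst j => /eqP. Qed.

Lemma cocycle_submod : submod_closed cocycle.
Proof.
split=> [|a x y Hx Hy]; rewrite cocycleE ?(raw0 (dif_lin _)) //.
by rewrite dif_lin !cocycleP // scaler0 addr0.
Qed.
HB.instance Definition _ :=
  GRing.isSubmodClosed.Build K (V q i) cocycle cocycle_submod.

Record cocycles := Cocycle { cval :> V q i; _ : cval \in cocycle }.
HB.instance Definition _ := [isSub for cval].
HB.instance Definition _ := [Choice of cocycles by <:].
HB.instance Definition _ := [SubChoice_isSubLmodule of cocycles by <:].

Lemma valZE a (x : cocycles) : val (a *: x) = a *: val x.
Proof. by []. Qed.
Lemma valDE (x y : cocycles) : val (x + y) = val x + val y.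
Proof. by []. Qed.

Definition boundaries : {pred cocycles} := fun x => `[< coboundary (val x) >].

Lemma boundariesE x : reflect (coboundary (val x)) (x \in boundaries).
Proof. exact: asboolP. Qed.

Lemma coboundary0 : coboundary 0.
Proof. by exists (i - 1), (subrK _ _), 0; rewrite (raw0 (dif_lin _)). Qed.

Lemma coboundary_lin a x y :
  coboundary x -> coboundary y -> coboundary (a *: x + y).
Proof.
move=> [j [h [x' ->]]] [k [h' [y' ->]]].
have E : k = j by apply: (addIr 1); rewrite h h'.
subst k; exists j, h, (a *: x' + y'); rewrite dif_lin; congr (_ + dif _ _).
exact: eq_irrelevance.
Qed.

Lemma boundaries_submod : submod_closed boundaries.
Proof.
split=> [|a x y /boundariesE Hx /boundariesE Hy]; apply/boundariesE => /=.
  exact: coboundary0.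
exact: coboundary_lin.
Qed.
HB.instance Definition _ :=
  GRing.isSubmodClosed.Build K cocycles boundaries boundaries_submod.

Definition coh : Type := Quotient.quot boundaries.
HB.instance Definition _ := GRing.Zmodule.on coh.
HB.instance Definition _ := EqQuotient.on coh.
HB.instance Definition _ := ZmodQuotient.on coh.

Lemma coh_piP (x y : cocycles) :
  (\pi_coh x = \pi_coh y) <-> coboundary (val x - val y).
Proof.
split=> [/eqP|H].
  by rewrite -Quotient.idealrBE => /boundariesE.
by apply/eqP; rewrite -Quotient.idealrBE; apply/boundariesE.
Qed.

Definition coh_scale (a : K) (x : coh) : coh := \pi_coh (a *: repr x).

Lemma coh_scale_pi a (x : cocycles) :
  coh_scale a (\pi_coh x) = \pi_coh (a *: x).
Proof.
rewrite /coh_scale; apply/coh_piP.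
have /coh_piP H : \pi_coh (repr (\pi_coh x)) = \pi_coh x by rewrite reprK.
rewrite !valZE -scalerBr.
by have := coboundary_lin a H coboundary0; rewrite addr0.
Qed.

Lemma coh_piD (x y : cocycles) : \pi_coh (x + y) = \pi_coh x + \pi_coh y.
Proof. exact: Quotient.pi_add. Qed.

Lemma coh_surj (z : coh) : exists x, z = \pi_coh x.
Proof. by exists (repr z); rewrite reprK. Qed.

Lemma coh_scaleA a b v : coh_scale a (coh_scale b v) = coh_scale (a * b) v.
Proof. by have [x ->] := coh_surj v; rewrite !coh_scale_pi scalerA. Qed.
Lemma coh_scale1 : left_id 1 coh_scale.
Proof. by move=> v; have [x ->] := coh_surj v; rewrite coh_scale_pi scale1r. Qed.
Lemma coh_scaleDr : right_distributive coh_scale +%R.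
Proof.
move=> a v w; have [x ->] := coh_surj v; have [y ->] := coh_surj w.
by rewrite -coh_piD !coh_scale_pi -coh_piD scalerDr.
Qed.
Lemma coh_scaleDl v : {morph coh_scale^~ v : a b / a + b}.
Proof.
move=> a b; have [x ->] := coh_surj v.
by rewrite !coh_scale_pi -coh_piD scalerDl.
Qed.
HB.instance Definition _ := GRing.Zmodule_isLmodule.Build K coh
  coh_scaleA coh_scale1 coh_scaleDr coh_scaleDl.

(* The cohomology class of a cocycle (and the class of 0 for other vectors). *)
Definition cls (x : V q i) : coh := \pi_coh (insubd (0 : cocycles) x).

Definition rep (z : coh) : V q i := val (repr z).

Lemma rep_cocycle z : rep z \in cocycle.
Proof. exact: valP. Qed.

Lemma cls_rep z : cls (rep z) = z.
Proof. by rewrite /cls /rep valKd reprK. Qed.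

Lemma clsP x y : x \in cocycle -> y \in cocycle ->
  cls x = cls y <-> coboundary (x - y).
Proof.
by move=> hx hy; rewrite /cls coh_piP /= !insubdK.
Qed.

Lemma rep_cls x : x \in cocycle -> coboundary (rep (cls x) - x).
Proof.
by move=> hx; apply/clsP => //; [exact: rep_cocycle | rewrite cls_rep].
Qed.

Lemma cls_lin a x y : x \in cocycle -> y \in cocycle ->
  cls (a *: x + y) = a *: cls x + cls y.
Proof.
move=> hx hy; rewrite /cls -[a *: \pi_coh _]/(coh_scale a _) coh_scale_pi.
rewrite -coh_piD; congr (\pi_coh _); apply: val_inj.
by rewrite [LHS]insubdK ?rpredD ?rpredZ // valDE valZE !insubdK.
Qed.

Lemma clsZ a x : x \in cocycle -> cls (a *: x) = a *: cls x.
Proof.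
move=> hx; have h0 : cls 0 = 0.
  have := cls_lin (-1) hx hx.
  by rewrite !scaleN1r !addNr.
by rewrite -[a *: x]addr0 cls_lin ?rpred0 // h0 addr0.
Qed.
End Cohomology.
Arguments cocycle {V q i}.

Section CohomologyOperad.
Variable O : dgOperad.
Let mul := @mu _ (dgo_str O).

Lemma cohE q i (z : coh O q i) : exists2 x, x \in cocycle & z = cls x.
Proof. by exists (rep z); [exact: rep_cocycle | rewrite cls_rep]. Qed.

Lemma cls_eq q i (x y : O q i) : x \in cocycle -> y \in cocycle ->
  coboundary (x - y) -> cls x = cls y.
Proof. by move=> hx hy h; apply/clsP. Qed.

Lemma act_cocycle q s (hs : @colperm q s) i (x : O q i) :
  x \in cocycle -> act hs x \in cocycle.
Proof.
by move=> /cocycleP hx; rewrite cocycleE dif_act hx (raw0 (@act_lin _ _ _ _ _)).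
Qed.

Definition coh_act q s (hs : @colperm q s) i (z : coh O q i) : coh O q i :=
  cls (act hs (rep z)).

Lemma coh_actE q s (hs : @colperm q s) i (x : O q i) : x \in cocycle ->
  coh_act hs (cls x) = cls (act hs x).
Proof.
move=> hx; apply: cls_eq; [|exact: act_cocycle|].
  by apply: act_cocycle; exact: rep_cocycle.
have [j [h [y E]]] := rep_cls hx.
by exists j, h, (act hs y); rewrite -(rawB (@act_lin _ _ _ _ _)) E dif_act.
Qed.

Lemma mu_cocycle q q1 q2 (t : tree2 q q1 q2) (i j k : int) (h : i + j = k) x y :
  x \in cocycle -> y \in cocycle -> mul t h x y \in cocycle.
Proof.
move=> /cocycleP hx /cocycleP hy; rewrite cocycleE.
have h1 : (i + 1) + j = k + 1 by rewrite -h addrAC.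
have h2 : i + (j + 1) = k + 1 by rewrite -h addrA.
rewrite (dif_mu t h (erefl _) (erefl _) (erefl _) h1 h2) hx hy.
by rewrite (raw0 (mu_linl _ _ _ _)) (raw0 (mu_linr _ _ _ _)) scaler0 addr0.
Qed.

Lemma sgnK n : sgn K n * sgn K n = 1.
Proof. by rewrite /sgn -exprMn mulrNN mulr1 expr1n. Qed.

Lemma mu_coboundaryl q q1 q2 (t : tree2 q q1 q2) (i j k : int) (h : i + j = k) x y :
  coboundary x -> y \in cocycle -> coboundary (mul t h x y).
Proof.
move=> [i0 [e [x0 ->]]] /cocycleP hy.
have h0 : i0 + j = k - 1 by rewrite -h -e addrAC addrK.
have h2 : i0 + (j + 1) = k by rewrite addrA h0 subrK.
exists (k - 1), (subrK _ _), (mul t h0 x0 y).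
rewrite (dif_mu t h0 e (erefl _) (subrK _ _) h h2) hy.
by rewrite (raw0 (mu_linr _ _ _ _)) scaler0 addr0.
Qed.

Lemma mu_coboundaryr q q1 q2 (t : tree2 q q1 q2) (i j k : int) (h : i + j = k) x y :
  x \in cocycle -> coboundary y -> coboundary (mul t h x y).
Proof.
move=> /cocycleP hx [j0 [e [y0 ->]]].
have h0 : i + j0 = k - 1 by rewrite -h -e addrA addrK.
have h1 : (i + 1) + j0 = k by rewrite addrAC h0 subrK.
exists (k - 1), (subrK _ _), (sgn K i *: mul t h0 x y0).
rewrite (rawZ (dif_lin _)) (dif_mu t h0 (erefl _) e (subrK _ _) h1 h) hx.
by rewrite (raw0 (mu_linl _ _ _ _)) add0r scalerA sgnK scale1r.
Qed.

Definition coh_mu q q1 q2 (t : tree2 q q1 q2) (i j k : int) (h : i + j = k)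
  (x : coh O q1 i) (y : coh O q2 j) : coh O q k := cls (mul t h (rep x) (rep y)).

Lemma coh_muE q q1 q2 (t : tree2 q q1 q2) (i j k : int) (h : i + j = k) x y :
  x \in cocycle -> y \in cocycle ->
  coh_mu t h (cls x) (cls y) = cls (mul t h x y).
Proof.
move=> hx hy; have rx := rep_cocycle (cls x); have ry := rep_cocycle (cls y).
transitivity (cls (mul t h x (rep (cls y)))); apply: cls_eq;
  rewrite ?mu_cocycle //.
  rewrite -(rawB (mu_linl _ t h _)); apply: mu_coboundaryl => //.
  exact: rep_cls.
rewrite -(rawB (mu_linr _ t h _)); apply: mu_coboundaryr => //.
exact: rep_cls.
Qed.

Lemma coh_act_lin q s (hs : @colperm q s) i : linear (@coh_act q s hs i).
Proof.
move=> a z w; have [x hx ->] := cohE z; have [y hy ->] := cohE w.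
rewrite -cls_lin // !coh_actE ?rpredD ?rpredZ //.
by rewrite act_lin cls_lin ?act_cocycle.
Qed.

Lemma coh_act1 q (h1 : @colperm q 1%g) i z : @coh_act q 1%g h1 i z = z.
Proof. by have [x hx ->] := cohE z; rewrite coh_actE // act1. Qed.

Lemma coh_actM q s t (hs : @colperm q s) (ht : colperm t)
  (hst : colperm (s * t)%g) i z :
  @coh_act q _ hst i z = coh_act ht (coh_act hs z).
Proof.
have [x hx ->] := cohE z; rewrite !coh_actE ?act_cocycle //.
by rewrite (actM hs ht).
Qed.

Definition coh_gColl : gColl :=
  GColl coh_act_lin coh_act1 coh_actM.

Lemma zero_lin q (i j : int) (h : i + 1 = j) :
  linear (fun _ : coh_gColl q i => 0 : coh_gColl q j).
Proof. by move=> a x y; rewrite scaler0 addr0. Qed.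

Definition coh_dgColl : dgColl.
Proof.
refine (@DGColl coh_gColl (fun q i j h _ => 0) zero_lin _ _) => //.
by move=> q s hs i j h x; rewrite (raw0 (@act_lin _ _ _ _ _)).
Defined.

Lemma coh_mu_linl q q1 q2 (t : tree2 q q1 q2) (i j k : int) (h : i + j = k) z :
  linear (fun x => coh_mu t h x z).
Proof.
move=> a v w; have [x hx ->] := cohE v; have [y hy ->] := cohE w.
have [u hu ->] := cohE z.
rewrite -cls_lin // !coh_muE ?rpredD ?rpredZ //.
by rewrite /mul (mu_linl _ t h) cls_lin ?mu_cocycle.
Qed.

Lemma coh_mu_linr q q1 q2 (t : tree2 q q1 q2) (i j k : int) (h : i + j = k) z :
  linear (coh_mu t h z).
Proof.
move=> a v w; have [x hx ->] := cohE v; have [y hy ->] := cohE w.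
have [u hu ->] := cohE z.
rewrite -cls_lin // !coh_muE ?rpredD ?rpredZ //.
by rewrite /mul (mu_linr _ t h) cls_lin ?mu_cocycle.
Qed.

Lemma oid_cocycle c : oid (dgo_str O) c \in cocycle.
Proof. by rewrite cocycleE dif_oid. Qed.

Lemma coh_mu_act q q1 q2 (t t' : tree2 q q1 q2) s s1 s2
  (hs : colperm s) (hs1 : colperm s1) (hs2 : colperm s2) :
  tree2_iso s s1 s2 t t' -> forall (i j k : int) (h : i + j = k) z w,
  coh_mu t' h (coh_act hs1 z) (coh_act hs2 w) = coh_act hs (coh_mu t h z w).
Proof.
move=> E i j k h z w.
have [x hx ->] := cohE z; have [y hy ->] := cohE w.
rewrite (coh_actE hs1 hx) (coh_actE hs2 hy).
rewrite (coh_muE t h hx hy) (coh_actE hs (mu_cocycle t h hx hy)).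
rewrite (coh_muE t' h (act_cocycle hs1 hx) (act_cocycle hs2 hy)).
by rewrite /mul (mu_act _ _ _ _ E).
Qed.

Definition coh_str : operad_on coh_gColl.
Proof.
refine (@OperadOn coh_gColl coh_mu (fun c => cls (oid (dgo_str O) c))
  coh_mu_linl coh_mu_linr _ _ _ _ _).
- exact: coh_mu_act.
- move=> q m m' q0 q1 q2 u t u' t' E i j l ij jl k hij hjl h h' z w v.
  have [x hx ->] := cohE z; have [y hy ->] := cohE w; have [r hr ->] := cohE v.
  rewrite !coh_muE ?mu_cocycle //.
  by rewrite /mul (mu_stacked _ E hij hjl h h').
- move=> q m m' q0 q1 q2 u t u' t' E i j l ij il k hij hil h h' z w v.
  have [x hx ->] := cohE z; have [y hy ->] := cohE w; have [r hr ->] := cohE v.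
  rewrite !coh_muE ?mu_cocycle //.
  have hc : mul u' h' (mul t' hil x r) y \in cocycle by rewrite !mu_cocycle.
  rewrite /mul (mu_parallel _ E hij hil h h').
  exact: clsZ.
- move=> q c t E i h z; have [x hx ->] := cohE z.
  by rewrite coh_muE ?oid_cocycle // /mul mu_idl.
- move=> q c t E i h z; have [x hx ->] := cohE z.
  by rewrite coh_muE ?oid_cocycle // /mul mu_idr.
Defined.

Definition coh_operad : dgOperad.
Proof.
refine (@DGOperad coh_dgColl coh_str _ _) => //.
move=> q q1 q2 t i j k i' j' k' h hi hj hk h1 h2 x y /=.
rewrite (raw0 (coh_mu_linl t h1 y)) (raw0 (coh_mu_linr t h2 x)).
by rewrite scaler0 addr0.
Defined.
End CohomologyOperad.

Definition coh_map (A B : dgOperad) (f : dg_map A B) q i (z : coh A q i) :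
  coh B q i := cls (f q i (rep z)).

Definition quasi_iso (A B : dgOperad) (f : dg_map A B) : Prop :=
  forall q i, bijective (@coh_map A B f q i).

Definition formal (O : dgOperad) : Prop :=
  clos_refl_sym_trans dgOperad
    (fun A B => exists f : dg_map A B, quasi_iso f) O (coh_operad O).

Lemma deg_difl (a b i j : int) : a + b = i -> i + 1 = j -> (a + 1) + b = j.
Proof. by move=> <- <-; rewrite addrAC. Qed.

Lemma deg_difr (a b i j : int) : a + b = i -> i + 1 = j -> a + (b + 1) = j.
Proof. by move=> <- <-; rewrite addrA. Qed.

Definition tdif (V : dgColl) q1 q2 (i j : int) (h : i + 1 = j) :
    gtens (V q1) (V q2) i -> gtens (V q1) (V q2) j :=
  tlift (fun a b h' x y =>
    tens (deg_difl h' h) (dif (erefl (a + 1)) x) y +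
    sgn K a *: tens (deg_difr h' h) x (dif (erefl (b + 1)) y)).

(* The structure maps Delta t are the comultiplications for the trees with two
   nodal vertices; those for larger trees are their iterations, see DeltaT. *)
Record pseudoCooperad := PseudoCooperad {
  pc_coll :> dgColl;
  Delta : forall q q1 q2 (t : tree2 q q1 q2) i,
    pc_coll q i -> gtens (pc_coll q1) (pc_coll q2) i;
  Delta_lin : forall q q1 q2 (t : tree2 q q1 q2) i, linear (@Delta q q1 q2 t i);
  Delta_act : forall q q1 q2 (t t' : tree2 q q1 q2) s s1 s2
    (hs : colperm s) (hs1 : colperm s1) (hs2 : colperm s2),
    tree2_iso s s1 s2 t t' -> forall i x,
    @Delta q q1 q2 t' i (act hs x) =
    tmap (@act pc_coll q1 s1 hs1) (@act pc_coll q2 s2 hs2) (Delta t x);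
  Delta_stacked : forall q m m' q0 q1 q2
    (u : tree2 q m q2) (t : tree2 m q0 q1)
    (u' : tree2 q q0 m') (t' : tree2 m' q1 q2), stacked u t u' t' ->
    forall i (x : pc_coll q i),
    tens_assoc (tmap (@Delta m q0 q1 t) (fun _ => id) (Delta u x)) =
    tmap (fun _ => id) (@Delta m' q1 q2 t') (Delta u' x);
  Delta_parallel : forall q m m' q0 q1 q2
    (u : tree2 q m q2) (t : tree2 m q0 q1)
    (u' : tree2 q m' q1) (t' : tree2 m' q0 q2), parallel u t u' t' ->
    forall i (x : pc_coll q i),
    tens_swap (tmap (@Delta m q0 q1 t) (fun _ => id) (Delta u x)) =
    tmap (@Delta m' q0 q2 t') (fun _ => id) (Delta u' x);
  Delta_dif : forall q q1 q2 (t : tree2 q q1 q2) (i j : int) (h : i + 1 = j) x,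
    Delta t (dif h x) = tdif h (Delta t x) }.

Fixpoint tensT (V : gColl) q (b : dtree q) : graded K :=
  match b with
  | DCor q => V q
  | DGraft _ _ _ _ b1 b2 => gtens (tensT V b1) (tensT V b2)
  end.

Fixpoint DeltaT (P : pseudoCooperad) q (b : dtree q) :
    forall i, P q i -> tensT P b i :=
  match b in dtree q return forall i, P q i -> tensT P b i with
  | DCor q => fun i x => x
  | DGraft _ _ _ t b1 b2 => fun i x =>
      tmap (@DeltaT P _ b1) (@DeltaT P _ b2) (Delta t x)
  end.

Definition collSet (V : gColl) := forall q i, set (V q i).

(* The part of total weight m of the tensor product of copies of V indexed by
   the nodal vertices of b: the sum of the tensor products of the parts of
   weights r_1, ..., r_q with r_1 + ... + r_q = m. *)
Fixpoint weightT (V : gColl) (G : nat -> collSet V) q (b : dtree q) (m : nat) :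
    forall i, set (tensT V b i) :=
  match b in dtree q return forall i, set (tensT V b i) with
  | DCor q => G m q
  | DGraft _ _ _ _ b1 b2 => fun i z =>
      exists (n : nat) (p : 'I_n -> pureTensor (tensT V b1) (tensT V b2) i),
        z = \sum_(l < n) tens (pt_deg (p l)) (pt_fst (p l)) (pt_snd (p l)) /\
        forall l, exists r s, [/\ (r + s)%N = m,
          @weightT V G _ b1 r _ (pt_fst (p l)) &
          @weightT V G _ b2 s _ (pt_snd (p l))]
  end.

Record is_grading (P : pseudoCooperad) (G : nat -> collSet P) : Prop := IsGrading {
  G_sub0 : forall k q i, G k q i 0;
  G_lin : forall k q i a x y, G k q i x -> G k q i y -> G k q i (a *: x + y);
  G_act : forall k q s (hs : @colperm q s) i x, G k q i x -> G k q i (act hs x);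
  G_dec : forall q i (x : P q i), exists (n : nat) (y : nat -> P q i),
    (forall k, G k q i (y k)) /\ x = \sum_(k < n) y k;
  G_indep : forall q i (n : nat) (y : nat -> P q i),
    (forall k, G k q i (y k)) -> \sum_(k < n) y k = 0 ->
    forall k, (k < n)%N -> y k = 0;
  G_weight0 : forall q i x, G 0%N q i x -> x = 0;
  G_dif : forall k q (i j : int) (h : i + 1 = j) x,
    G k.+1 q i x -> G k q j (dif h x);
  G_Delta : forall m q i x, G m q i x -> forall b : dtree q,
    weightT G m (DeltaT b x) }.

Definition spanned_by (V : lmodType K) (s : seq V) (x : V) : Prop :=
  exists c : 'I_(size s) -> K, x = \sum_(l < size s) c l *: tnth (in_tuple s) l.

Definition findim_set (V : lmodType K) (A : set V) : Prop :=
  exists s : seq V, A `<=` spanned_by s.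

(* The direct sum of all components of the family is finite dimensional. *)
Definition findim_collSet (V : gColl) (A : collSet V) : Prop :=
  (forall q i, findim_set (A q i)) /\
  exists s : seq (corolla * int),
    forall q i x, A q i x -> x <> 0 -> (q, i) \in s.

(* Families of maps of degree e; a map V q i -> W q j is given for each proof
   that i + e = j. *)
Definition ghom (V W : gColl) (e : int) :=
  forall q (i j : int), i + e = j -> V q i -> W q j.

(* The degree e part of Hom_Coll(V, W). *)
Record collHom (V W : gColl) (e : int) := CollHom {
  chom :> ghom V W e;
  chom_lin : forall q (i j : int) (h : i + e = j), linear (@chom q i j h);
  chom_act : forall q s (hs : @colperm q s) (i j : int) (h : i + e = j) x,
    chom h (act hs x) = act hs (@chom q i j h x) }.

Definition eq_on (V W : gColl) (e : int) (A : collSet V) (f g : ghom V W e) : Prop :=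
  forall q i x, A q i x -> forall (j : int) (h : i + e = j), f q i j h x = g q i j h x.

Definition vanish_on (V W : gColl) (e : int) (A : collSet V) (f : ghom V W e) :
    Prop :=
  forall q i x, A q i x -> forall (j : int) (h : i + e = j), f q i j h x = 0.

Lemma deg_hom (e i j : int) : i + (e + 1) = j -> i + e + 1 = j.
Proof. by move=> <-; rewrite addrA. Qed.

Lemma deg_hom1 (e i j : int) : i + (e + 1) = j -> i + 1 + e = j.
Proof. by move=> <-; rewrite addrAC addrA. Qed.

Lemma deg_hom2 (e f a b i j : int) :
  a + b = i -> i + (e + f) = j -> (a + e) + (b + f) = j.
Proof. by move=> <- <-; rewrite addrACA. Qed.

Lemma deg_homC (e f i j : int) : i + (e + f) = j -> i + (f + e) = j.
Proof. by move=> <-; rewrite [f + e]addrC. Qed.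

Section Convolution.
Variables (P : pseudoCooperad) (O : dgOperad).

Definition conv_dif (e : int) (f : ghom P O e) : ghom P O (e + 1) :=
  fun q i j h x =>
    dif (deg_hom h) (f q i (i + e) erefl x) -
    sgn K e *: f q (i + 1) j (deg_hom1 h) (dif (erefl (i + 1)) x).

(* The pre-Lie product. The sum is over isomorphism classes of trees with two
   nodal vertices; when Xi is infinite and infinitely many of its terms are
   nonzero, it is 0 by convention. *)
Definition bullet (e e' : int) (f : ghom P O e) (g : ghom P O e') :
    ghom P O (e + e') :=
  fun q i j h x =>
    \sum_(p \in [set: corolla * corolla])
      \sum_(t : tree2 q p.1 p.2 | canonical_tree2 t)
        tlift (fun a b h' y z => sgn K e' ^+ `|a|%N *:
                 mu (dgo_str O) t (deg_hom2 h' h)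
                   (f p.1 a (a + e) erefl y) (g p.2 b (b + e') erefl z))
          (Delta t x).

Definition bracket (e e' : int) (f : ghom P O e) (g : ghom P O e') :
    ghom P O (e + e') :=
  fun q i j h x =>
    bullet f g h x - sgn K e ^+ `|e'|%N *: bullet g f (deg_homC h) x.

Definition curv (f : ghom P O 1) : ghom P O (1 + 1) :=
  fun q i j h x => conv_dif f h x + 2^-1 *: bracket f f h x.

Definition is_sprout (G : nat -> collSet P) (n : nat) (f : ghom P O 1) : Prop :=
  forall k, (k <= n)%N -> forall q i x, G k q i x ->
  forall (j : int) (h : i + (1 + 1) = j), @curv f q i j h x = 0.
End Convolution.

(* s : V -> F is regarded as a map of degree 0 from the suspension of V; it
   exhibits F as the free graded operad on the suspension of V. *)
Definition is_free (V : gColl) (F : operad) (s : collHom V F 1) : Prop :=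
  forall (A : operad) (f : collHom V A 1),
  exists2 g : operad_map F A,
    (forall q (i j : int) (h : i + 1 = j) x, g q j (chom s h x) = chom f h x) &
    forall g' : operad_map F A,
    (forall q (i j : int) (h : i + 1 = j) x, g' q j (chom s h x) = chom f h x) ->
    forall q i x, g' q i x = g q i x.

(* C is the cobar construction of the cooperad obtained from P by adjoining
   a counit: the free operad on the suspension s P, whose differential is
   d (s X) = - s (d X) - sum_t mu_t ((s (x) s) (Delta_t X)). *)
Definition is_cobar (P : pseudoCooperad) (C : dgOperad) (s : collHom P C 1) :
    Prop :=
  @is_free P (dgo_operad C) s /\
  forall q (i j k : int) (h : i + 1 = j) (h' : j + 1 = k)
    (h2 : i + (1 + 1) = k) (x : P q i),
  dif h' (chom s h x) = - chom s h' (dif h x) - bullet s s h2 x.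

(* The map X |-> F (s X); for a cobar construction C it is the Maurer-Cartan
   element corresponding to F. *)
Definition twisting (P : pseudoCooperad) (C B : dgOperad) (s : collHom P C 1)
    (F : dg_map C B) : ghom P B 1 :=
  fun q i j h x => F q j (chom s h x).

Definition generated (H : operad) (A : collSet H) : Prop :=
  forall S : collSet H,
  (forall q i, A q i `<=` S q i) ->
  (forall q i, S q i 0) ->
  (forall q i a x y, S q i x -> S q i y -> S q i (a *: x + y)) ->
  (forall q s (hs : @colperm q s) i x, S q i x -> S q i (act hs x)) ->
  (forall c, S (ucor c) 0 (oid (op_str H) c)) ->
  (forall q q1 q2 (t : tree2 q q1 q2) (i j k : int) (h : i + j = k) x y,
     S q1 i x -> S q2 j y -> S q k (mu (op_str H) t h x y)) ->
  forall q i x, S q i x.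

(* The components in Hom_Coll(G^n P, O) (+) Hom_Coll(G^{n+1} P, O), of degree 1,
   of the (n+1)-th sprouts which agree with alpha on G^k P for k < n are exactly
   the solutions of a linear system v *m A = b. The unknown v is the row of
   coordinates of such a pair of components in the basis given by Phi. *)
Definition linear_system (P : pseudoCooperad) (O : dgOperad)
    (G : nat -> collSet P) (n : nat) (alpha : ghom P O 1) : Prop :=
  exists (N M : nat) (Phi : 'rV[K]_N -> collHom P O 1)
    (A : 'M[K]_(N, M)) (b : 'rV[K]_M),
  [/\ forall a v w q (i j : int) (h : i + 1 = j) (x : P q i),
        chom (Phi (a *: v + w)) h x = a *: chom (Phi v) h x + chom (Phi w) h x,
      forall v k, k != n -> k != n.+1 -> vanish_on (G k) (Phi v),
      forall beta : collHom P O 1,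
        (forall k, k != n -> k != n.+1 -> vanish_on (G k) beta) ->
        exists! v, forall q (i j : int) (h : i + 1 = j) (x : P q i),
          chom (Phi v) h x = chom beta h x &
      forall (v : 'rV[K]_N) (alpha' : collHom P O 1),
        (forall k, (k < n)%N -> eq_on (G k) alpha' alpha) ->
        eq_on (G n) alpha' (Phi v) -> eq_on (G n.+1) alpha' (Phi v) ->
        is_sprout G n.+1 alpha' <-> v *m A = b].

End Algebra.

Section BaseChange.
Variables (K L : fieldType) (phi : {rmorphism K -> L}).

Section Module.
Definition semilinear (V : lmodType K) (U : lmodType L) (g : V -> U) : Prop :=
  forall a x y, g (a *: x + y) = phi a *: g x + g y.

(* The L-module L (x)_K V, by its universal property. *)
Definition bc (V : lmodType K) : lmodType L := umod (@semilinear V).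
Definition bc_in (V : lmodType K) (x : V) : bc V := ugen (@semilinear V) x.

Lemma bc_inP (V : lmodType K) : semilinear (@bc_in V).
Proof.
move=> a x y; apply: umodP => U g Hg.
have HL := ulift_lin Hg.
by rewrite (HL (phi a) (bc_in x) (bc_in y)) !ulift_gen.
Qed.

Definition bc_map (V W : lmodType K) (f : V -> W) : bc V -> bc W :=
  ulift (fun x => bc_in (f x)).

Definition bc_map2 (V W U : lmodType K) (f : V -> W -> U) (x : bc V) (y : bc W) :
    bc U :=
  ulift (fun v => ulift (fun w => bc_in (f v w)) y) x.

Lemma bc_ext (V : lmodType K) (U : lmodType L) (F G : bc V -> U) :
  linear F -> linear G -> (forall x, F (bc_in x) = G (bc_in x)) -> F =1 G.
Proof. exact: umod_lin_ext. Qed.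

Section Maps.
Variables (V W U : lmodType K) (f : V -> W) (B : V -> W -> U).
Hypothesis Hf : linear f.
Hypothesis HBl : forall y, linear (fun x => B x y).
Hypothesis HBr : forall x, linear (B x).

Lemma bc_adm : semilinear (fun x => bc_in (f x)).
Proof. by move=> a x y; rewrite Hf bc_inP. Qed.

Lemma bc_mapE x : bc_map f (bc_in x) = bc_in (f x).
Proof. exact: (ulift_gen _ bc_adm). Qed.

Lemma bc_map_lin : linear (bc_map f).
Proof. exact: (ulift_lin bc_adm). Qed.

Lemma bc_adm2 v : semilinear (fun w => bc_in (B v w)).
Proof. by move=> a x y; rewrite HBr bc_inP. Qed.

Lemma bc_adm1 (y : bc W) :
  semilinear (fun v => ulift (fun w => bc_in (B v w)) y).
Proof.
move=> a v v'; move: y; apply: bc_ext.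
- exact: (ulift_lin (bc_adm2 _)).
- move=> c y y'; rewrite !(ulift_lin (bc_adm2 _)).
  by rewrite !scalerDr !scalerA mulrC -!scalerA addrACA.
- by move=> w; rewrite !(ulift_gen _ (bc_adm2 _)) HBl bc_inP.
Qed.

Lemma bc_map2_linl y : linear (fun x => bc_map2 B x y).
Proof. exact: (ulift_lin (bc_adm1 y)). Qed.

Lemma bc_map2_linr x : linear (bc_map2 B x).
Proof.
move=> a y y'; move: x; apply: bc_ext.
- exact: (bc_map2_linl (a *: y + y')).
- move=> c x x'; rewrite (bc_map2_linl y) (bc_map2_linl y').
  by rewrite !scalerDr !scalerA mulrC -!scalerA addrACA.
- move=> v; rewrite /bc_map2 !(ulift_gen _ (bc_adm1 _)).
  exact: (ulift_lin (bc_adm2 v)).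
Qed.

Lemma bc_map2E v w : bc_map2 B (bc_in v) (bc_in w) = bc_in (B v w).
Proof. by rewrite /bc_map2 (ulift_gen _ (bc_adm1 _)) (ulift_gen _ (bc_adm2 _)). Qed.
End Maps.

Lemma bc_inZ (V : lmodType K) a (x : V) : bc_in (a *: x) = phi a *: bc_in x.
Proof.
have h0 : bc_in (0 : V) = 0.
  have := bc_inP (-1) (0 : V) 0.
  by rewrite scaler0 add0r rmorphN1 scaleN1r addNr.
by rewrite -[a *: x]addr0 bc_inP h0 addr0.
Qed.

Lemma bc_inD (V : lmodType K) (x y : V) : bc_in (x + y) = bc_in x + bc_in y.
Proof. by rewrite -[x]scale1r bc_inP rmorph1 !scale1r. Qed.

Lemma bc_in0 (V : lmodType K) : bc_in (0 : V) = 0.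
Proof. by rewrite -(scale0r (0 : V)) bc_inZ rmorph0 scale0r. Qed.

Lemma sgn_bc n : phi (sgn K n) = sgn L n.
Proof. by rewrite /sgn rmorphXn rmorphN1. Qed.
End Module.

Section BaseChangeOperad.
Variable O : dgOperad K.
Let mul := @mu _ _ (dgo_str O).

Lemma lin_comp (R : pzRingType) (U V W : lmodType R) (f : V -> W) (g : U -> V) :
  linear f -> linear g -> linear (fun x => f (g x)).
Proof. by move=> hf hg a x y; rewrite hg hf. Qed.

Lemma lin_id (R : pzRingType) (U : lmodType R) : linear (fun x : U => x).
Proof. by []. Qed.

Lemma lin_add (R : pzRingType) (U V : lmodType R) (f g : U -> V) :
  linear f -> linear g -> linear (fun x => f x + g x).
Proof. by move=> hf hg a x y; rewrite hf hg scalerDr addrACA. Qed.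

Lemma lin_scale (R : comPzRingType) (U V : lmodType R) c (f : U -> V) :
  linear f -> linear (fun x => c *: f x).
Proof. by move=> hf a x y; rewrite hf scalerDr !scalerA mulrC. Qed.

Definition bc_V q i : lmodType L := bc (O q i).

Definition bc_act q s (hs : @colperm q s) i : bc_V q i -> bc_V q i :=
  bc_map (@act _ O q s hs i).
Definition bc_dif q (i j : int) (h : i + 1 = j) : bc_V q i -> bc_V q j :=
  bc_map (@dif _ O q i j h).
Definition bc_mu q q1 q2 (t : tree2 q q1 q2) (i j k : int) (h : i + j = k) :
  bc_V q1 i -> bc_V q2 j -> bc_V q k := bc_map2 (mul t h).

Lemma bc_act_lin q s hs i : linear (@bc_act q s hs i).
Proof. exact: (bc_map_lin (@act_lin _ _ _ _ _ _)). Qed.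
Lemma bc_dif_lin q (i j : int) h : linear (@bc_dif q i j h).
Proof. exact: (bc_map_lin (@dif_lin _ _ _ _ _ _)). Qed.
Lemma bc_mu_linl q q1 q2 t (i j k : int) h y :
  linear (fun x => @bc_mu q q1 q2 t i j k h x y).
Proof. exact: (bc_map2_linl (mu_linl _ t h) (mu_linr _ t h)). Qed.
Lemma bc_mu_linr q q1 q2 t (i j k : int) h x :
  linear (@bc_mu q q1 q2 t i j k h x).
Proof. exact: (bc_map2_linr (mu_linl _ t h) (mu_linr _ t h)). Qed.
Lemma bc_actE q s (hs : @colperm q s) i (x : O q i) :
  bc_act hs (bc_in x) = bc_in (act hs x).
Proof. exact: (bc_mapE (@act_lin _ _ _ _ _ _)). Qed.
Lemma bc_difE q (i j : int) (h : i + 1 = j) (x : O q i) :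
  bc_dif h (bc_in x) = bc_in (dif h x).
Proof. exact: (bc_mapE (@dif_lin _ _ _ _ _ _)). Qed.
Lemma bc_muE q q1 q2 (t : tree2 q q1 q2) (i j k : int) (h : i + j = k) x y :
  bc_mu t h (bc_in x) (bc_in y) = bc_in (mul t h x y).
Proof. exact: (bc_map2E (mu_linl _ t h) (mu_linr _ t h)). Qed.

Definition bc_gColl : gColl L.
Proof.
refine (@GColl _ bc_V bc_act bc_act_lin _ _).
- move=> q h1 i; apply: bc_ext; [exact: bc_act_lin | by [] |].
  by move=> x; rewrite bc_actE act1.
- move=> q s t hs ht hst i; apply: bc_ext; first exact: bc_act_lin.
    by apply: lin_comp; exact: bc_act_lin.
  by move=> x; rewrite !bc_actE (actM hs ht).
Defined.

Definition bc_dgColl : dgColl L.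
Proof.
refine (@DGColl _ bc_gColl bc_dif bc_dif_lin _ _).
- move=> q i j k h h'; apply: bc_ext.
  + by apply: lin_comp; exact: bc_dif_lin.
  + by move=> a x y; rewrite scaler0 addr0.
  + by move=> x; rewrite !bc_difE dif_dif bc_in0.
- move=> q s hs i j h; apply: bc_ext.
  + by apply: lin_comp; [exact: bc_dif_lin | exact: bc_act_lin].
  + by apply: lin_comp; [exact: bc_act_lin | exact: bc_dif_lin].
  + by move=> x; rewrite /= bc_actE !bc_difE bc_actE dif_act.
Defined.

Lemma bc_mu_act q q1 q2 (t t' : tree2 q q1 q2) s s1 s2
  (hs : colperm s) (hs1 : colperm s1) (hs2 : colperm s2) :
  tree2_iso s s1 s2 t t' -> forall (i j k : int) (h : i + j = k) x y,
  bc_mu t' h (bc_act hs1 x) (bc_act hs2 y) = bc_act hs (bc_mu t h x y).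
Proof.
move=> E i j k h x; apply: bc_ext.
- apply: lin_comp; [exact: bc_mu_linr | exact: bc_act_lin].
- apply: lin_comp; [exact: bc_act_lin | exact: bc_mu_linr].
move=> w; move: x; apply: bc_ext.
- apply: (lin_comp (bc_mu_linl _ _ _)); exact: bc_act_lin.
- apply: (lin_comp (@bc_act_lin _ _ _ _)); exact: bc_mu_linl.
by move=> v; rewrite !bc_actE !bc_muE bc_actE /mul (mu_act _ _ _ _ E).
Qed.

Lemma bc_mu_stacked q m m' q0 q1 q2 (u : tree2 q m q2) (t : tree2 m q0 q1)
    (u' : tree2 q q0 m') (t' : tree2 m' q1 q2) : stacked u t u' t' ->
  forall (i j l ij jl k : int) (hij : i + j = ij) (hjl : j + l = jl)
    (h : ij + l = k) (h' : i + jl = k) x y z,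
  bc_mu u h (bc_mu t hij x y) z = bc_mu u' h' x (bc_mu t' hjl y z).
Proof.
move=> E i j l ij jl k hij hjl h h' x y; apply: bc_ext.
- exact: bc_mu_linr.
- apply: lin_comp; exact: bc_mu_linr.
move=> z; move: y; apply: bc_ext.
- apply: (lin_comp (bc_mu_linl _ _ _)); exact: bc_mu_linr.
- apply: (lin_comp (bc_mu_linr _ _ _)); exact: bc_mu_linl.
move=> y; move: x; apply: bc_ext.
- apply: (lin_comp (bc_mu_linl _ _ _)); exact: bc_mu_linl.
- exact: bc_mu_linl.
by move=> x; rewrite !bc_muE /mul (mu_stacked _ E hij hjl h h').
Qed.

Lemma bc_mu_parallel q m m' q0 q1 q2 (u : tree2 q m q2) (t : tree2 m q0 q1)
    (u' : tree2 q m' q1) (t' : tree2 m' q0 q2) : parallel u t u' t' ->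
  forall (i j l ij il k : int) (hij : i + j = ij) (hil : i + l = il)
    (h : ij + l = k) (h' : il + j = k) x y z,
  bc_mu u h (bc_mu t hij x y) z =
  sgn L j ^+ `|l|%N *: bc_mu u' h' (bc_mu t' hil x z) y.
Proof.
move=> E i j l ij il k hij hil h h' x y; apply: bc_ext.
- exact: bc_mu_linr.
- apply: lin_scale; apply: (lin_comp (bc_mu_linl _ _ _)); exact: bc_mu_linr.
move=> z; move: y; apply: bc_ext.
- apply: (lin_comp (bc_mu_linl _ _ _)); exact: bc_mu_linr.
- apply: lin_scale; exact: bc_mu_linr.
move=> y; move: x; apply: bc_ext.
- apply: (lin_comp (bc_mu_linl _ _ _)); exact: bc_mu_linl.
- apply: lin_scale; apply: (lin_comp (bc_mu_linl _ _ _)); exact: bc_mu_linl.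
move=> x; rewrite !bc_muE /mul (mu_parallel _ E hij hil h h').
by rewrite bc_inZ rmorphXn sgn_bc.
Qed.

Definition bc_oid c : bc_gColl (ucor c) 0 := bc_in (oid (dgo_str O) c).

Definition bc_str : operad_on bc_gColl.
Proof.
refine (@OperadOn _ bc_gColl bc_mu bc_oid bc_mu_linl bc_mu_linr
  bc_mu_act bc_mu_stacked bc_mu_parallel _ _).
- move=> q c t E i h; apply: bc_ext; [exact: bc_mu_linr | by [] |].
  by move=> x; rewrite bc_muE /mul mu_idl.
- move=> q c t E i h; apply: bc_ext; [exact: bc_mu_linl | by [] |].
  by move=> x; rewrite bc_muE /mul mu_idr.
Defined.

Definition base_change : dgOperad L.
Proof.
refine (@DGOperad _ bc_dgColl bc_str _ _).
- by move=> c j h; rewrite /= bc_difE dif_oid bc_in0.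
move=> q q1 q2 t i j k i' j' k' h hi hj hk h1 h2 x; apply: bc_ext => /=.
- apply: lin_comp; [exact: bc_dif_lin | exact: bc_mu_linr].
- apply: lin_add; first exact: bc_mu_linr.
  by apply: lin_scale; apply: lin_comp; [exact: bc_mu_linr | exact: bc_dif_lin].
move=> y; move: x; apply: bc_ext.
- apply: lin_comp; [exact: bc_dif_lin | exact: bc_mu_linl].
- apply: lin_add.
    apply: (lin_comp (bc_mu_linl _ _ _)); exact: bc_dif_lin.
  apply: lin_scale; exact: bc_mu_linl.
move=> x; rewrite bc_muE !bc_difE !bc_muE /mul (dif_mu t h hi hj hk h1 h2).
by rewrite bc_inD bc_inZ sgn_bc.
Defined.
End BaseChangeOperad.
End BaseChange.
End Colored.

Arguments gColl {disp} Xi K.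
Arguments dgColl {disp} Xi K.
Arguments operad {disp} Xi K.
Arguments dgOperad {disp} Xi K.
Arguments pseudoCooperad {disp} Xi K.

(* Main.v *)
From HB Require Import structures.
From Stdlib Require Import Relation_Operators.
From mathcomp Require Import all_boot all_order all_algebra fingroup perm.
From mathcomp Require Import boolp classical_sets fsbigop functions ring zify.
Require Import Defs.

(** The obstruction to passing from weight n to n+1 is a class that may be nonzero, which is why
    weight n has to change too. Euler's trick shows that such a change suffices: the obstruction
    sits in order n - 1 of lambda, so differentiating multiplies it by n - 1, invertible in
    characteristic 0, while dF/dlambda is a derivation whose effect on boundaries can be controlled.
    Subtracting lambda^p F D is harmless because D commutes with the differential of C in the
    relevant weights: F D d = F d D still vanishes in low orders, and only the values on generators
    improve. Two obstacles shape the rest. P, C and rho live over Q while formality holds over K;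
    hence operads over K are restricted to Q, and maps into them are expanded as finite sums of
    rational maps with coefficients in K independent over Q, to which liftings along rho apply.
    Moreover quasi-isomorphisms have no inverses, so classes are carried along a zigzag by relations
    between cocycles; these induce an automorphism of the cohomology of O (x) K, possibly not the
    identity, which must be undone before the sprout can be compared with rho. *)

(** Say that an operad extends sprouts if every n-th sprout with the prescribed
    cohomology classes can be corrected in weight n so as to extend to weight
    n+1. Seen over Q, this property is invariant under quasi-isomorphism: sprouts
    lift along surjective quasi-isomorphisms, and a quasi-isomorphism A -> B is a
    zigzag of two of these through the operad of pairs of an element of A and a
    path in B[t, dt] starting at its image. By formality it is enough to extend
    sprouts gamma in the cohomology W of O (x) K, which has zero differential.

    There, let F : C -> W[[lambda]] be given by s X |-> lambda^(k-1) gamma X for X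
    of weight k < n. It kills boundaries up to order n - 2, and dF/dlambda is a
    derivation along F. In each order one subtracts from dF/dlambda a derivation
    lambda^p F D, where the derivation D of the cobar construction C lifts a
    closed map into W and exists because rho is a quasi-isomorphism. After n - 1
    steps the first obstruction to extending gamma, multiplied by n - 1, is
    exhibited as the effect of a modification of gamma in weight n.

    Finally, as n >= 2, the curvature in weights <= n+1 is affine in the
    components of weights n and n+1, so these solve a linear system over Q; it is
    finite dimensional, and solvable over K, hence over Q. *)
Set Implicit Arguments.
Unset Strict Implicit.
Unset Printing Implicit Defensive.

Import Order.TTheory GRing.Theory.
Local Open Scope ring_scope.

Arguments om_lin {disp Xi K A B} o {q i} a x y.
Arguments act_lin {disp Xi K g q s} hs {i} a x y.

(** * Sweedler expansions and weight projections *)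

Section RawSums.
Variables (K : pzRingType) (U V : lmodType K) (f : U -> V).
Hypothesis Hf : linear f.

Lemma raw_sum I (r : seq I) (Q : pred I) (F : I -> U) :
  f (\sum_(i <- r | Q i) F i) = \sum_(i <- r | Q i) f (F i).
Proof. exact: (big_morph f (rawD Hf) (raw0 Hf)). Qed.

Lemma rawN x : f (- x) = - f x.
Proof. by rewrite -scaleN1r (rawZ Hf) scaleN1r. Qed.
End RawSums.

Section Sweedler.
Context {disp : Order.disp_t} {Xi : orderType disp} {K : fieldType}.
Variables (P : pseudoCooperad Xi K) (G : nat -> collSet P).
Hypotheses (Ggr : is_grading G) (Gfin : forall k, findim_collSet (G k)).

(** One summand of a comultiplication in Sweedler notation, kept together with its tree, so that one
    list of terms can mix trees, corollas and degrees. *)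
Record term (q : corolla) (i : int) := Term {
  tm1 : corolla; tm2 : corolla; tmt : tree2 q tm1 tm2;
  tma : int; tmb : int; tmh : tma + tmb = i;
  tmy : P tm1 tma; tmz : P tm2 tmb }.

(** The contribution of one term to [bullet f g]; the sign comes from moving [g], of degree 1, past
    the first tensor factor. *)
Definition term_val (O : dgOperad Xi K) (f g : ghom P O 1) q (i j : int)
    (h : i + (1 + 1) = j) (e : term q i) : O q j :=
  sgn K 1 ^+ `|tma e|%N *: mu (dgo_str O) (tmt e) (deg_hom2 (tmh e) h)
    (f _ _ _ erefl (tmy e)) (g _ _ _ erefl (tmz e)).

Lemma tmap_id (V W : graded K) k (z : gtens V W k) :
  tmap (fun _ x => x) (fun _ x => x) z = z.
Proof.
have adm : tensorFun (fun p : pureTensor V W k =>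
    tens (pt_deg p) (pt_fst p) (pt_snd p)).
  split=> i j h v a x y; apply: umodP => U g Hg.
    by rewrite (ulift_lin Hg) !ulift_gen // (proj1 Hg).
  by rewrite (ulift_lin Hg) !ulift_gen // (proj2 Hg).
move: z; apply: umod_lin_ext => [|//|p]; first exact: (ulift_lin adm).
by rewrite /tmap /tlift (ulift_gen _ adm); case: p.
Qed.

(** Makes the sum over all pairs of corollas in [bullet] genuinely finite, so that its default value
    0 for infinite sums never enters. *)
Lemma grading_vanish m : exists S : seq (@corolla disp Xi),
  forall r, (r <= m)%N -> forall q i (x : P q i), G r x -> q \notin S -> x = 0.
Proof.
elim: m => [|m [S HS]].
  exists [::] => r; rewrite leqn0 => /eqP-> q i x Hx _.
  exact: (G_weight0 Ggr) Hx.
have [s Hs] := (Gfin m.+1).2.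
exists (S ++ map fst s) => r; rewrite leq_eqVlt => /orP[/eqP->|Hr] q i x Hx.
  rewrite mem_cat negb_or => /andP[_ /negP Hn].
  case: (eqVneq x 0) => [//|/eqP hx].
  by case: Hn; apply/mapP; exists (q, i) => //; apply: Hs Hx hx.
by rewrite mem_cat negb_or => /andP[hn _]; exact: HS Hr _ _ _ Hx hn.
Qed.

Lemma bullet_adm (O : dgOperad Xi K) (f g : collHom P O 1)
    q q1 q2 (t : tree2 q q1 q2) (i j : int) (h : i + (1 + 1) = j) :
  tensorFun (fun p : pureTensor (P q1) (P q2) i =>
    sgn K 1 ^+ `|pt_i p|%N *: mu (dgo_str O) t (deg_hom2 (pt_deg p) h)
      (chom f erefl (pt_fst p)) (chom g erefl (pt_snd p))).
Proof.
split=> a b hab v c x y /=.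
  rewrite (chom_lin f) (mu_linl _ t) scalerDr.
  by rewrite (scalerA _ c) [in LHS]mulrC -scalerA.
rewrite (chom_lin g) (mu_linr _ t) scalerDr.
by rewrite (scalerA _ c) [in LHS]mulrC -scalerA.
Qed.

Lemma Delta_weight m q q1 q2 (t : tree2 q q1 q2) i (x : P q i) : G m x ->
  exists (n : nat) (p : 'I_n -> pureTensor (P q1) (P q2) i),
    Delta t x = \sum_(l < n) tens (pt_deg (p l)) (pt_fst (p l)) (pt_snd (p l)) /\
    forall l, exists r s, [/\ (r + s)%N = m,
      G r (pt_fst (p l)) & G s (pt_snd (p l))].
Proof.
move=> Hx; have := G_Delta Ggr Hx (DGraft t (DCor q1) (DCor q2)).
by rewrite /= tmap_id.
Qed.

(** The expansion is chosen once for [x], before the operad and the two maps; products of different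
    maps can therefore be compared term by term. *)
Lemma Delta_rep m q i (x : P q i) : G m x ->
  exists (I : finType) (Q : pred I) (e : I -> term q i),
    (forall k, exists r s, [/\ (r + s)%N = m, G r (tmy (e k)) & G s (tmz (e k))]) /\
    forall (O : dgOperad Xi K) (f g : collHom P O 1) j (h : i + (1 + 1) = j),
      bullet f g h x = \sum_(k | Q k) term_val f g h (e k).
Proof.
move=> Hx; have [S HS] := grading_vanish m.
pose SS := undup [seq (a, b) | a <- S, b <- S].
pose pr (l : 'I_(size SS)) := tnth (in_tuple SS) l.
have Hw q1 q2 (t : tree2 q q1 q2) := cid (Delta_weight t Hx).
pose n q1 q2 t := projT1 (Hw q1 q2 t).
have Hp q1 q2 t := cid (projT2 (Hw q1 q2 t)).
pose p q1 q2 t : 'I_(n q1 q2 t) -> _ := projT1 (Hp q1 q2 t).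
have Hp2 q1 q2 t := projT2 (Hp q1 q2 t).
pose J (l : 'I_(size SS)) : finType :=
  {t : tree2 q (pr l).1 (pr l).2 & 'I_(n _ _ t)}.
pose Q (k : {l : 'I_(size SS) & J l}) := canonical_tree2 (tag (tagged k)).
pose e (k : {l : 'I_(size SS) & J l}) : term q i :=
  let w := p _ _ (tag (tagged k)) (tagged (tagged k)) in
  Term (tag (tagged k)) (pt_deg w) (pt_fst w) (pt_snd w).
exists {l : 'I_(size SS) & J l}, Q, e; split=> [k|O f g j h].
  by have [_ /(_ (tagged (tagged k)))] := Hp2 _ _ (tag (tagged k)).
pose F (c : corolla * corolla) := \sum_(t : tree2 q c.1 c.2 | canonical_tree2 t)
  \sum_(l < n _ _ t) term_val f g h
    (Term t (pt_deg (p _ _ t l)) (pt_fst (p _ _ t l)) (pt_snd (p _ _ t l))).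
have HF c : (\sum_(t : tree2 q c.1 c.2 | canonical_tree2 t)
    tlift (fun a b h' y z => sgn K 1 ^+ `|a|%N *:
       mu (dgo_str O) t (deg_hom2 h' h)
         (chom f (erefl (a + 1)) y) (chom g (erefl (b + 1)) z)) (Delta t x)) = F c.
  apply: eq_bigr => t _; rewrite (Hp2 _ _ t).1.
  have adm := bullet_adm f g t h.
  rewrite /tlift (raw_sum (ulift_lin adm)); apply: eq_bigr => l _.
  by rewrite (ulift_gen _ adm).
rewrite /bullet; under eq_fsbigr => c _ do rewrite HF.
(* Outside [SS] one of the two corollas is not in [S]; the corresponding tensor factor has weight at
   most m, so it vanishes. *)
rewrite -(@fsbig_widen _ _ _ _ [set` SS]%classic) //; last first.
  move=> [c1 c2] /= [_] Hc; rewrite /F big1 // => t _; rewrite big1 // => l _.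
  have [_ /(_ l) [r [s [Hrs Hr Hs]]]] := Hp2 _ _ t.
  have [/andP[h1 h2]|] := boolP ((c1 \in S) && (c2 \in S)).
    by case: Hc; rewrite mem_undup; apply/allpairsP; exists (c1, c2).
  rewrite negb_and /term_val => /orP[hc|hc] /=.
    have -> : pt_fst (p _ _ t l) = 0.
      by apply: HS Hr hc; rewrite -Hrs leq_addr.
    by rewrite (raw0 (chom_lin f _)) (raw0 (mu_linl _ _ _ _)) scaler0.
  have -> : pt_snd (p _ _ t l) = 0.
    by apply: HS Hs hc; rewrite -Hrs leq_addl.
  by rewrite (raw0 (chom_lin g _)) (raw0 (mu_linr _ _ _ _)) scaler0.
rewrite -fsbig_seq ?undup_uniq //.
rewrite big_tnth.
under eq_bigr => l _ do rewrite /F (sig_big_dep _ _ _).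
rewrite (sig_big_dep _ _ _) /=; apply: eq_bigl => k.
by rewrite /Q andbT.
Qed.
End Sweedler.

(** * Bases and coordinates for finite dimensional subspaces *)

Section Bases.
Variables (K : fieldType) (V : lmodType K).

Definition lin_free N (e : 'I_N -> V) :=
  forall c : 'rV[K]_N, \sum_l c 0 l *: e l = 0 -> c = 0.

Lemma lin_free_le (s : seq V) N (e : 'I_N -> V) :
  (forall l, spanned_by s (e l)) -> lin_free e -> (N <= size s)%N.
Proof.
move=> Hs He; pose M : 'M[K]_(N, size s) :=
  \matrix_(l, m) projT1 (cid (Hs l)) m.
have HM l : e l = \sum_m M l m *: tnth (in_tuple s) m.
  rewrite {1}(projT2 (cid (Hs l))).
  by apply: eq_bigr => m _; rewrite mxE.
rewrite leqNgt; apply/negP => Hlt.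
have : kermx M != 0.
  by rewrite kermx_eq0 /row_free neq_ltn (leq_ltn_trans (rank_leq_col M) Hlt).
case/rowV0Pn => c /sub_kermxP cM /negP; apply; apply/eqP/He.
under eq_bigr => l _ do rewrite HM scaler_sumr.
rewrite exchange_big /= big1 // => m _.
under eq_bigr => l _ do rewrite scalerA.
rewrite -scaler_suml; have /matrixP/(_ 0 m) := cM.
by rewrite !mxE => ->; rewrite scale0r.
Qed.

Lemma findim_basis (A : set V) : findim_set A ->
  exists (N : nat) (e : 'I_N -> V), [/\ forall l, A (e l), lin_free e &
    forall x, A x -> exists c : 'rV[K]_N, x = \sum_l c 0 l *: e l].
Proof.
move=> [s Hs].
pose Q N := `[< exists e : 'I_N -> V, (forall l, A (e l)) /\ lin_free e >].
have exQ : exists N, Q N.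
  exists 0%N; apply/asboolP; exists (fun=> 0); split; first by case.
  by move=> c _; apply/rowP; case.
have ubQ N : Q N -> (N <= size s)%N.
  by move=> /asboolP[e [eA ef]]; apply: lin_free_le ef => l; apply: Hs.
case: (ex_maxnP exQ ubQ) => N /asboolP[e [eA ef]] Hmax.
exists N, e; split=> // x Ax; apply: contrapT => Hx.
suff : Q N.+1 by move/Hmax; rewrite ltnn.
apply/asboolP; exists (fun l => if unlift ord0 l is Some m then e m else x).
split=> [l|c]; first by case: unliftP.
rewrite big_ord_recl unlift_none.
under eq_bigr => l _ do rewrite liftK.
have [c0|c0 E] := eqVneq (c 0 ord0) 0.
  rewrite c0 scale0r add0r => E; pose c' : 'rV_N := \row_l c 0 (lift ord0 l).
  have /rowP Hc' : c' = 0.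
    by apply: ef; rewrite -[RHS]E; apply: eq_bigr => l _; rewrite mxE.
  apply/rowP => l; rewrite mxE; case: (unliftP ord0 l) => [m ->|->] //.
  by have := Hc' m; rewrite !mxE.
case: Hx; exists (\row_l (- (c 0 ord0)^-1 * c 0 (lift ord0 l))).
under eq_bigr => l _ do rewrite mxE -scalerA.
rewrite -scaler_sumr; move/eqP: E; rewrite addr_eq0 => /eqP E.
apply: (scalerI c0); rewrite E scalerA mulrN divff // scaleN1r.
by [].
Qed.

(** Off [A] the coordinates are arbitrary choices; on [A] the freeness of the family makes them
    unique, hence linear. *)
Lemma findim_coord (A : set V) : findim_set A ->
  (forall a x y, A x -> A y -> A (a *: x + y)) ->
  exists (N : nat) (e : 'I_N -> V) (co : V -> 'rV[K]_N),
  [/\ forall l, A (e l), lin_free e, forall x, A x -> x = \sum_l co x 0 l *: e l &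
   forall a x y, A x -> A y -> co (a *: x + y) = a *: co x + co y].
Proof.
move=> /findim_basis [N [e [eA ef eS]]] Alin.
have Hc x : exists c : 'rV[K]_N, A x -> x = \sum_l c 0 l *: e l.
  case: (pselect (A x)) => [/eS[c Hc]|nA]; first by exists c.
  by exists 0 => /nA.
pose co x := projT1 (cid (Hc x)).
have Hco x : A x -> x = \sum_l co x 0 l *: e l := projT2 (cid (Hc x)).
exists N, e, co; split=> // a x y Ax Ay; apply/eqP; rewrite -subr_eq0.
apply/eqP; apply: ef.
transitivity (\sum_l co (a *: x + y) 0 l *: e l -
    (a *: (\sum_l co x 0 l *: e l) + \sum_l co y 0 l *: e l)).
  rewrite scaler_sumr -big_split /= -sumrB; apply: eq_bigr => l _.
  by rewrite !mxE scalerBl scalerDl scalerA.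
by rewrite -(Hco x Ax) -(Hco y Ay) -(Hco _ (Alin a x y Ax Ay)) subrr.
Qed.
End Bases.

Section Projections.
Context {disp : Order.disp_t} {Xi : orderType disp} {K : fieldType}.
Variables (P : pseudoCooperad Xi K) (G : nat -> collSet P).
Hypotheses (Ggr : is_grading G).

Lemma proj_ex q i (x : P q i) : exists (n : nat) (y : nat -> P q i),
  [/\ forall k, G k (y k), forall k, (n <= k)%N -> y k = 0 &
      x = \sum_(k < n) y k].
Proof.
have [n [y [Gy ->]]] := G_dec Ggr x.
exists n, (fun k => if (k < n)%N then y k else 0); split=> [k|k|].
- by case: ifP => _ //; apply: (G_sub0 Ggr).
- by rewrite leqNgt => /negbTE->.
- by apply: eq_bigr => k _; rewrite ltn_ord.
Qed.

Definition proj k q i (x : P q i) : P q i :=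
  projT1 (cid (projT2 (cid (proj_ex x)))) k.

Lemma proj_widen q i (n m : nat) (y : nat -> P q i) : (n <= m)%N ->
  (forall k, (n <= k)%N -> y k = 0) -> \sum_(k < n) y k = \sum_(k < m) y k.
Proof.
move=> nm y0; rewrite (big_ord_widen m _ nm) big_mkcond /=.
by apply: eq_bigr => k _; case: ltnP => // /y0.
Qed.

Lemma projG k q i (x : P q i) : G k (proj k x).
Proof. by rewrite /proj; case: cid => n /= Hn; case: cid => y []. Qed.

Lemma proj_spec q i (x : P q i) : exists n : nat,
  (forall k, (n <= k)%N -> proj k x = 0) /\ forall m, (n <= m)%N -> x = \sum_(k < m) proj k x.
Proof.
rewrite /proj; case: cid => n /= Hn; case: cid => y [Gy y0 E] /=.
by exists n; split=> // m nm; rewrite E; apply: proj_widen.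
Qed.

(** Independence of the weights. The decompositions are only known to exist, so every property of
    [proj] is obtained by exhibiting the expected decomposition here. *)
Lemma proj_unique q i (x : P q i) n (y : nat -> P q i) :
  (forall k, G k (y k)) -> (forall k, (n <= k)%N -> y k = 0) ->
  x = \sum_(k < n) y k -> forall k, proj k x = y k.
Proof.
move=> Gy y0 E k; have [m [_ Hm]] := proj_spec x.
pose N := maxn (maxn n m) k.+1.
have nN : (n <= N)%N by rewrite /N !leq_max leqnn.
have mN : (m <= N)%N by rewrite /N !leq_max leqnn orbT.
have kN : (k < N)%N by rewrite /N !leq_max leqnn orbT.
apply/eqP; rewrite -subr_eq0; apply/eqP.
apply: (@G_indep _ _ _ _ _ Ggr _ _ N (fun k => proj k x - y k)) => //.
  move=> l; rewrite addrC -scaleN1r; apply: (G_lin Ggr) => //; exact: projG.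
by rewrite sumrB -(Hm _ mN) E (proj_widen nN y0) subrr.
Qed.

Lemma proj_lin k q i : linear (@proj k q i).
Proof.
move=> a x y; have [n [n0 Hn]] := proj_spec x; have [m [m0 Hm]] := proj_spec y.
pose N := maxn n m.
apply: (@proj_unique _ _ _ N (fun k => a *: proj k x + proj k y)) => [l|l|].
- by apply: (G_lin Ggr); exact: projG.
- rewrite /N geq_max => /andP[nl ml].
  by rewrite n0 // m0 // scaler0 addr0.
rewrite big_split /= -scaler_sumr -Hn ?leq_maxl // -Hm ?leq_maxr //.
Qed.

Lemma proj_act k q s (hs : @colperm _ _ q s) i (x : P q i) :
  proj k (act hs x) = act hs (proj k x).
Proof.
have [n [n0 Hn]] := proj_spec x.
apply: (@proj_unique _ _ _ n (fun k => act hs (proj k x))) => [l|l nl|].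
- by apply: (G_act Ggr); exact: projG.
- by rewrite n0 // (raw0 (act_lin _)).
by rewrite {1}(Hn n) // (raw_sum (act_lin _)).
Qed.

Lemma proj_G k l q i (x : P q i) : G k x -> proj l x = if l == k then x else 0.
Proof.
move=> Hx; apply: (@proj_unique _ _ _ k.+1 (fun l => if l == k then x else 0)).
- by move=> m; case: eqP => [->|_] //; apply: (G_sub0 Ggr).
- by move=> m; rewrite ltn_neqAle eq_sym => /andP[/negbTE->].
rewrite big_ord_recr /= eqxx big1 ?add0r // => m _.
by rewrite ltn_eqF // ltn_ord.
Qed.

Lemma proj_id k q i (x : P q i) : G k x -> proj k x = x.
Proof. by move=> /(proj_G k); rewrite eqxx. Qed.

Lemma proj_neq k l q i (x : P q i) : G k x -> l != k -> proj l x = 0.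
Proof. by move=> /(proj_G l) -> /negbTE->. Qed.

Definition trunc_proj N q i (x : P q i) := \sum_(k < N) proj k x.

Lemma trunc_proj_lin N q i : linear (@trunc_proj N q i).
Proof.
move=> d x y; rewrite /trunc_proj scaler_sumr -big_split; apply: eq_bigr => k _ /=.
exact: proj_lin.
Qed.

Lemma trunc_proj_act N q t (ht : @colperm _ _ q t) i (x : P q i) :
  trunc_proj N (act ht x) = act ht (trunc_proj N x).
Proof.
rewrite /trunc_proj (raw_sum (act_lin _)); apply: eq_bigr => k _.
exact: proj_act.
Qed.

Lemma trunc_projG N k q i (x : P q i) : G k x ->
  trunc_proj N x = if (k < N)%N then x else 0.
Proof.
move=> Gx; rewrite /trunc_proj; case: ltnP => [kN|Nk].
  rewrite (bigD1 (Ordinal kN)) //= (proj_id Gx) big1 ?addr0 // => l Hl.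
  by rewrite (proj_neq Gx).
rewrite big1 // => l _; rewrite (proj_neq Gx) //.
by rewrite neq_ltn (leq_trans (ltn_ord l) Nk).
Qed.

End Projections.

(** * Equivariant linear choices by averaging *)

Section EquivariantSection.
Context {disp : Order.disp_t} {Xi : orderType disp}.
Variables (P : pseudoCooperad Xi rat) (G : nat -> collSet P).
Hypotheses (Ggr : is_grading G) (Gfin : forall k, findim_collSet (G k)).

Lemma colperm1 q : @colperm _ Xi q 1%g.
Proof. by apply/forallP => l; rewrite perm1. Qed.

Lemma colpermV q s : @colperm _ Xi q s -> colperm s^-1%g.
Proof.
by move=> /forallP hs; apply/forallP => l; rewrite -{2}[l](permKV s) eq_sym.
Qed.

Lemma colpermM q s t : @colperm _ Xi q s -> colperm t -> colperm (s * t)%g.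
Proof.
move=> /forallP hs /forallP ht; apply/forallP => l.
by rewrite permM (eqP (ht _)) (eqP (hs _)).
Qed.

Lemma act_irr (W : gColl Xi rat) q s s' (hs : @colperm _ _ q s)
  (hs' : colperm s') i (x : W q i) : s = s' -> act hs x = act hs' x.
Proof. by move=> E; subst s'; rewrite (bool_irrelevance hs hs'). Qed.

(* A linear choice made on a basis becomes equivariant after averaging over the
   color preserving permutations. *)
Lemma equivariant_section (W : gColl Xi rat) (e : int) (k : nat)
    (T : forall q (i j : int), i + e = j -> P q i -> W q j -> Prop)
    (a0 : collHom P W e) :
  (forall q (i j : int) (h : i + e = j) c x y x' y', T q i j h x y -> T q i j h x' y' ->
     T q i j h (c *: x + x') (c *: y + y')) ->
  (forall q (i j : int) (h : i + e = j) s (hs : colperm s) x y, T q i j h x y ->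
     T q i j h (act hs x) (act hs y)) ->
  (forall q (i j : int) (h : i + e = j) x, G k x -> exists y, T q i j h x y) ->
  exists a : collHom P W e,
    (forall l, l != k -> eq_on (@G l) a a0) /\ forall q (i j : int) (h : i + e = j) x, G k x -> T q i j h x (chom a h x).
Proof.
move=> Tlin Tact Ttot.
have T0 q (i j : int) (h : i + e = j) : T q i j h 0 0.
  have [y Hy] := Ttot q i j h 0 (G_sub0 Ggr _ _ _).
  by have := Tlin _ _ _ h (-1) _ _ _ _ Hy Hy; rewrite !scaleN1r !addNr.
have Tsum q (i j : int) (h : i + e = j) I (r : seq I) (c : I -> rat) x y :
    (forall l, T q i j h (x l) (y l)) ->
    T q i j h (\sum_(l <- r) c l *: x l) (\sum_(l <- r) c l *: y l).
  move=> HT; elim: r => [|l r IH]; first by rewrite !big_nil.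
  by rewrite !big_cons; apply: Tlin.
have Hf q (i j : int) (h : i + e = j) : exists f : P q i -> W q j,
    linear f /\ forall x, G k x -> T q i j h x (f x).
  have [N [b [co [bA bf bE clin]]]] := findim_coord ((Gfin k).1 q i)
    (fun a x y => @G_lin _ _ _ _ _ Ggr k q i a x y).
  pose w l := projT1 (cid (Ttot q i j h _ (bA l))).
  have Hw l : T q i j h (b l) (w l) := projT2 (cid (Ttot q i j h _ (bA l))).
  exists (fun x => \sum_l co (proj Ggr k x) 0 l *: w l); split=> [a x y|x Gx].
    rewrite (proj_lin Ggr) clin; try exact: projG.
    rewrite scaler_sumr -big_split; apply: eq_bigr => l _ /=.
    by rewrite !mxE scalerDl scalerA.
  by rewrite (proj_id Ggr Gx) {1}(bE x Gx); apply: Tsum.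
pose f q (i j : int) h := projT1 (cid (Hf q i j h)).
have flin q (i j : int) h : linear (f q i j h) := (projT2 (cid (Hf q i j h))).1.
have fT q (i j : int) h := (projT2 (cid (Hf q i j h))).2.
pose Gam (q : @corolla _ Xi) := {s : 'S_(arity q) | colperm s}.
pose n q : rat := #|{: Gam q}|%:R.
have n0 q : n q != 0.
  rewrite Num.Theory.pnatr_eq0 -lt0n; apply/card_gt0P.
  by exists (exist (fun u => colperm u) 1%g (colperm1 q)).
pose g q (i j : int) h x : W q j :=
  (n q)^-1 *: \sum_(s : Gam q) act (colpermV (valP s)) (f q i j h (act (valP s) x)).
have glin q (i j : int) h : linear (g q i j h).
  move=> a x y; rewrite /g scalerA [in RHS]mulrC -scalerA -scalerDr.
  congr (_ *: _); rewrite scaler_sumr -big_split.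
  by apply: eq_bigr => s _; rewrite act_lin flin act_lin.
have gact q s (hs : @colperm _ _ q s) (i j : int) h x : g q i j h (act hs x) = act hs (g q i j h x).
  rewrite /g (rawZ (act_lin _)) (raw_sum (act_lin _)).
  congr (_ *: _).
  pose m (t : Gam q) : Gam q := exist (fun u => colperm u) _ (colpermM hs (valP t)).
  have mI : injective m.
    move=> [t ht] [u hu] /(congr1 val) /= /mulgI E.
    by apply: val_inj.
  rewrite [RHS](reindex_inj mI) /=; apply: eq_bigr => t _.
  rewrite (actM hs (valP t) (valP (m t))).
  rewrite -(actM (colpermV (valP (m t))) hs (colpermM (colpermV (valP (m t))) hs)).
  by apply: act_irr; rewrite /= invMg -mulgA mulVg mulg1.
have gT q (i j : int) h x : G k x -> T q i j h x (g q i j h x).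
  move=> Gx.
  (* As [T] is a linear relation, it suffices to write [x] itself as an average of copies of [x] and
     to relate the two averages summand by summand. *)
  have {1}-> : x = \sum_(s : Gam q) (n q)^-1 *: x.
    by rewrite -scaler_sumr sumr_const -scaler_nat scalerA mulVf ?scale1r.
  rewrite /g scaler_sumr; apply: Tsum => s.
  have := Tact _ _ _ h _ (colpermV (valP s)) _ _
    (fT _ _ _ h _ (G_act Ggr (valP s) Gx)).
  rewrite -(actM (valP s) _ (colpermM (valP s) (colpermV (valP s)))).
  move: (colpermM _ _); rewrite mulgV => h1; by rewrite act1.
pose a q (i j : int) (h : i + e = j) x : W q j :=
  chom a0 h (x - proj Ggr k x) + g q i j h (proj Ggr k x).
have alin q (i j : int) h : linear (a q i j h).
  move=> c x y; rewrite /a (proj_lin Ggr) glin opprD addrACA -scalerBr.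
  by rewrite (chom_lin a0) scalerDr addrACA.
have aact q s (hs : @colperm _ _ q s) (i j : int) h x : a q i j h (act hs x) = act hs (a q i j h x).
  rewrite /a proj_act -(rawB (act_lin _)) chom_act gact.
  by rewrite (rawD (act_lin _)).
exists (CollHom alin aact); split=> [l lk q i x Gx j h|q i j h x Gx] /=.
  rewrite /a (proj_neq Ggr Gx) 1?eq_sym // subr0 (raw0 (glin _ _ _ _)) addr0.
  by [].
rewrite /a (proj_id Ggr Gx) subrr (raw0 (chom_lin a0 _)) add0r.
exact: gT.
Qed.
End EquivariantSection.

(** * Curvature and maps out of the cobar construction *)

Section Composition.
Context {disp : Order.disp_t} {Xi : orderType disp} {K : fieldType}.

Definition operad_comp (A B D : operad Xi K) (g : operad_map B D)
    (f : operad_map A B) : operad_map A D.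
Proof.
refine (@OperadMap _ _ _ A D (fun q i x => g q i (f q i x)) _ _ _ _).
- by move=> q i; apply: lin_comp; exact: om_lin.
- by move=> q s hs i x; rewrite !om_act.
- by move=> q q1 q2 t i j k h x y; rewrite !om_mu.
- by move=> c; rewrite !om_oid.
Defined.

Definition hom_comp (P A B : gColl Xi K) (e : int)
    (g : forall q i, A q i -> B q i)
    (glin : forall q i, linear (g q i))
    (gact : forall q s (hs : @colperm _ _ q s) i x,
       g q i (act hs x) = act hs (g q i x))
    (f : collHom P A e) : collHom P B e.
Proof.
refine (@CollHom _ _ _ _ _ _ (fun q i j h x => g q j (chom f h x)) _ _).
- by move=> q i j h; apply: lin_comp; [exact: glin | exact: chom_lin].
- by move=> q s hs i j h x; rewrite chom_act gact.
Defined.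

Definition push (P : gColl Xi K) (A B : operad Xi K) (g : operad_map A B)
  (f : collHom P A 1) : collHom P B 1 := hom_comp (@om_lin _ _ _ _ _ g) (@om_act _ _ _ _ _ g) f.

Lemma pushE (P : gColl Xi K) (A B : operad Xi K) (g : operad_map A B)
  (f : collHom P A 1) q (i j : int) (h : i + 1 = j) x :
  chom (push g f) h x = g q j (chom f h x).
Proof. by []. Qed.
Definition precomp (P A : gColl Xi K) (f : forall q i, P q i -> P q i)
    (fl : forall q i, linear (f q i))
    (fa : forall q t (ht : @colperm _ _ q t) i x, f q i (act ht x) = act ht (f q i x))
    (a : collHom P A 1) : collHom P A 1.
Proof.
refine (@CollHom _ _ _ P A 1 (fun q i j h x => chom a h (f q i x)) _ _).
- by move=> q i j h c x y; rewrite fl chom_lin.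
- by move=> q t ht i j h x; rewrite fa chom_act.
Defined.
End Composition.

Section Curvature.
Context {disp : Order.disp_t} {Xi : orderType disp}.
Variables (P : pseudoCooperad Xi rat) (G : nat -> collSet P).
Hypotheses (Ggr : is_grading G) (Gfin : forall k, findim_collSet (G k)).

Lemma sgn1 (K : fieldType) : sgn K 1 = -1.
Proof. by rewrite /sgn expr1. Qed.

(** In degree 1 the two halves of the bracket of [f] with itself coincide, so the factor 1/2
    cancels. *)
Lemma curvE (A : dgOperad Xi rat) (f : collHom P A 1) q (i j : int)
    (h : i + (1 + 1) = j) (x : P q i) :
  curv f h x = dif (deg_hom h) (chom f erefl x) +
    chom f (deg_hom1 h) (dif erefl x) + bullet f f h x.
Proof.
rewrite /curv /bracket /conv_dif.
rewrite (_ : deg_homC h = h); last exact: eq_irrelevance.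
by rewrite !sgn1 expr1 !scaleN1r !opprK -mulr2n -scaler_nat scalerA mulVf ?scale1r.
Qed.

(** Since weight 0 is zero, terms with a factor of weight 0 may be dropped. The remaining factors
    both have weight strictly below m, which drives all inductions on the weight. *)
Lemma Delta_rep_pos m q i (x : P q i) : G m x ->
  exists (I : finType) (Q : pred I) (e : I -> term P q i),
    (forall k, Q k -> exists r s, [/\ (r + s)%N = m, (0 < r)%N, (0 < s)%N,
       G r (tmy (e k)) & G s (tmz (e k))]) /\
    forall (O : dgOperad Xi rat) (f g : collHom P O 1) j (h : i + (1 + 1) = j),
      bullet f g h x = \sum_(k | Q k) term_val f g h (e k).
Proof.
move=> /(Delta_rep Ggr Gfin) [I [Q [e [He HB]]]].
exists I, (fun k => Q k && ((tmy (e k) != 0) && (tmz (e k) != 0))), e; split.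
  move=> k /andP[_ /andP[y0 z0]]; have [r [s [Hrs Hr Hs]]] := He k.
  exists r, s; split=> //.
    by case: r Hr {Hrs} => // /(G_weight0 Ggr) E; rewrite E eqxx in y0.
  by case: s Hs {Hrs} => // /(G_weight0 Ggr) E; rewrite E eqxx in z0.
move=> O f g j h; rewrite HB.
rewrite (bigID (fun k => (tmy (e k) != 0) && (tmz (e k) != 0))) /=.
rewrite [X in _ + X]big1 ?addr0 // => k /andP[_].
rewrite negb_and !negbK /term_val => /orP[] /eqP->.
  by rewrite (raw0 (chom_lin f _)) (raw0 (mu_linl _ _ _ _)) scaler0.
by rewrite (raw0 (chom_lin g _)) (raw0 (mu_linr _ _ _ _)) scaler0.
Qed.

Variables (C : dgOperad Xi rat) (s : collHom P C 1).
Hypothesis Ccobar : is_cobar s.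

(** The map of graded operads with [s x] sent to [f x]; its compatibility with the differentials is
    exactly what the curvature of [f] measures. *)
Definition ext (A : operad Xi rat) (f : collHom P A 1) :
  operad_map (dgo_operad C) A := s2val (cid2 (Ccobar.1 A f)).

Lemma extE (A : operad Xi rat) (f : collHom P A 1) q (i j : int) (h : i + 1 = j) x :
  ext f q j (chom s h x) = chom f h x.
Proof. by rewrite /ext; case: cid2. Qed.

Lemma ext_unique (A : operad Xi rat) (u v : operad_map (dgo_operad C) A) :
  (forall q (i j : int) (h : i + 1 = j) x, u q j (chom s h x) = v q j (chom s h x)) ->
  forall q i x, u q i x = v q i x.
Proof.
move=> H q i x; have [g _ Hg] := Ccobar.1 A (push u s).
by rewrite (Hg u) // (Hg v) // => *; rewrite pushE H.
Qed.

(* The same tensors expand d (s x) and all pre-Lie products at x. *)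
Lemma ds_expand m q (i j k : int) (h : i + 1 = j) (h' : j + 1 = k)
    (h2 : i + (1 + 1) = k) (x : P q i) : G m x ->
  exists (I : finType) (Q : pred I) (e : I -> term P q i),
   [/\ forall l, Q l -> exists r t, [/\ (r + t)%N = m, (0 < r)%N, (0 < t)%N,
       G r (tmy (e l)) & G t (tmz (e l))],
     dif h' (chom s h x) = - chom s h' (dif h x) -
       \sum_(l | Q l) term_val s s h2 (e l) &
    forall (A : dgOperad Xi rat) (f g : collHom P A 1),
      bullet f g h2 x = \sum_(l | Q l) term_val f g h2 (e l)].
Proof.
move=> /Delta_rep_pos [I [Q [e [He HB]]]]; exists I, Q, e; split=> //.
by rewrite (Ccobar.2 _ _ _ _ h h' h2) HB.
Qed.

Lemma G_dif_pred m q (i j : int) (h : i + 1 = j) (x : P q i) :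
  G m x -> G m.-1 (dif h x).
Proof.
case: m => [/(G_weight0 Ggr) ->|m /(G_dif Ggr)]; last exact.
by rewrite (raw0 (dif_lin _)); apply: (G_sub0 Ggr).
Qed.

Lemma G_dif_vanish q (i j : int) (h : i + 1 = j) (x : P q i) : G 1%N x -> dif h x = 0.
Proof. by move=> /(G_dif_pred h) /(G_weight0 Ggr). Qed.

Lemma term_val_map (A : operad Xi rat) (u : operad_map (dgo_operad C) A) q (i k : int)
   (h : i + (1 + 1) = k) (e : term P q i) :
  u q k (term_val s s h e) = sgn rat 1 ^+ `|tma e|%N *:
    mu (op_str A) (tmt e) (deg_hom2 (tmh e) h)
     (u _ _ (chom s erefl (tmy e))) (u _ _ (chom s erefl (tmz e))).
Proof. by rewrite /term_val (rawZ (om_lin u)) -(om_mu u). Qed.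

(** The boundary of a generator of weight m is built from generators of smaller weight: a linear
    term of weight m - 1 and products of two positive weights with sum m. *)
Lemma ext_local m (A : operad Xi rat) (u v : operad_map (dgo_operad C) A)
   q (i j k : int) (h : i + 1 = j) (h' : j + 1 = k) (x : P q i) : G m x ->
  (forall r, (r < m)%N -> forall q (i j : int) (h : i + 1 = j) (y : P q i), G r y ->
     u q j (chom s h y) = v q j (chom s h y)) ->
  u q k (dif h' (chom s h x)) = v q k (dif h' (chom s h x)).
Proof.
move=> Gx Huv; have h2 : i + (1 + 1) = k by rewrite addrA h.
case: m Gx Huv => [|m] Gx Huv.
  rewrite (G_weight0 Ggr Gx) (raw0 (chom_lin s _)) (raw0 (dif_lin _)).
  by rewrite !(raw0 (om_lin _)).
have [I [Q [e [He -> _]]]] := ds_expand h h' h2 Gx.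
rewrite !(rawB (om_lin _)) !(rawN (om_lin _)).
rewrite (Huv m) //; last exact: (G_dif Ggr).
rewrite !(raw_sum (om_lin _)); congr (_ - _).
apply: eq_bigr => l /He [r [t [E r0 t0 Gr Gt]]].
have rm : (r < m.+1)%N by rewrite -E -addn1 leq_add2l.
have tm : (t < m.+1)%N by rewrite -E -add1n leq_add2r.
by rewrite !term_val_map (Huv r) ?(Huv t).
Qed.

(** By the formula for d (s x), the map F extending [f] sends it to -f(dx) - (f bullet f)(x). The
    curvature is thus d F - F d on generators, and being a sprout becomes a statement about operad
    maps. *)
Lemma curv_ext m (A : dgOperad Xi rat) (f : collHom P A 1) q (i j k : int)
    (h : i + (1 + 1) = k) (h1 : i + 1 = j) (h' : j + 1 = k) (x : P q i) : G m x ->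
  curv f h x = dif h' (chom f h1 x) -
    @ext (dgo_operad A) f q k (dif h' (chom s h1 x)).
Proof.
subst j => Gx; rewrite curvE.
have [I [Q [e [He -> HB]]]] := ds_expand erefl h' h Gx.
rewrite HB !(rawB (om_lin _)) !(rawN (om_lin _)).
rewrite opprB opprK extE (raw_sum (om_lin _)).
rewrite (_ : deg_hom h = h'); last exact: eq_irrelevance.
rewrite (_ : deg_hom1 h = h'); last exact: eq_irrelevance.
rewrite -addrA; congr (_ + _); rewrite addrC; congr (_ + _).
by apply: eq_bigr => l _; rewrite term_val_map !extE.
Qed.

Lemma sproutP N (A : dgOperad Xi rat) (f : collHom P A 1) :
  is_sprout G N f <->
  forall m, (m <= N)%N -> forall q (i j k : int) (h1 : i + 1 = j) (h' : j + 1 = k)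
    (x : P q i), G m x ->
    dif h' (chom f h1 x) = @ext (dgo_operad A) f q k (dif h' (chom s h1 x)).
Proof.
split=> [H m mN q i j k h1 h' x Gx|H m mN q i x Gx k h].
  have h : i + (1 + 1) = k by rewrite addrA h1.
  by apply/eqP; rewrite -subr_eq0 -(curv_ext f h h1 h' Gx); apply/eqP; exact: (H m mN).
have h' : i + 1 + 1 = k by rewrite -addrA.
by rewrite (curv_ext f h erefl h' Gx) (H m) // subrr.
Qed.

Lemma sprout_local N (A : dgOperad Xi rat) (f g : collHom P A 1) :
  (forall k, (k <= N)%N -> eq_on (@G k) f g) -> is_sprout G N f -> is_sprout G N g.
Proof.
move=> Hfg /sproutP H; apply/sproutP => m mN q i j k h1 h' x Gx.
rewrite -(Hfg m) // (H m) //; apply: (@ext_local m _ (@ext (dgo_operad A) f) (@ext (dgo_operad A) g) _ _ _ _ h1 h' _ Gx) => r rm q' i' j' h2 y Gy.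
by rewrite !extE; apply: Hfg Gy _ _; rewrite (leq_trans (ltnW rm)).
Qed.

(* The defect E = d F - F d of the operad map F extending f is a derivation
   along F; it kills s y for y of weight < m, hence it kills d (s x). *)
Lemma obstruction_closed m (A : dgOperad Xi rat) (f : collHom P A 1)
   q (i j k l : int) (h : i + 1 = j) (h' : j + 1 = k) (h'' : k + 1 = l) (x : P q i) :
  G m x -> (forall r, (r < m)%N -> is_sprout G r f) ->
  dif h'' (@ext (dgo_operad A) f q k (dif h' (chom s h x))) = 0.
Proof.
move=> Gx Hf; set F := ext _.
have h2 : i + (1 + 1) = k by rewrite addrA h.
case: m Gx Hf => [|m] Gx Hf.
  rewrite (G_weight0 Ggr Gx) (raw0 (chom_lin s _)) (raw0 (dif_lin _)).
  by rewrite !(raw0 (om_lin _)) (raw0 (dif_lin _)).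
have {}Hf r q' (i' j' k' : int) (h1 : i' + 1 = j') (h1' : j' + 1 = k') (y : P q' i') :
    (r <= m)%N -> G r y -> dif h1' (F q' j' (chom s h1 y)) = F q' k' (dif h1' (chom s h1 y)).
  move=> rm Gy; rewrite /F extE; have /sproutP := Hf m (ltnSn m).
  by move/(_ r rm); apply.
pose E q' (i' j' : int) (h1 : i' + 1 = j') (u : C q' i') :=
  dif h1 (F q' i' u) - F q' j' (dif h1 u).
have Elin q' i' j' h1 : linear (@E q' i' j' h1).
  move=> a u v; rewrite /E (@om_lin _ _ _ _ _ F) !dif_lin (@om_lin _ _ _ _ _ F).
  by rewrite opprD addrACA -scalerBr.
(* As d d = 0 in the cobar construction, the defect at d (s x) reduces to d F (d (s x)). *)
suff : E q k l h'' (dif h' (chom s h x)) = 0.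
  rewrite /E dif_dif (raw0 (om_lin F)) subr0 //.
have [I [Q [e [He -> _]]]] := ds_expand h h' h2 Gx.
rewrite (rawB (Elin _ _ _ _)) (rawN (Elin _ _ _ _)) (raw_sum (Elin _ _ _ _)).
rewrite big1 => [|p /He [r [t [rt r0 t0 Gr Gt]]]].
  by rewrite subr0 /E (Hf m) ?subrr ?oppr0 //; apply: (G_dif Ggr).
rewrite /term_val (rawZ (Elin _ _ _ _)) /E.
have rm : (r <= m)%N by rewrite -ltnS -rt -addn1 leq_add2l.
have tm : (t <= m)%N by rewrite -ltnS -rt -add1n leq_add2r.
set a := tma (e p); set b := tmb (e p).
have h3 : (a + 1 + 1) + (b + 1) = l.
  by rewrite -h'' -h2 -(tmh (e p)) -/a -/b -!addrA; congr (_ + _); rewrite addrCA; congr (_ + _); rewrite addrCA.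
have h4 : (a + 1) + (b + 1 + 1) = l.
  by rewrite -h'' -h2 -(tmh (e p)) -/a -/b -!addrA; congr (_ + _); rewrite addrCA; congr (_ + _).
rewrite (dif_mu (tmt (e p)) _ erefl erefl h'' h3 h4).
rewrite (rawD (om_lin F)) (rawZ (om_lin F)).
rewrite !(om_mu F) (dif_mu (tmt (e p)) _ erefl erefl h'' h3 h4).
by rewrite (Hf r _ _ _ _ _ _ _ rm Gr) (Hf t _ _ _ _ _ _ _ tm Gt) subrr scaler0.
Qed.
End Curvature.

(** * Transfer of the extension property *)

Local Notation cocycle := (@cocycle _ _ _ _ _ _).

Section DgMaps.
Context {disp : Order.disp_t} {Xi : orderType disp} {K : fieldType}.

Lemma coboundaryB (A : dgOperad Xi K) q i (x y : A q i) :
  coboundary x -> coboundary y -> coboundary (x - y).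
Proof.
by move=> hx hy; rewrite addrC -scaleN1r; apply: coboundary_lin.
Qed.

Lemma cocycleE' (A : dgOperad Xi K) q (i j : int) (h : i + 1 = j) (x : A q i) :
  dif h x = 0 -> x \in cocycle.
Proof. by subst j => H; rewrite cocycleE H. Qed.

Lemma dgm_cocycle (A B : dgOperad Xi K) (f : dg_map A B) q i (x : A q i) :
  x \in cocycle -> f q i x \in cocycle.
Proof.
move=> /cocycleP hx; apply: (cocycleE' (h := erefl)).
by rewrite -(dgm_dif f) hx (raw0 (om_lin _)).
Qed.

Lemma dgm_coboundary (A B : dgOperad Xi K) (f : dg_map A B) q i (x : A q i) :
  coboundary x -> coboundary (f q i x).
Proof.
by move=> [j [h [y ->]]]; exists j, h, (f q j y); rewrite (dgm_dif f).
Qed.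

Lemma coh_mapE (A B : dgOperad Xi K) (f : dg_map A B) q i (x : A q i) :
  x \in cocycle -> coh_map f (cls x) = cls (f q i x).
Proof.
move=> hx; apply: cls_eq; try exact: dgm_cocycle.
  by apply: dgm_cocycle; apply: rep_cocycle.
by rewrite -(rawB (om_lin f)); apply: dgm_coboundary; apply: rep_cls.
Qed.

(** Injectivity and surjectivity on cohomology, phrased with cocycles only: neither a quotient nor
    the base field appears, so the property survives restriction of scalars unchanged. *)
Definition weak_equivalence (A B : dgOperad Xi K) (f : dg_map A B) : Prop :=
  (forall q i (x : A q i), x \in cocycle -> coboundary (f q i x) -> coboundary x) /\
  (forall q i (y : B q i), y \in cocycle ->
     exists2 x, x \in cocycle & coboundary (f q i x - y)).

Lemma quasi_iso_weak (A B : dgOperad Xi K) (f : dg_map A B) :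
  quasi_iso f -> weak_equivalence f.
Proof.
move=> Hf; split=> q i.
  move=> x hx cx; rewrite -[x]subr0; apply/clsP => //; first exact: rpred0.
  apply: (bij_inj (Hf q i)); rewrite !coh_mapE ?rpred0 //; apply: cls_eq.
  - exact: dgm_cocycle.
  - by apply: dgm_cocycle; exact: rpred0.
  by rewrite (raw0 (om_lin f)) subr0.
move=> y hy; have [g _ gK] := Hf q i.
have [x hx Hx] := cohE (g (cls y)); exists x => //; apply/clsP => //.
  exact: dgm_cocycle.
by rewrite -coh_mapE // -Hx gK.
Qed.
End DgMaps.

Section Correspondences.
Context {disp : Order.disp_t} {Xi : orderType disp}.

(** The lifting property characterizing surjective quasi-isomorphisms of complexes. It provides at
    once an element over [b] and a prescribed boundary, which is what extending a map by one
    generator asks for. *)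
Definition acyclic_fibration (A B : dgOperad Xi rat) (f : dg_map A B) : Prop :=
  forall q (i j : int) (h : i + 1 = j) (b : B q i) (a' : A q j),
  dif (erefl (j + 1)) a' = 0 -> f q j a' = dif h b ->
  exists a, f q i a = b /\ dif h a = a'.

(* Multivalued maps between cocycles inducing an isomorphism on cohomology;
   unlike operad maps they can be inverted. *)
Record coh_corr (A B : dgOperad Xi rat) (R : forall q i, A q i -> B q i -> Prop) :
    Prop := CohCorr {
  cc_lin : forall q i a x y x' y', R q i x y -> R q i x' y' ->
    R q i (a *: x + x') (a *: y + y');
  cc_act : forall q s (hs : @colperm _ _ q s) i x y, R q i x y ->
    R q i (act hs x) (act hs y);
  cc_mu : forall q q1 q2 (t : tree2 q q1 q2) (i j k : int) (h : i + j = k) x y x' y',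
    R q1 i x y -> R q2 j x' y' ->
    R q k (mu (dgo_str A) t h x x') (mu (dgo_str B) t h y y');
  cc_oid : forall c, R _ _ (oid (dgo_str A) c) (oid (dgo_str B) c);
  cc_cocycle : forall q i x y, R q i x y -> x \in cocycle /\ y \in cocycle;
  cc_total : forall q i x, x \in cocycle -> exists y, R q i x y;
  cc_surj : forall q i y, y \in cocycle -> exists x, R q i x y;
  cc_bnd : forall q i x y, R q i x y -> coboundary x <-> coboundary y }.

Lemma coh_corr_id (A : dgOperad Xi rat) :
  coh_corr (fun q i (x y : A q i) => x \in cocycle /\ x = y).
Proof.
split.
- by move=> q i a x y x' y' [hx <-] [hx' <-]; rewrite rpredD ?rpredZ.
- by move=> q s hs i x y [hx <-]; rewrite act_cocycle.
- by move=> q q1 q2 t i j k h x y x' y' [hx <-] [hx' <-]; rewrite mu_cocycle.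
- by move=> c; rewrite oid_cocycle.
- by move=> q i x y [hx <-].
- by move=> q i x hx; exists x.
- by move=> q i x hx; exists x.
- by move=> q i x y [hx <-].
Qed.

Lemma coh_corr_sym (A B : dgOperad Xi rat) (R : forall q i, A q i -> B q i -> Prop) :
  coh_corr R -> coh_corr (fun q i y x => R q i x y).
Proof.
case=> H1 H2 H3 H4 H5 H6 H7 H8; split; eauto.
- by move=> q i x y /H5 [].
- by move=> q i x y /H8 [].
Qed.

Lemma coh_corr_trans (A B D : dgOperad Xi rat) (R : forall q i, A q i -> B q i -> Prop)
    (S : forall q i, B q i -> D q i -> Prop) :
  coh_corr R -> coh_corr S ->
  coh_corr (fun q i x z => exists y, R q i x y /\ S q i y z).
Proof.
move=> HR HS; split.
- move=> q i a x z x' z' [y [r1 s1]] [y' [r2 s2]].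
  by exists (a *: y + y'); split; [apply: (cc_lin HR) | apply: (cc_lin HS)].
- move=> q s hs i x z [y [r1 s1]].
  by exists (act hs y); split; [apply: (cc_act HR) | apply: (cc_act HS)].
- move=> q q1 q2 t i j k h x z x' z' [y [r1 s1]] [y' [r2 s2]].
  exists (mu (dgo_str B) t h y y').
  by split; [apply: (cc_mu HR) | apply: (cc_mu HS)].
- by move=> c; exists (oid (dgo_str B) c); split; [apply: (cc_oid HR)|apply: (cc_oid HS)].
- by move=> q i x z [y [/(cc_cocycle HR)[hx _] /(cc_cocycle HS)[_ hz]]].
- move=> q i x /(cc_total HR)[y Hy]; have [z Hz] := cc_total HS (cc_cocycle HR Hy).2.
  by exists z, y.
- move=> q i x /(cc_surj HS)[y Hy]; have [z Hz] := cc_surj HR (cc_cocycle HS Hy).1.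
  by exists z, y.
- by move=> q i x z [y [/(cc_bnd HR) -> /(cc_bnd HS)]].
Qed.

Definition graph_corr (A B : dgOperad Xi rat) (f : dg_map A B) q i (x : A q i) (y : B q i) :=
  [/\ x \in cocycle, y \in cocycle & coboundary (f q i x - y)].

Lemma fibration_corr (A B : dgOperad Xi rat) (f : dg_map A B) :
  acyclic_fibration f -> coh_corr (graph_corr f).
Proof.
move=> af; split.
- move=> q i a x y x' y' [hx hy hxy] [hx' hy' hxy']; split.
  + by rewrite rpredD ?rpredZ.
  + by rewrite rpredD ?rpredZ.
  rewrite (@om_lin _ _ _ _ _ f) opprD addrACA -scalerBr.
  exact: coboundary_lin.
- move=> q s hs i x y [hx hy [j [h [u Hu]]]]; split; try exact: act_cocycle.
  exists j, h, (act hs u).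
  by rewrite (om_act f) -(rawB (act_lin _)) Hu dif_act.
- move=> q q1 q2 t i j k h x y x' y' [hx hy hxy] [hx' hy' hxy'].
  split; try exact: mu_cocycle.
  rewrite (om_mu f) -[X in X - _](subrK (mu (dgo_str B) t h y (f q2 j x'))).
  rewrite -addrA; rewrite -(rawB (mu_linl _ t h _)) -(rawB (mu_linr _ t h _)).
  rewrite -[X in X + _]scale1r; apply: coboundary_lin.
    by apply: mu_coboundaryl => //; apply: dgm_cocycle.
  exact: mu_coboundaryr.
- move=> c; split; try exact: oid_cocycle.
  by rewrite (om_oid f) subrr; apply: coboundary0.
- by move=> q i x y [].
- move=> q i x hx; exists (f q i x); split=> //; first exact: dgm_cocycle.
  by rewrite subrr; apply: coboundary0.
- move=> q i y hy.
  have [||x [Hx dx]] := af q i (i + 1) erefl y 0.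
  + exact: raw0 (dif_lin _).
  + by rewrite (raw0 (om_lin f)) (cocycleP _ hy).
  exists x; split=> //; first exact: cocycleE' dx.
  by rewrite Hx subrr; apply: coboundary0.
- move=> q i x y [hx hy hxy]; split=> [cx|cy].
    rewrite -[y](subKr (f q i x)); apply: coboundaryB => //.
    exact: dgm_coboundary.
  have : coboundary (f q i x).
    rewrite -[X in coboundary X](subrK y) -[X in coboundary (X + _)]scale1r.
    exact: coboundary_lin.
  move=> [j [h [w Hw]]].
  have [|a [_ Ha]] := af q j i h w x _ Hw; first exact: cocycleP.
  by exists j, h, a.
Qed.
End Correspondences.

Definition hom0 {disp : Order.disp_t} {Xi : orderType disp} (V W : gColl Xi rat)
  (e : int) : collHom V W e.
Proof.
refine (@CollHom _ _ _ _ _ _ (fun _ _ _ _ _ => 0) _ _).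
  by move=> q i j h a x y; rewrite scaler0 addr0.
by move=> q t ht i j h x; rewrite (raw0 (act_lin _)).
Defined.

(** * Extending and lifting sprouts *)

Section Extendability.
Context {disp : Order.disp_t} {Xi : orderType disp}.
Variables (P : pseudoCooperad Xi rat) (G : nat -> collSet P).
Hypotheses (Ggr : is_grading G) (Gfin : forall k, findim_collSet (G k)).
Variables (C : dgOperad Xi rat) (s : collHom P C 1).
Hypothesis Ccobar : is_cobar s.

(** A condition on the values in weight 1. It is a relation rather than a map because transport
    along a zigzag determines a value only up to a correspondence. *)
Definition classes (A : dgOperad Xi rat) :=
  forall q (i j : int), i + 1 = j -> P q i -> A q j -> Prop.

Definition extendable (A : dgOperad Xi rat) (cs : classes A) : Prop :=
  forall n, (2 <= n)%N -> forall alpha : collHom P A 1, is_sprout G n alpha ->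
  (forall q (i j : int) (h : i + 1 = j) x, G 1%N x -> cs q i j h x (chom alpha h x)) ->
  exists alpha' : collHom P A 1, is_sprout G n.+1 alpha' /\
    forall k, (k < n)%N -> eq_on (@G k) alpha' alpha.

Lemma is_sproutW (A : dgOperad Xi rat) m n (f : collHom P A 1) :
  (m <= n)%N -> is_sprout G n f -> is_sprout G m f.
Proof. by move=> mn H k km; apply: H; apply: leq_trans mn. Qed.

(** A generator of weight 1 is closed: its linear boundary term has weight 0, and 1 is not a sum of
    two positive weights. *)
Lemma sprout_cocycle (A : dgOperad Xi rat) n (f : collHom P A 1) q (i j : int)
  (h : i + 1 = j) (x : P q i) : (0 < n)%N -> is_sprout G n f -> G 1%N x ->
  chom f h x \in cocycle.
Proof.
move=> n0 /(sproutP Ggr Gfin Ccobar) Hf Gx; apply: (cocycleE' (h := erefl)).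
rewrite (Hf 1%N n0 _ _ _ _ _ _ _ Gx).
have -> : dif (erefl (j + 1)) (chom s h x) = 0.
  have h2 : i + (1 + 1) = j + 1 by rewrite -h addrA.
  have [I [Q [e [He -> _]]]] := ds_expand Ggr Gfin Ccobar h erefl h2 Gx.
  rewrite (G_dif_vanish Ggr h Gx) (raw0 (chom_lin s _)) oppr0 sub0r.
  rewrite big_pred0 ?oppr0 // => l; apply/negP => /He [[|r] [[|t] [//]]].
  by rewrite addSn addnS.
exact: (raw0 (@om_lin _ _ _ _ _ (ext Ccobar (A := dgo_operad A) f) _ _)).
Qed.

Section Lifting.
Variables (A B : dgOperad Xi rat) (f : dg_map A B).
Hypothesis af : acyclic_fibration f.

(** A value y over beta(x) with d y = F(d (s x)) is needed for each x of weight m+1. The right side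
    is closed because alpha is a sprout up to weight m, and lies over d beta(x) because beta is one
    up to m+1, so the lifting property applies; averaging makes the choices linear and
    equivariant. *)
Lemma lift_step m (alpha : collHom P A 1) (beta : collHom P B 1) :
  is_sprout G m alpha -> is_sprout G m.+1 beta ->
  (forall k, (k <= m)%N -> eq_on (@G k) (push f alpha) beta) ->
  exists alpha' : collHom P A 1, [/\ is_sprout G m.+1 alpha',
    forall k, (k <= m)%N -> eq_on (@G k) alpha' alpha &
    forall k, (k <= m.+1)%N -> eq_on (@G k) (push f alpha') beta].
Proof.
move=> Ha Hb Hab; pose F := ext Ccobar (A := dgo_operad A) alpha.
pose T q (i j : int) (h : i + 1 = j) (x : P q i) (y : A q j) :=
  f q j y = chom beta h x /\ forall (k : int) (h' : j + 1 = k),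
    dif h' y = F q k (dif h' (chom s h x)).
have [||q i j h x Gx|alpha' [Ha' HT]] := @equivariant_section _ _ P G Ggr Gfin A 1 m.+1 T alpha.
- move=> q i j h c x y x' y' [fy dy] [fy' dy']; split=> [|k h'].
    by rewrite (@om_lin _ _ _ _ _ f) fy fy' (chom_lin beta).
  rewrite (chom_lin s) !dif_lin (@om_lin _ _ _ _ _ F) dy dy'.
  by [].
- move=> q i j h t ht x y [fy dy]; split=> [|k h'].
    by rewrite (om_act f) fy chom_act.
  by rewrite chom_act !dif_act (om_act F) dy.
- pose a' := F q (j + 1) (dif erefl (chom s h x)).
  have [||y [fy dy]] := af (h := erefl (j + 1)) (b := chom beta h x) (a' := a').
  + apply: (obstruction_closed Ggr Gfin Ccobar _ _ _ Gx) => r rm.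
    exact: is_sproutW Ha.
  + have /(sproutP Ggr Gfin Ccobar) Hb' := Hb.
    rewrite (Hb' m.+1 _ _ _ _ _ _ _ _ Gx) // /a'.
    apply: (@ext_local _ _ P G Ggr Gfin C s Ccobar m.+1 _
      (operad_comp f F) (ext Ccobar (A := dgo_operad B) beta) _ _ _ _ h erefl _ Gx).
    move=> r rm q' i' j' h' z Gz; rewrite extE /= extE.
    exact: (Hab r).
  exists y; split=> // k h'; subst k; exact: dy.
exists alpha'; have Haa k : (k <= m)%N -> eq_on (@G k) alpha' alpha.
  by move=> km; apply: Ha'; rewrite ltn_eqF.
split=> //.
- apply/(sproutP Ggr Gfin Ccobar) => k.
  rewrite leq_eqVlt => /orP[/eqP->|km] q i j l h1 h' x Gx; last first.
    have Hs : is_sprout G m alpha'.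
      apply: (sprout_local Ggr Gfin Ccobar) Ha => r rm q' i' y Gy j' h2.
      by rewrite (Haa r).
    by have /(sproutP Ggr Gfin Ccobar) := Hs; move/(_ k km); apply.
  have [_ ->] := HT q i j h1 x Gx.
  apply: (@ext_local _ _ P G Ggr Gfin C s Ccobar m.+1 _ F
      (ext Ccobar (A := dgo_operad A) alpha') _ _ _ _ h1 h' _ Gx).
  move=> r rm q' i' j' h2 y Gy; rewrite !extE.
  by rewrite (Haa r).
- move=> k; rewrite leq_eqVlt => /orP[/eqP->|km] q i x Gx j h.
    by rewrite pushE; have [-> _] := HT q i j h x Gx.
  by rewrite pushE (Haa k km) // -(Hab k km).
Qed.

Lemma lift_sprout m N (alpha : collHom P A 1) (beta : collHom P B 1) :
  (m <= N)%N -> is_sprout G m alpha -> is_sprout G N beta ->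
  (forall k, (k <= m)%N -> eq_on (@G k) (push f alpha) beta) ->
  exists alpha' : collHom P A 1, [/\ is_sprout G N alpha',
    forall k, (k <= m)%N -> eq_on (@G k) alpha' alpha &
    forall k, (k <= N)%N -> eq_on (@G k) (push f alpha') beta].
Proof.
elim: N => [|N IH].
  by rewrite leqn0 => /eqP-> Ha Hb Hab; exists alpha; split.
rewrite leq_eqVlt => /orP[/eqP->|mN] Ha Hb Hab; first by exists alpha; split.
have [a' [Ha' H1 H2]] := IH mN Ha (is_sproutW (leqnSn N) Hb) Hab.
have [a'' [Ha'' H1' H2']] := lift_step Ha' Hb H2.
exists a''; split=> // k km q i x Gx j h.
by rewrite (H1' k (leq_trans km mN)) // (H1 k).
Qed.

Lemma push_sprout N (alpha : collHom P A 1) :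
  is_sprout G N alpha -> is_sprout G N (push f alpha).
Proof.
move=> /(sproutP Ggr Gfin Ccobar) H; apply/(sproutP Ggr Gfin Ccobar).
move=> m mN q i j k h1 h' x Gx; rewrite pushE -(dgm_dif f) (H m) //.
apply: (@ext_unique _ _ P C s Ccobar _
  (operad_comp f (ext Ccobar (A := dgo_operad A) alpha))
  (ext Ccobar (A := dgo_operad B) (push f alpha))) => *.
by rewrite extE /= extE.
Qed.
End Lifting.

(* Stated for all prescribed classes at once and in both directions, so that it
   can be composed along a zigzag. *)
Definition transfer (A B : dgOperad Xi rat) : Prop :=
  exists R : forall q i, A q i -> B q i -> Prop, [/\ coh_corr R,
    forall cs : classes A, extendable (fun q i j (h : i + 1 = j) x (y : B q j) =>
      exists z, cs q i j h x z /\ R q j z y) -> extendable cs &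
    forall cs : classes B, extendable (fun q i j (h : i + 1 = j) x (y : A q j) =>
      exists z, cs q i j h x z /\ R q j y z) -> extendable cs].

Lemma transfer_refl (A : dgOperad Xi rat) : transfer A A.
Proof.
exists (fun q i (x y : A q i) => x \in cocycle /\ x = y); split.
- exact: coh_corr_id.
- move=> cs E n n2 a Ha Hc; apply: (E n n2 a Ha) => q i j h x Gx.
  exists (chom a h x); split; first exact: Hc.
  by split=> //; exact: (sprout_cocycle h (ltnW n2) Ha Gx).
- move=> cs E n n2 a Ha Hc; apply: (E n n2 a Ha) => q i j h x Gx.
  exists (chom a h x); split; first exact: Hc.
  by split=> //; exact: (sprout_cocycle h (ltnW n2) Ha Gx).
Qed.

Lemma transfer_sym (A B : dgOperad Xi rat) : transfer A B -> transfer B A.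
Proof.
by move=> [R [H1 H2 H3]]; exists (fun q i y x => R q i x y); split=> //; apply: coh_corr_sym.
Qed.

Lemma extendable_impl (A : dgOperad Xi rat) (cs cs' : classes A) :
  (forall q (i j : int) (h : i + 1 = j) x y, cs q i j h x y -> cs' q i j h x y) ->
  extendable cs' -> extendable cs.
Proof. by move=> H E n n2 a Ha Hc; apply: (E n n2 a Ha) => *; apply/H/Hc. Qed.

Lemma transfer_trans (A B D : dgOperad Xi rat) :
  transfer A B -> transfer B D -> transfer A D.
Proof.
move=> [R [R1 R2 R3]] [S [S1 S2 S3]].
exists (fun q i x z => exists y, R q i x y /\ S q i y z); split.
- exact: coh_corr_trans.
- move=> cs E; apply/R2/S2; apply: extendable_impl E.
  by move=> q i j h x y [z [[w [Hw Hwz]] Hzy]]; exists w; split=> //; exists z.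
- move=> cs E; apply/S3/R3; apply: extendable_impl E.
  by move=> q i j h x y [z [[w [Hw Hwz]] Hzy]]; exists w; split=> //; exists z.
Qed.

Lemma transfer_fibration (A B : dgOperad Xi rat) (f : dg_map A B) :
  acyclic_fibration f -> transfer A B.
Proof.
move=> af; exists (graph_corr f); split; first exact: fibration_corr.
- move=> cs E n n2 a Ha Hc.
  have Hfa := push_sprout f Ha.
  have [|b [Hb Hab]] := E n n2 _ Hfa.
    move=> q i j h x Gx; exists (chom a h x); split; first exact: Hc.
    have hx : chom a h x \in cocycle.
      by exact: (sprout_cocycle h (ltnW n2) Ha Gx).
    by split=> //; [exact: dgm_cocycle | rewrite subrr; exact: coboundary0].
  (* The extended sprout in B agrees with the image of the given one only below weight n, so the
     lift keeps weights up to n - 1 and rebuilds weights n and n+1. *)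
  have n1 : (n.-1 <= n.+1)%N by rewrite (leq_trans (leq_pred n)).
  have n1n : (n.-1 < n)%N by case: n n2 {Ha Hc Hfa Hb Hab n1}.
  have [|a' [Ha' H1 H2]] := lift_sprout af n1 (is_sproutW (leq_pred n) Ha) Hb.
    by move=> k kn q i x Gx j h; rewrite (Hab k) //; apply: leq_ltn_trans n1n.
  exists a'; split=> // k kn; apply: H1.
  by rewrite -ltnS (ltn_predK kn).
- move=> cs E n n2 b Hb Hc.
  (* A sprout in B is lifted from nothing: in weight 0 everything vanishes, and the zero map serves
     as the start. *)
  have [||a [Ha _ Hab]] := @lift_sprout _ _ f af 0 n (hom0 P A 1) b (leq0n n) _ Hb.
  + move=> k; rewrite leqn0 => /eqP-> q i x Gx j h.
    rewrite (G_weight0 Ggr Gx); have h1 : i + 1 + 1 = j by rewrite -addrA.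
    rewrite (curv_ext Ggr Gfin Ccobar (hom0 P A 1) h erefl h1 (G_sub0 Ggr 0 q i)).
    rewrite !(raw0 (chom_lin _ _)) !(raw0 (dif_lin _)).
    by rewrite (raw0 (om_lin _)) subr0.
  + move=> k; rewrite leqn0 => /eqP-> q i x Gx j h.
    by rewrite (G_weight0 Ggr Gx) !(raw0 (chom_lin _ _)).
  have [|a' [Ha' Haa]] := E n n2 a Ha.
    move=> q i j h x Gx; exists (chom b h x); split; first exact: Hc.
    have n0 : (0 < n)%N by apply: leq_trans n2.
    split; [exact: (sprout_cocycle h n0 Ha Gx) | exact: (sprout_cocycle h n0 Hb Gx) |].
    by rewrite -(Hab 1%N n0 _ _ _ Gx) pushE subrr; apply: coboundary0.
  exists (push f a'); split; first exact: push_sprout.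
  move=> k kn q i x Gx j h; rewrite pushE (Haa k) //.
  by rewrite -(Hab k (ltnW kn)).
Qed.
End Extendability.

(** * Power series and path operads *)

Section TripleSums.
Variables (U : nmodType) (F : nat -> nat -> nat -> U) (n : nat).

Lemma sum_tripleA :
  \sum_(a < n.+1) \sum_(b < a.+1) F b (a - b)%N (n - a)%N =
  \sum_(b < n.+1) \sum_(c < (n - b).+1) F b c (n - b - c)%N.
Proof.
rewrite (reindex_inj rev_ord_inj) /=.
transitivity (\sum_(k < n.+1) \sum_(b < n.+1 | (b <= n - k)%N) F b (n - k - b)%N k).
  apply: eq_bigr => k _; rewrite subSS (big_ord_narrow_leq (leq_subr _ _)) /=.
  by apply: eq_bigr => b _; rewrite subKn // -ltnS.
rewrite (exchange_big_dep predT) //=; apply: eq_bigr => b _.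
transitivity (\sum_(k < n.+1 | (k <= n - b)%N) F b (n - b - k)%N k).
  apply: eq_big => k; last by move=> _; rewrite -!subnDA addnC.
  have kn : (k <= n)%N by rewrite -ltnS.
  have bn : (b <= n)%N by rewrite -ltnS.
  by rewrite (leq_subRL _ kn) (leq_subRL _ bn) addnC.
rewrite (big_ord_narrow_leq (leq_subr _ _)) /= (reindex_inj rev_ord_inj) /=.
apply: eq_bigr => k _; rewrite subSS subKn //.
by rewrite -ltnS.
Qed.
End TripleSums.

(** Triple Cauchy products may be summed with the last two factors exchanged; this is the
    combinatorics behind the parallel composition axiom for power series. *)
Lemma sum_tripleC (U : nmodType) (F : nat -> nat -> nat -> U) n :
  \sum_(a < n.+1) \sum_(b < a.+1) F b (a - b)%N (n - a)%N =
  \sum_(a < n.+1) \sum_(b < a.+1) F b (n - a)%N (a - b)%N.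
Proof.
rewrite sum_tripleA (sum_tripleA (fun b c d => F b d c)).
apply: eq_bigr => b _; rewrite (reindex_inj rev_ord_inj) /=.
by apply: eq_bigr => k _; rewrite subSS subKn // -ltnS.
Qed.

Lemma fct_linE (K : pzRingType) (V : lmodType K) (T : Type) c (f g : T -> V) n :
  (c *: f + g) n = c *: f n + g n.
Proof. by []. Qed.

Section Series.
Context {disp : Order.disp_t} {Xi : orderType disp} {K : fieldType}.
Variable A : operad Xi K.

(** The collection A[[lambda]], a series being the function of its coefficients. The parameter has
    degree 0, so the Cauchy product below carries no signs. *)
Definition ser_gColl : gColl Xi K.
Proof.
refine (@GColl _ _ _ (fun q i => (nat -> A q i) : lmodType K)
  (fun q s hs i x n => act hs (x n)) _ _ _).
- by move=> q s hs i a x y; apply/funext => n; rewrite act_lin.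
- by move=> q h1 i x; apply/funext => n; rewrite act1.
- by move=> q s t hs ht hst i x; apply/funext => n; rewrite (actM hs ht).
Defined.

Definition ser_mu q q1 q2 (t : tree2 q q1 q2) (i j k : int) (h : i + j = k)
    (x : nat -> A q1 i) (y : nat -> A q2 j) : nat -> A q k :=
  fun n => \sum_(a < n.+1) mu (op_str A) t h (x a) (y (n - a)%N).

Lemma ser_mu_linl q q1 q2 (t : tree2 q q1 q2) (i j k : int) (h : i + j = k) y :
  linear (fun x => ser_mu t h x y).
Proof.
move=> c x x'; apply/funext => n; rewrite [RHS]fct_linE /ser_mu.
rewrite scaler_sumr -big_split; apply: eq_bigr => a _.
by rewrite (mu_linl (op_str A) t h).
Qed.

Lemma ser_mu_linr q q1 q2 (t : tree2 q q1 q2) (i j k : int) (h : i + j = k) x :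
  linear (@ser_mu q q1 q2 t i j k h x).
Proof.
move=> c y y'; apply/funext => n; rewrite [RHS]fct_linE /ser_mu.
rewrite scaler_sumr -big_split; apply: eq_bigr => a _.
by rewrite (mu_linr (op_str A) t h).
Qed.

Definition ser_const q i (x : A q i) : nat -> A q i :=
  fun n => if n is 0%N then x else 0.

Lemma ser_mu_constl q q1 q2 (t : tree2 q q1 q2) (i j k : int) (h : i + j = k) x y n :
  ser_mu t h (ser_const x) y n = mu (op_str A) t h x (y n).
Proof.
rewrite /ser_mu big_ord_recl subn0 big1 ?addr0 // => a _.
by rewrite (raw0 (mu_linl _ t h _)).
Qed.

Lemma ser_mu_constr q q1 q2 (t : tree2 q q1 q2) (i j k : int) (h : i + j = k) x y n :
  ser_mu t h x (ser_const y) n = mu (op_str A) t h (x n) y.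
Proof.
rewrite /ser_mu big_ord_recr /= subnn big1 ?add0r // => a _.
case E : (n - a)%N => [|m] /=; last by rewrite (raw0 (mu_linr _ t h _)).
by move/eqP: E; rewrite subn_eq0 leqNgt ltn_ord.
Qed.

Lemma ser_mu_triple q m q0 q1 q2 (u : tree2 q m q2) (t : tree2 m q0 q1)
  (i j l ij k : int) (hij : i + j = ij) (h : ij + l = k) x y z n :
  ser_mu u h (ser_mu t hij x y) z n =
  \sum_(a < n.+1) \sum_(b < a.+1)
    mu (op_str A) u h (mu (op_str A) t hij (x b) (y (a - b)%N)) (z (n - a)%N).
Proof. by apply: eq_bigr => a _; rewrite (raw_sum (mu_linl _ u h _)). Qed.

Definition ser_str : operad_on ser_gColl.
Proof.
refine (@OperadOn _ _ _ ser_gColl ser_mu (fun c => ser_const (oid (op_str A) c))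
  ser_mu_linl ser_mu_linr _ _ _ _ _).
- move=> q q1 q2 t t' s s1 s2 hs hs1 hs2 E i j k h x y; apply/funext => n.
  rewrite /ser_mu /= (raw_sum (act_lin _)).
  by apply: eq_bigr => a _; rewrite (mu_act _ _ _ _ E).
- move=> q m m' q0 q1 q2 u t u' t' E i j l ij jl k hij hjl h h' x y z.
  apply/funext => n; rewrite ser_mu_triple (sum_tripleA (fun b c d =>
    mu (op_str A) u h (mu (op_str A) t hij (x b) (y c)) (z d))).
  apply: eq_bigr => b _; rewrite (raw_sum (mu_linr _ u' h' _)).
  by apply: eq_bigr => c _; rewrite (mu_stacked _ E hij hjl h h').
- move=> q m m' q0 q1 q2 u t u' t' E i j l ij il k hij hil h h' x y z.
  apply/funext => n; rewrite scalrfctE !ser_mu_triple (sum_tripleC (fun b c d =>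
    mu (op_str A) u h (mu (op_str A) t hij (x b) (y c)) (z d))).
  rewrite scaler_sumr; apply: eq_bigr => a _; rewrite scaler_sumr.
  by apply: eq_bigr => b _; rewrite (mu_parallel _ E hij hil h h').
- move=> q c t E i h x; apply/funext => n.
  by rewrite ser_mu_constl mu_idl.
- move=> q c t E i h x; apply/funext => n.
  by rewrite ser_mu_constr mu_idr.
Defined.

Definition ser_operad : operad Xi K := Operad ser_str.

Definition ser_coef0 : operad_map ser_operad A.
Proof.
refine (@OperadMap _ _ _ ser_operad A (fun q i x => x 0%N) _ _ _ _) => //.
by move=> q q1 q2 t i j k h x y; rewrite /= /ser_mu big_ord_recl big_ord0 addr0.
Defined.
End Series.

Section Signs.
Variable K : fieldType.

(** The sign conventions use exponents in absolute value. For x equal to its inverse these are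
    integer powers, whose exponents add. *)
Lemma sqr1_expz (x : K) n : x * x = 1 -> x ^+ `|n|%N = x ^ n.
Proof.
move=> xx; case: n => n //; rewrite -[RHS]/((x ^+ n.+1)^-1) -[LHS]/(x ^+ n.+1).
have x0 : x != 0.
  by apply/eqP => x0; move: xx; rewrite x0 mul0r => /eqP; rewrite eq_sym oner_eq0.
by rewrite -exprVn; congr (_ ^+ _); apply: (mulfI x0); rewrite divff.
Qed.

Lemma sgnE n : sgn K n = (-1) ^ n.
Proof. by rewrite /sgn sqr1_expz // mulrNN mulr1. Qed.

Lemma sgnD m n : sgn K (m + n) = sgn K m * sgn K n.
Proof. by rewrite !sgnE expfzDr // oppr_eq0 oner_eq0. Qed.

Lemma sgnB1 n : sgn K (n - 1) = - sgn K n.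
Proof. by rewrite sgnD /sgn /= expr1 mulrN1. Qed.

Lemma sgnD1 n : sgn K (n + 1) = - sgn K n.
Proof. by rewrite sgnD /sgn /= expr1 mulrN1. Qed.

Lemma sgnXB1r j l : sgn K j ^+ `|(l - 1)%R|%N = sgn K j * sgn K j ^+ `|l|%N.
Proof.
have j0 : sgn K j != 0 by rewrite /sgn expf_neq0 // oppr_eq0 oner_eq0.
rewrite !sqr1_expz ?sgnK // expfzDr // mulrC; congr (_ * _).
by rewrite -sqr1_expz ?sgnK // expr1.
Qed.

Lemma sgnXB1l j l : sgn K (j - 1) ^+ `|l|%N = sgn K l * sgn K j ^+ `|l|%N.
Proof. by rewrite sgnB1 exprNn. Qed.
End Signs.

Section Transport.
Context {disp : Order.disp_t} {Xi : orderType disp} {K : fieldType}.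

(** Transport of degree, needed for the dt-components below: the t-derivative of a path of degree i
    is wanted in degree j - 1, equal to i only by a proof. *)
Definition cast (V : gColl Xi K) q (i j : int) (e : i = j) (x : V q i) : V q j :=
  ecast k (V q k) e x.

Lemma cast_id (V : gColl Xi K) q (i : int) (e : i = i) (x : V q i) : cast e x = x.
Proof. by rewrite /cast eq_axiomK. Qed.

Lemma cast_lin (V : gColl Xi K) q (i j : int) (e : i = j) : linear (@cast V q i j e).
Proof. by subst j => a x y; rewrite !cast_id. Qed.

Lemma cast_act (V : gColl Xi K) q (i j : int) (e : i = j) s (hs : @colperm _ _ q s) (x : V q i) :
  cast e (act hs x) = act hs (cast e x).
Proof. by subst j; rewrite !cast_id. Qed.

Lemma cast_dif (V : dgColl Xi K) q (i j i' j' : int) (h : i + 1 = j) (h' : i' + 1 = j')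
  (e : i = i') (e' : j = j') (x : V q i) : dif h' (cast e x) = cast e' (dif h x).
Proof.
case: i' / e h' => h'; case: j' / e' h' => h'.
by rewrite !cast_id (eq_irrelevance h h').
Qed.

Lemma mu_castl (V : operad Xi K) q q1 q2 (t : tree2 q q1 q2) (i j k i' k' : int)
  (h : i + j = k) (h' : i' + j = k') (e : i = i') (e' : k = k') x y :
  mu (op_str V) t h' (cast e x) y = cast e' (mu (op_str V) t h x y).
Proof.
case: i' / e h' => h'; case: k' / e' h' => h'.
by rewrite !cast_id (eq_irrelevance h h').
Qed.

Lemma mu_castr (V : operad Xi K) q q1 q2 (t : tree2 q q1 q2) (i j k j' k' : int)
  (h : i + j = k) (h' : i + j' = k') (e : j = j') (e' : k = k') x y :
  mu (op_str V) t h' x (cast e y) = cast e' (mu (op_str V) t h x y).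
Proof.
case: j' / e h' => h'; case: k' / e' h' => h'.
by rewrite !cast_id (eq_irrelevance h h').
Qed.
End Transport.

(** * Dg suboperads cut out by a closed predicate *)

Section SubOperads.
Context {disp : Order.disp_t} {Xi : orderType disp} {K : fieldType}.
Variable D : dgOperad Xi K.

Record subdg := SubDg {
  sd_S : forall q i, D q i -> Prop;
  sd_0 : forall q i, sd_S (0 : D q i);
  sd_lin : forall q i a (x y : D q i), sd_S x -> sd_S y -> sd_S (a *: x + y);
  sd_act : forall q s (hs : @colperm _ _ q s) i (x : D q i), sd_S x -> sd_S (act hs x);
  sd_dif : forall q (i j : int) (h : i + 1 = j) (x : D q i), sd_S x -> sd_S (dif h x);
  sd_oid : forall c, sd_S (oid (dgo_str D) c);
  sd_mu : forall q q1 q2 (t : tree2 q q1 q2) (i j k : int) (h : i + j = k) x y,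
    sd_S x -> sd_S y -> sd_S (mu (dgo_str D) t h x y) }.

Variable S : subdg.

Definition sd_pred q i : {pred D q i} := fun x => `[< sd_S S x >].

Lemma sd_submod q i : submod_closed (@sd_pred q i).
Proof.
split=> [|a x y /asboolP Hx /asboolP Hy]; apply/asboolP; first exact: sd_0.
exact: sd_lin.
Qed.
HB.instance Definition _ q i :=
  GRing.isSubmodClosed.Build K (D q i) (@sd_pred q i) (sd_submod q i).

Record sd_type q i := Sd { sd_val :> D q i; _ : sd_val \in @sd_pred q i }.
HB.instance Definition _ q i := [isSub for @sd_val q i].
HB.instance Definition _ q i := [Choice of sd_type q i by <:].
HB.instance Definition _ q i := [SubChoice_isSubLmodule of sd_type q i by <:].

Definition sd_mk q i x (H : sd_S S x) : sd_type q i := Sd (asboolT H).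

Lemma sd_valP q i (x : sd_type q i) : sd_S S (sd_val x).
Proof. by case: x => x /= /asboolP. Qed.

Definition sub_gColl : gColl Xi K.
Proof.
refine (@GColl _ _ _ (fun q i => sd_type q i : lmodType K)
  (fun q s hs i x => sd_mk (sd_act hs (sd_valP x))) _ _ _).
- by move=> q s hs i a x y; apply: val_inj; exact: act_lin.
- by move=> q h1 i x; apply: val_inj; exact: act1.
- by move=> q s t hs ht hst i x; apply: val_inj; exact: (actM hs ht).
Defined.

Definition sub_dgColl : dgColl Xi K.
Proof.
refine (@DGColl _ _ _ sub_gColl
  (fun q i j h x => sd_mk (sd_dif h (sd_valP x))) _ _ _).
- by move=> q i j h a x y; apply: val_inj; exact: dif_lin.
- by move=> q i j k h h' x; apply: val_inj; exact: dif_dif.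
- by move=> q s hs i j h x; apply: val_inj; exact: dif_act.
Defined.

Definition sub_str : operad_on sub_dgColl.
Proof.
refine (@OperadOn _ _ _ sub_dgColl
  (fun q q1 q2 t i j k h x y => sd_mk (sd_mu t h (sd_valP x) (sd_valP y)))
  (fun c => sd_mk (sd_oid S c)) _ _ _ _ _ _ _).
- move=> q q1 q2 t i j k h y a x x'; apply: val_inj.
  exact: (mu_linl (dgo_str D) t h).
- move=> q q1 q2 t i j k h y a x x'; apply: val_inj.
  exact: (mu_linr (dgo_str D) t h).
- move=> q q1 q2 t t' s s1 s2 hs hs1 hs2 E i j k h x y; apply: val_inj.
  exact: (mu_act _ _ _ _ E).
- move=> q m m' q0 q1 q2 u t u' t' E i j l ij jl k hij hjl h h' x y z.
  by apply: val_inj; apply: (mu_stacked _ E).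
- move=> q m m' q0 q1 q2 u t u' t' E i j l ij il k hij hil h h' x y z.
  by apply: val_inj; exact: (mu_parallel _ E).
- by move=> q c t E i h x; apply: val_inj; exact: mu_idl.
- by move=> q c t E i h x; apply: val_inj; exact: mu_idr.
Defined.

Definition sub_dgOperad : dgOperad Xi K.
Proof.
refine (@DGOperad _ _ _ sub_dgColl sub_str _ _).
- by move=> c j h; apply: val_inj; exact: dif_oid.
- move=> q q1 q2 t i j k i' j' k' h hi hj hk h1 h2 x y; apply: val_inj.
  exact: dif_mu.
Defined.

Definition sub_incl_op : operad_map (dgo_operad sub_dgOperad) (dgo_operad D).
Proof.
by refine (@OperadMap _ _ _ (dgo_operad sub_dgOperad) (dgo_operad D)
  (fun q i x => val x) _ _ _ _).
Defined.

End SubOperads.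

Section ZeroDifferential.
Context {disp : Order.disp_t} {Xi : orderType disp} {K : fieldType}.
Variable A : operad Xi K.

Definition zero_dgColl : dgColl Xi K.
Proof.
refine (@DGColl _ _ _ (op_coll A) (fun q i j h _ => 0) _ _ _) => //.
- by move=> q i j h a x y; rewrite scaler0 addr0.
- by move=> q s hs i j h x; rewrite (raw0 (act_lin _)).
Defined.

Definition zero_dgOperad : dgOperad Xi K.
Proof.
refine (@DGOperad _ _ _ zero_dgColl (op_str A : operad_on zero_dgColl) _ _) => //.
move=> q q1 q2 t i j k i' j' k' h hi hj hk h1 h2 x y /=.
by rewrite (raw0 (mu_linl _ t _ _)) (raw0 (mu_linr _ t _ _)) scaler0 addr0.
Defined.
End ZeroDifferential.

Definition ser_der (K : pzRingType) (V : lmodType K) (x : nat -> V) : nat -> V :=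
  fun n => n.+1%:R *: x n.+1.

Section SeriesCalculus.
Context {disp : Order.disp_t} {Xi : orderType disp} {K : fieldType}.

Lemma ser_der_lin (V : lmodType K) : linear (@ser_der K V).
Proof.
move=> a x y; apply/funext => n; rewrite [RHS]fct_linE /ser_der fct_linE.
by rewrite scalerDr !scalerA mulrC.
Qed.

Lemma ser_mu_der (A : operad Xi K) q q1 q2 (t : tree2 q q1 q2) (i j k : int)
    (h : i + j = k) (x : nat -> A q1 i) (y : nat -> A q2 j) :
  ser_der (ser_mu t h x y) = ser_mu t h (ser_der x) y + ser_mu t h x (ser_der y).
Proof.
apply/funext => n; rewrite [RHS]/GRing.add /=.
rewrite /ser_der /ser_mu scaler_sumr.
(* The factor n+1 is split as a + (n + 1 - a), one summand for each derivative in the Leibniz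
   rule. *)
transitivity (\sum_(a < n.+2) (a%:R *: mu (op_str A) t h (x a) (y (n.+1 - a)%N) +
   (n.+1 - a)%:R *: mu (op_str A) t h (x a) (y (n.+1 - a)%N))).
  by apply: eq_bigr => a _; rewrite -scalerDl -natrD subnKC // -ltnS.
rewrite big_split /= big_ord_recl scale0r add0r; congr (_ + _).
  apply: eq_bigr => a _; rewrite subSS; exact: (esym (rawZ (mu_linl _ t h _) _ _)).
rewrite big_ord_recr /= subnn scale0r addr0; apply: eq_bigr => a _.
by rewrite (rawZ (mu_linr _ t h _)) subSn // -ltnS.
Qed.

Lemma ser_mu_dif (A : dgOperad Xi K) q q1 q2 (t : tree2 q q1 q2) (i j k i' j' k' : int)
    (h : i + j = k) (hi : i + 1 = i') (hj : j + 1 = j') (hk : k + 1 = k')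
    (h1 : i' + j = k') (h2 : i + j' = k') (x : nat -> A q1 i) (y : nat -> A q2 j) n :
  dif hk (ser_mu (A := dgo_operad A) t h x y n) =
  ser_mu (A := dgo_operad A) t h1 (fun n => dif hi (x n)) y n +
  sgn K i *: ser_mu (A := dgo_operad A) t h2 x (fun n => dif hj (y n)) n.
Proof.
rewrite /ser_mu (raw_sum (dif_lin _)) scaler_sumr -big_split.
by apply: eq_bigr => a _; rewrite (dif_mu t h hi hj hk h1 h2).
Qed.
End SeriesCalculus.

Section SeriesOperad.
Context {disp : Order.disp_t} {Xi : orderType disp} {K : fieldType}.
Variable A : operad Xi K.
Local Notation smu := (@ser_mu _ _ _ A _ _ _).

Lemma ser_mu_act q q1 q2 (t t' : tree2 q q1 q2) s s1 s2
    (hs : colperm s) (hs1 : colperm s1) (hs2 : colperm s2) :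
  tree2_iso s s1 s2 t t' -> forall (i j k : int) (h : i + j = k) x y,
  smu t' h (fun n => act hs1 (x n)) (fun n => act hs2 (y n)) =
  (fun n => act hs (smu t h x y n)).
Proof. exact: (mu_act (ser_str A)). Qed.

Lemma ser_mu_stacked q m m' q0 q1 q2 (u : tree2 q m q2) (t : tree2 m q0 q1)
    (u' : tree2 q q0 m') (t' : tree2 m' q1 q2) : stacked u t u' t' ->
  forall (i j l ij jl k : int) (hij : i + j = ij) (hjl : j + l = jl)
    (h : ij + l = k) (h' : i + jl = k) x y z,
  smu u h (smu t hij x y) z = smu u' h' x (smu t' hjl y z).
Proof. exact: (mu_stacked (ser_str A)). Qed.

Lemma ser_mu_parallel q m m' q0 q1 q2 (u : tree2 q m q2) (t : tree2 m q0 q1)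
    (u' : tree2 q m' q1) (t' : tree2 m' q0 q2) : parallel u t u' t' ->
  forall (i j l ij il k : int) (hij : i + j = ij) (hil : i + l = il)
    (h : ij + l = k) (h' : il + j = k) x y z,
  smu u h (smu t hij x y) z =
  sgn K j ^+ `|l|%N *: smu u' h' (smu t' hil x z) y.
Proof. exact: (mu_parallel (ser_str A)). Qed.
End SeriesOperad.

(** * The operad of pairs of an element and a path *)

Section Paths.
Context {disp : Order.disp_t} {Xi : orderType disp} {K : fieldType}.
Variables A B : dgOperad Xi K.
Local Notation smu := (@ser_mu _ _ _ (dgo_operad B) _ _ _).

(** Degree i of A x B[[t, dt]]; the last component is the coefficient of dt, hence the degree i - 1.
    Polynomiality and the starting point of the path are imposed later, by [rep_S]. *)
Definition pathV (q : corolla) (i : int) : lmodType K :=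
  (A q i * (nat -> B q i) * (nat -> B q (i - 1)))%type.

Lemma path_eq q i (x y : pathV q i) :
  x.1.1 = y.1.1 -> x.1.2 = y.1.2 -> x.2 = y.2 -> x = y.
Proof. by case: x => [[? ?] ?]; case: y => [[? ?] ?] /= -> -> ->. Qed.

Definition path_gColl : gColl Xi K.
Proof.
refine (@GColl _ _ _ pathV (fun q s hs i x =>
  (act hs x.1.1, (fun n => act hs (x.1.2 n)), (fun n => act hs (x.2 n)))) _ _ _).
- by move=> q s hs i a x y; apply: path_eq => /=;
     [exact: act_lin | apply/funext => n; exact: act_lin | apply/funext => n; exact: act_lin].
- by move=> q h1 i x; apply: path_eq => /=;
     [exact: act1 | apply/funext => n; exact: act1 | apply/funext => n; exact: act1].
- by move=> q s t hs ht hst i x; apply: path_eq => /=;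
     [exact: actM | apply/funext => n; exact: actM | apply/funext => n; exact: actM].
Defined.

Lemma path_hl (i j : int) : i + 1 = j -> i - 1 + 1 = j - 1.
Proof. by move=> <-; rewrite subrK addrK. Qed.
Lemma path_he (i j : int) : i + 1 = j -> i = j - 1.
Proof. by move=> <-; rewrite addrK. Qed.
Lemma path_h1 (i j k : int) : i + j = k -> i - 1 + j = k - 1.
Proof. by move=> <-; rewrite addrAC. Qed.
Lemma path_h2 (i j k : int) : i + j = k -> i + (j - 1) = k - 1.
Proof. by move=> <-; rewrite addrA. Qed.

(* A triple (a, p, p') stands for a together with the form p + p' dt. *)
Definition path_dif q (i j : int) (h : i + 1 = j) (x : path_gColl q i) : path_gColl q j :=
  (dif h x.1.1, (fun n => dif h (x.1.2 n)),
   (fun n => cast (path_he h) (sgn K i *: ser_der x.1.2 n) +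
             dif (path_hl h) (x.2 n))).

Lemma path_dif_lin q (i j : int) (h : i + 1 = j) : linear (@path_dif q i j h).
Proof.
move=> a x y; apply: path_eq => /=.
- exact: dif_lin.
- by apply/funext => n; exact: dif_lin.
apply/funext => n; rewrite [RHS]fct_linE ser_der_lin fct_linE.
rewrite scalerDr scalerA mulrC -scalerA (cast_lin _ a).
have -> : (a *: x.2 + y.2) n = a *: x.2 n + y.2 n by [].
by rewrite dif_lin scalerDr addrACA.
Qed.

Definition path_dgColl : dgColl Xi K.
Proof.
refine (@DGColl _ _ _ path_gColl path_dif path_dif_lin _ _).
- move=> q i j k h h' x; apply: path_eq => /=.
  + exact: dif_dif.
  + by apply/funext => n; exact: dif_dif.
  apply/funext => n; rewrite (rawD (dif_lin _)) dif_dif addr0.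
  rewrite (cast_dif h (path_hl h') (path_he h) (path_he h')).
  rewrite /ser_der !(rawZ (dif_lin _)) -(rawD (cast_lin _)) -scalerDl.
  have -> : sgn K j = - sgn K i by rewrite -h sgnD1.
  by rewrite addNr scale0r (raw0 (cast_lin _)).
- move=> q s hs i j h x; apply: path_eq => /=.
  + exact: dif_act.
  + by apply/funext => n; exact: dif_act.
  apply/funext => n; rewrite (rawD (act_lin _)) dif_act -cast_act.
  by rewrite /ser_der !(rawZ (act_lin _)).
Defined.

(** The form dt is written on the right: moving it past the second factor gives the sign [sgn K j],
    and the product of two dt-components is zero. *)
Definition path_mu q q1 q2 (t : tree2 q q1 q2) (i j k : int) (h : i + j = k)
    (x : path_gColl q1 i) (y : path_gColl q2 j) : path_gColl q k :=
  (mu (dgo_str A) t h x.1.1 y.1.1, smu t h x.1.2 y.1.2,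
   (smu t (path_h2 h) x.1.2 y.2 + sgn K j *: smu t (path_h1 h) x.2 y.1.2)).

Definition path_str : operad_on path_gColl.
Proof.
refine (@OperadOn _ _ _ path_gColl path_mu
  (fun c => (oid (dgo_str A) c, ser_const (A := dgo_operad B) (oid (dgo_str B) c), 0)) _ _ _ _ _ _ _).
- move=> q q1 q2 t i j k h y a x x'; apply: path_eq.
  + exact: (mu_linl (dgo_str A) t h).
  + exact: (ser_mu_linl (A := dgo_operad B) t h).
  rewrite -[RHS]/(a *: (path_mu t h x y).2 + (path_mu t h x' y).2).
  rewrite -[LHS]/(smu t (path_h2 h) (a *: x.1.2 + x'.1.2) y.2 +
    sgn K j *: smu t (path_h1 h) (a *: x.2 + x'.2) y.1.2) !ser_mu_linl /=.
  by rewrite !scalerDr addrACA !scalerA [_ * a]mulrC.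
- move=> q q1 q2 t i j k h x a y y'; apply: path_eq.
  + exact: (mu_linr (dgo_str A) t h).
  + exact: (ser_mu_linr (A := dgo_operad B) t h).
  rewrite -[RHS]/(a *: (path_mu t h x y).2 + (path_mu t h x y').2).
  rewrite -[LHS]/(smu t (path_h2 h) x.1.2 (a *: y.2 + y'.2) +
    sgn K j *: smu t (path_h1 h) x.2 (a *: y.1.2 + y'.1.2)) !ser_mu_linr /=.
  by rewrite !scalerDr addrACA !scalerA [_ * a]mulrC.
- move=> q q1 q2 t t' s s1 s2 hs hs1 hs2 E i j k h x y; apply: path_eq => /=.
  + exact: (mu_act _ _ _ _ E).
  + exact: (ser_mu_act (A := dgo_operad B) hs hs1 hs2 E).
  rewrite !(ser_mu_act (A := dgo_operad B) hs hs1 hs2 E); apply/funext => n.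
  rewrite -[RHS]/(act hs (smu t (path_h2 h) x.1.2 y.2 n +
    sgn K j *: smu t (path_h1 h) x.2 y.1.2 n)).
  by rewrite (rawD (act_lin _)) (rawZ (act_lin _)).
- move=> q m m' q0 q1 q2 u t u' t' E i j l ij jl k hij hjl h h' x y z.
  apply: path_eq => /=.
  + exact: (mu_stacked _ E).
  + exact: (ser_mu_stacked (A := dgo_operad B) E).
  rewrite (rawD (ser_mu_linl (A := dgo_operad B) u _ _)) (rawZ (ser_mu_linl (A := dgo_operad B) u _ _)).
  rewrite (rawD (ser_mu_linr (A := dgo_operad B) u' _ _)) (rawZ (ser_mu_linr (A := dgo_operad B) u' _ _)).
  rewrite (ser_mu_stacked (A := dgo_operad B) E hij (path_h2 hjl) (path_h2 h) (path_h2 h')).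
  rewrite (ser_mu_stacked (A := dgo_operad B) E (path_h2 hij) (path_h1 hjl) (path_h1 h) (path_h2 h')).
  rewrite (ser_mu_stacked (A := dgo_operad B) E (path_h1 hij) hjl (path_h1 h) (path_h1 h')).
  have -> : sgn K jl = sgn K l * sgn K j by rewrite -hjl sgnD mulrC.
  by rewrite scalerDr addrA scalerA.
- move=> q m m' q0 q1 q2 u t u' t' E i j l ij il k hij hil h h' x y z.
  apply: path_eq => /=.
  + exact: (mu_parallel _ E).
  + exact: (ser_mu_parallel (A := dgo_operad B) E).
  rewrite (rawD (ser_mu_linl (A := dgo_operad B) u _ _)) (rawZ (ser_mu_linl (A := dgo_operad B) u _ _)).
  rewrite (rawD (ser_mu_linl (A := dgo_operad B) u' _ _)) (rawZ (ser_mu_linl (A := dgo_operad B) u' _ _)).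
  rewrite (ser_mu_parallel (A := dgo_operad B) E hij (path_h2 hil) (path_h2 h) (path_h1 h')).
  rewrite (ser_mu_parallel (A := dgo_operad B) E (path_h2 hij) hil (path_h1 h) (path_h2 h')).
  rewrite (ser_mu_parallel (A := dgo_operad B) E (path_h1 hij) (path_h1 hil) (path_h1 h) (path_h1 h')).
  rewrite sgnXB1r sgnXB1l !scalerDr !scalerA addrCA; congr (_ + _).
    by rewrite mulrA sgnK mul1r.
  congr (_ *: _ + _ *: _); first by rewrite mulrC.
  by rewrite mulrC [sgn K l * _]mulrC mulrA.
- move=> q c t E i h x; apply: path_eq => /=.
  + exact: mu_idl.
  + by apply/funext => n; rewrite ser_mu_constl; apply: mu_idl.
  rewrite (raw0 (ser_mu_linl (A := dgo_operad B) t _ _)) scaler0 addr0.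
  by apply/funext => n; rewrite ser_mu_constl; apply: mu_idl.
- move=> q c t E i h x; apply: path_eq => /=.
  + exact: mu_idr.
  + by apply/funext => n; rewrite ser_mu_constr; apply: mu_idr.
  rewrite (raw0 (ser_mu_linr (A := dgo_operad B) t _ _)) add0r /sgn expr0 scale1r.
  by apply/funext => n; rewrite ser_mu_constr; apply: mu_idr.
Defined.

Definition path_dgOperad : dgOperad Xi K.
Proof.
refine (@DGOperad _ _ _ path_dgColl path_str _ _).
- move=> c j h; apply: path_eq.
  + exact: dif_oid.
  + apply/funext => -[|n]; [exact: dif_oid | exact: (raw0 (dif_lin _))].
  apply/funext => n; rewrite /= /ser_der scaler0 scaler0 (raw0 (cast_lin _)).
  by rewrite (raw0 (dif_lin _)) addr0.
- move=> q q1 q2 t i j k i' j' k' h hi hj hk h1 h2 x y; apply: path_eq.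
  + exact: dif_mu.
  + by apply/funext => n; exact: ser_mu_dif.
  have ei' : sgn K i' = - sgn K i by rewrite -hi sgnD1.
  have ej' : sgn K j' = - sgn K j by rewrite -hj sgnD1.
  have ek : sgn K k = sgn K i * sgn K j by rewrite -h sgnD.
  apply/funext => n.
  pose dx1 n := dif hi (x.1.2 n); pose dx2 n := dif (path_hl hi) (x.2 n).
  pose dy1 n := dif hj (y.1.2 n); pose dy2 n := dif (path_hl hj) (y.2 n).
  pose Dx : nat -> B q1 (i' - 1) := fun n => cast (path_he hi) (ser_der x.1.2 n).
  pose Dy : nat -> B q2 (j' - 1) := fun n => cast (path_he hj) (ser_der y.1.2 n).
  have HDx m : smu t (path_h1 h1) Dx y.1.2 m =
      cast (path_he hk) (smu t h (ser_der x.1.2) y.1.2 m).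
    rewrite /ser_mu (raw_sum (cast_lin _)); apply: eq_bigr => a _.
    exact: (mu_castl (V := dgo_operad B) t h _ _ (path_he hk)).
  have HDy m : smu t (path_h2 h2) x.1.2 Dy m =
      cast (path_he hk) (smu t h x.1.2 (ser_der y.1.2) m).
    rewrite /ser_mu (raw_sum (cast_lin _)); apply: eq_bigr => a _.
    exact: (mu_castr (V := dgo_operad B) t h _ _ (path_he hk)).
  transitivity ((smu t (path_h2 h1) dx1 y.2 n +
      sgn K j *: smu t (path_h1 h1) (sgn K i *: Dx + dx2) y.1.2 n) +
    sgn K i *: (smu t (path_h2 h2) x.1.2 (sgn K j *: Dy + dy2) n +
      sgn K j' *: smu t (path_h1 h2) x.2 dy1 n)); last first.
    rewrite /= /dx1 /dx2 /dy1 /dy2 /Dx /Dy.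
    congr (_ + _ + _ *: (_ + _)).
    + congr (_ *: smu _ _ _ _ _); apply/funext => m.
      by rewrite [RHS]/= (rawZ (cast_lin _)).
    + congr (smu _ _ _ _ _); apply/funext => m.
      by rewrite [RHS]/= (rawZ (cast_lin _)).
  rewrite !ser_mu_linl !ser_mu_linr !fct_linE HDx HDy.
  rewrite -[LHS]/(cast (path_he hk) (sgn K k *: ser_der (smu t h x.1.2 y.1.2) n) +
    dif (path_hl hk) (smu t (path_h2 h) x.1.2 y.2 n +
      sgn K j *: smu t (path_h1 h) x.2 y.1.2 n)).
  rewrite ser_mu_der (rawD (dif_lin _)) (rawZ (dif_lin _)).
  rewrite (ser_mu_dif t (path_h2 h) hi (path_hl hj) (path_hl hk) (path_h2 h1) (path_h2 h2)).
  rewrite (ser_mu_dif t (path_h1 h) (path_hl hi) hj (path_hl hk) (path_h1 h1) (path_h1 h2)).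
  rewrite -/dx1 -/dx2 -/dy1 -/dy2.
  have -> : (smu t h (ser_der x.1.2) y.1.2 + smu t h x.1.2 (ser_der y.1.2)) n =
    smu t h (ser_der x.1.2) y.1.2 n + smu t h x.1.2 (ser_der y.1.2) n by [].
  rewrite (rawZ (cast_lin _)) (rawD (cast_lin _)) sgnB1 ek ej'.
  set a1 := cast _ _; set a2 := cast _ _.
  set b1 := smu _ _ dx1 _ _; set b2 := smu _ _ _ dy2 _.
  set b3 := smu _ _ dx2 _ _; set b4 := smu _ _ _ dy1 _.
  rewrite !scalerDr !scaleNr !scalerN !scalerA [sgn K j * sgn K i]mulrC !addrA.
  by rewrite [LHS](ACl (3*1*5*2*4*6)%AC).
Defined.
End Paths.

Section FiniteSupport.
Variables (K : fieldType).

Definition bounded (V : lmodType K) (x : nat -> V) N := forall n, (N <= n)%N -> x n = 0.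

Lemma boundedW (V : lmodType K) (x : nat -> V) N M :
  bounded x N -> (N <= M)%N -> bounded x M.
Proof. by move=> H NM n Mn; apply/H/(leq_trans NM). Qed.

Lemma bounded_sum (V : lmodType K) (x : nat -> V) N M : bounded x N -> (N <= M)%N ->
  \sum_(n < M) x n = \sum_(n < N) x n.
Proof.
move=> H NM; rewrite (big_ord_widen M _ NM) [RHS]big_mkcond /=.
by apply: eq_bigr => k _; case: ltnP => // /H.
Qed.

(** Evaluation of a polynomial at 1, with default 0 on series of infinite support. *)
Definition total (V : lmodType K) (x : nat -> V) : V :=
  if pselect (exists N, bounded x N) is left H then
    \sum_(n < projT1 (cid H)) x n else 0.

Lemma totalE (V : lmodType K) (x : nat -> V) N : bounded x N -> total x = \sum_(n < N) x n.
Proof.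
move=> H; rewrite /total; case: pselect => [HN|[]]; last by exists N.
case: (cid HN) => /= M HM; case: (leqP N M) => [NM|/ltnW MN].
  exact: bounded_sum.
by rewrite -(bounded_sum HM MN).
Qed.

Lemma total_map (V W : lmodType K) (f : V -> W) (x : nat -> V) N : linear f ->
  bounded x N -> total (fun n => f (x n)) = f (total x).
Proof.
move=> fl H; rewrite (totalE H) (raw_sum fl) (@totalE _ _ N) // => n /H ->.
exact: raw0.
Qed.

Lemma total_lin (V : lmodType K) a (x y : nat -> V) N M : bounded x N -> bounded y M ->
  total (a *: x + y) = a *: total x + total y.
Proof.
move=> Hx Hy; have Hx' := boundedW Hx (leq_maxl N M).
have Hy' := boundedW Hy (leq_maxr N M).
rewrite (totalE Hx') (totalE Hy') scaler_sumr -big_split /=.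
rewrite (@totalE _ _ (maxn N M)) // => n Hn; rewrite fct_linE Hx' // Hy' //.
by rewrite scaler0 addr0.
Qed.
End FiniteSupport.

Section SeriesTotal.
Context {disp : Order.disp_t} {Xi : orderType disp} {K : fieldType}.
Variable A : operad Xi K.

Lemma ser_mu_bounded q q1 q2 (t : tree2 q q1 q2) (i j k : int)
    (h : i + j = k) (x : nat -> A q1 i) (y : nat -> A q2 j) N M :
  bounded x N -> bounded y M -> bounded (ser_mu t h x y) (N + M).
Proof.
move=> Hx Hy n Hn; rewrite /ser_mu big1 // => a _.
have [Na|aN] := leqP N a; first by rewrite Hx // (raw0 (mu_linl _ t h _)).
rewrite (Hy (n - a)%N) ?(raw0 (mu_linr _ t h _)) //.
have an : (a <= n)%N by rewrite -ltnS.
by rewrite (leq_subRL _ an); apply: leq_trans Hn; rewrite leq_add2r ltnW.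
Qed.

(** Evaluation at 1 is multiplicative: the diagonals of the Cauchy product are reordered into a sum
    over pairs, and pairs outside the N by M rectangle contribute nothing. *)
Lemma ser_mu_total q q1 q2 (t : tree2 q q1 q2) (i j k : int)
    (h : i + j = k) (x : nat -> A q1 i) (y : nat -> A q2 j) N M :
  bounded x N -> bounded y M ->
  total (ser_mu t h x y) = mu (op_str A) t h (total x) (total y).
Proof.
move=> Hx Hy; rewrite (totalE (ser_mu_bounded t h Hx Hy)) (totalE Hx) (totalE Hy).
rewrite (raw_sum (mu_linl _ t h _)).
pose F a b := mu (op_str A) t h (x a) (y b).
transitivity (\sum_(n < N + M) \sum_(a < N + M | (a <= n)%N) F a (n - a)%N).
  apply: eq_bigr => n _.
  exact: (big_ord_widen (N + M)%N (fun a => F a (n - a)%N) (ltn_ord n)).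
rewrite (exchange_big_dep predT) //=.
transitivity (\sum_(a < N + M) \sum_(b < N + M - a) F a b).
  apply: eq_bigr => a _.
  transitivity (\sum_(a <= n < N + M) F a (n - a)%N).
    by rewrite big_geq_mkord.
  rewrite -{1}[a : nat]add0n big_addn big_mkord.
  by apply: eq_bigr => b _; rewrite addnK.
transitivity (\sum_(a < N + M) \sum_(b < M) F a b).
  apply: eq_bigr => a _.
  have [Na|aN] := leqP N a.
    by rewrite !big1 // => b _; rewrite /F Hx // (raw0 (mu_linl _ t h _)).
  apply: bounded_sum; last by rewrite -(addnBAC _ (ltnW aN)) leq_addl.
  by move=> b Mb; rewrite /F Hy // (raw0 (mu_linr _ t h _)).
rewrite (@bounded_sum _ _ (fun a => \sum_(b < M) F a b) N) ?leq_addr //; last first.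
  by move=> a Na; rewrite big1 // => b _; rewrite /F Hx // (raw0 (mu_linl _ t h _)).
by apply: eq_bigr => a _; rewrite (raw_sum (mu_linr _ t h _)).
Qed.
End SeriesTotal.

(** * Factoring a map through its mapping path operad *)

Section Replacement.
Context {disp : Order.disp_t} {Xi : orderType disp}.
Variables (A B : dgOperad Xi rat) (f : dg_map A B).
Local Notation E := (path_dgOperad A B).

(** The path starts at the image of the A-component. Finite support is required so that the path can
    be evaluated at 1. *)
Definition rep_S q i (x : E q i) : Prop := x.1.2 0%N = f q i x.1.1 /\
  exists N, bounded x.1.2 N /\ bounded x.2 N.

Lemma bounded_lin (V : lmodType rat) a (x y : nat -> V) N M :
  bounded x N -> bounded y M -> bounded (a *: x + y) (maxn N M).
Proof.
move=> Hx Hy n; rewrite geq_max => /andP[h1 h2].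
by rewrite fct_linE Hx // Hy // scaler0 addr0.
Qed.

Lemma bounded_map (V W : lmodType rat) (g : V -> W) (x : nat -> V) N : linear g ->
  bounded x N -> bounded (fun n => g (x n)) N.
Proof. by move=> gl H n /H ->; exact: raw0. Qed.

Definition rep_sub : subdg E.
Proof.
refine (@SubDg _ _ _ E rep_S _ _ _ _ _ _).
- move=> q i; split; first by rewrite (raw0 (om_lin f)).
  by exists 0%N.
- move=> q i a x y [x0 [N [Hx Hx']]] [y0 [M [Hy Hy']]]; split.
    by rewrite (@om_lin _ _ _ _ _ f) -x0 -y0.
  exists (maxn N M); split; [exact: bounded_lin Hx Hy | exact: bounded_lin Hx' Hy'].
- move=> q s hs i x [x0 [N [Hx Hx']]]; split; first by rewrite /= x0 (om_act f).
  by exists N; split; apply: bounded_map => //; exact: act_lin.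
- move=> q i j h x [x0 [N [Hx Hx']]]; split; first by rewrite /= x0 -(dgm_dif f).
  exists N; split; first by apply: bounded_map => //; exact: dif_lin.
  move=> n Hn; rewrite /= Hx' // /ser_der Hx ?(leq_trans Hn) //.
  by rewrite !scaler0 (raw0 (cast_lin _)) (raw0 (dif_lin _)) addr0.
- move=> c; split; first by rewrite /= (om_oid f).
  by exists 1%N; split=> [[|n]|].
- move=> q q1 q2 t i j k h x y [x0 [N [Hx Hx']]] [y0 [M [Hy Hy']]]; split.
    by rewrite /= /ser_mu big_ord_recl big_ord0 addr0 x0 y0 (om_mu f).
  exists (N + M)%N; split; first exact: (ser_mu_bounded (A := dgo_operad B)).
  move=> n Hn; rewrite -[LHS]/(ser_mu (A := dgo_operad B) t (path_h2 h) x.1.2 y.2 n +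
    sgn rat j *: ser_mu (A := dgo_operad B) t (path_h1 h) x.2 y.1.2 n).
  rewrite (ser_mu_bounded (A := dgo_operad B) t (path_h2 h) Hx Hy' Hn).
  by rewrite (ser_mu_bounded (A := dgo_operad B) t (path_h1 h) Hx' Hy Hn) scaler0 addr0.
Defined.

Definition replacement : dgOperad Xi rat := sub_dgOperad rep_sub.

Lemma rep_bounded q i (x : replacement q i) : exists N, bounded (val x).1.2 N.
Proof. by have [_ [N [H _]]] := sd_valP x; exists N. Qed.

Definition path_pr : operad_map (dgo_operad E) (dgo_operad A).
Proof.
refine (@OperadMap _ _ _ (dgo_operad E) (dgo_operad A)
  (fun q i (x : pathV A B q i) => x.1.1) _ _ _ _).
- move=> q i a x y; reflexivity.
- move=> q s hs i x; reflexivity.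
- move=> q q1 q2 t i j k h x y; reflexivity.
- move=> c; reflexivity.
Defined.

Definition rep_pr_op : operad_map (dgo_operad replacement) (dgo_operad A) :=
  operad_comp path_pr (sub_incl_op rep_sub).

Definition rep_pr : dg_map replacement A.
Proof.
refine (@DGMap _ _ _ replacement A rep_pr_op _) => q i j h x; reflexivity.
Defined.

Local Notation incl := (sub_incl_op rep_sub).

Lemma path_form_lin q i a (x y : dgo_operad E q i) :
  (a *: x + y).1.2 = a *: x.1.2 + y.1.2.
Proof. reflexivity. Qed.

Lemma incl_bounded q i (x : dgo_operad replacement q i) :
  exists N, bounded (incl q i x).1.2 N.
Proof. exact: rep_bounded. Qed.

Definition rep_ev_op : operad_map (dgo_operad replacement) (dgo_operad B).
Proof.
refine (@OperadMap _ _ _ (dgo_operad replacement) (dgo_operad B)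
  (fun q i x => total (incl q i x).1.2) _ _ _ _).
- move=> q i a x y; have [N HN] := incl_bounded x; have [M HM] := incl_bounded y.
  by rewrite (@om_lin _ _ _ _ _ incl) path_form_lin (total_lin a HN HM).
- move=> q s hs i x; have [N HN] := incl_bounded x.
  by rewrite (om_act incl) -(total_map (@act_lin _ _ _ B _ _ hs _) HN).
- move=> q q1 q2 t i j k h x y.
  have [N HN] := incl_bounded x; have [M HM] := incl_bounded y.
  by rewrite (om_mu incl) -(ser_mu_total (A := dgo_operad B) t h HN HM).
- move=> c; rewrite (om_oid incl) (@totalE _ _ _ 1%N); last by case.
  by rewrite big_ord_recl big_ord0 addr0.
Defined.

Definition rep_ev : dg_map replacement B.
Proof.
refine (@DGMap _ _ _ replacement B rep_ev_op _) => q i j h x.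
have [N HN] := incl_bounded x.
by rewrite -[RHS](total_map (dif_lin h) HN).
Defined.
Lemma path_back (i j : int) : i + 1 = j -> j - 1 = i.
Proof. by move=> <-; rewrite addrK. Qed.

Lemma castK (V : gColl Xi rat) q (i j : int) (e : i = j) (e' : j = i) (x : V q j) :
  cast e (cast e' x) = x.
Proof. by case: i / e' e => e; rewrite !cast_id. Qed.

(** Antiderivative in t, with index shifted by one: entry n is the coefficient of t^(n+1). The sign
    undoes the one in [path_dif]. *)
Definition prim q (i j : int) (h : i + 1 = j) (p' : nat -> B q (j - 1)) : nat -> B q i :=
  fun n => n.+1%:R^-1 *: (sgn rat i *: cast (path_back h) (p' n)).

Lemma prim_lin q (i j : int) (h : i + 1 = j) n : linear (fun p' => @prim q i j h p' n).
Proof.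
move=> a x y; rewrite /prim fct_linE (cast_lin _ a) !scalerDr !scalerA.
by congr (_ *: _ + _); rewrite mulrC mulrA.
Qed.

(** The dt-component of d z = 0 says that the t-derivative of the function part is, up to sign, the
    differential of the dt-part; integrating recovers every coefficient except the constant one. *)
Lemma prim_dif q (i j : int) (h : i + 1 = j) (z : path_gColl A B q j) n :
  path_dif erefl z = 0 -> dif h (prim h z.2 n) = z.1.2 n.+1.
Proof.
move=> dz.
have dz2 : cast (path_he erefl) (sgn rat j *: ser_der z.1.2 n) +
    dif (path_hl erefl) (z.2 n) = 0 by have := congr1 (fun u => u.2 n) dz.
have n0 : (n.+1%:R : rat) != 0 by rewrite Num.Theory.pnatr_eq0.
rewrite /prim !(rawZ (dif_lin _)).
rewrite (cast_dif (path_hl erefl) h (path_back h) (path_back erefl)).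
rewrite -(addr0_eq dz2) -scaleN1r (rawZ (cast_lin _)) castK /ser_der !scalerA.
rewrite -[RHS]scale1r; congr (_ *: _).
have -> : sgn rat j = - sgn rat i by rewrite -h sgnD1.
have := mulVf n0; set c := n.+1%:R; set ci := c^-1 => cK.
rewrite -[RHS](sgnK rat i) -[RHS]mulr1 -[X in _ = _ * X]cK; ring.
Qed.

(* A closed form z on the interval has a primitive with prescribed value at 0;
   the free term w changes its value at 1 by a boundary. *)
Lemma path_integrate q (i j : int) (h : i + 1 = j) (z : path_gColl A B q j)
    (a : A q i) (w : B q (i - 1)) :
  rep_S z -> path_dif erefl z = 0 -> dif h a = z.1.1 ->
  exists x : path_gColl A B q i, [/\ rep_S x, path_dif h x = z, x.1.1 = a &
    total x.1.2 = f q i a + total (prim h z.2) -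
      sgn rat i *: cast (path_back h) (dif (path_hl h) w)].
Proof.
move=> [z0 [N [Hz Hz']]] dz da.
pose dw := ser_const (A := dgo_operad B) (dif (path_hl h) w).
(* The constant form w dt is included in the primitive, and its boundary dw dt is removed before
   integration: d is unchanged while the endpoint moves by dw up to sign. *)
pose u := (-1) *: dw + z.2.
pose p n := if n is m.+1 then prim h u m else f q i a.
pose v := ser_const (A := dgo_operad B) w.
have Hdw : bounded dw 1 by case.
have Hu : bounded u (maxn 1 N) by apply: bounded_lin.
have Hp : bounded p (maxn 1 N).+1.
  case=> // n Hn; rewrite /p /prim Hu // (raw0 (cast_lin _)) !scaler0 //.
have n0 n : (n.+1%:R : rat) != 0 by rewrite Num.Theory.pnatr_eq0.
exists (a, p, v); split=> //.
- split=> //; exists (maxn 1 N).+1; split=> //.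
  by apply: (@boundedW _ _ _ 1); [case | rewrite ltnS leq0n].
- apply: path_eq => //=.
    apply/funext => -[|n] /=; first by rewrite -(dgm_dif f) da z0.
    rewrite (prim_lin h n (-1)) dif_lin (prim_dif h n dz).
    rewrite [X in -1 *: X](_ : _ = 0) ?scaler0 ?add0r //.
    have e : j - 1 + 1 = j + 1 - 1 by rewrite subrK addrK.
    rewrite /prim !(rawZ (dif_lin _)) (cast_dif e h _ (path_back erefl)).
    case: n => [|n]; last by rewrite (raw0 (dif_lin _)) (raw0 (cast_lin _)) !scaler0.
    by rewrite dif_dif (raw0 (cast_lin _)) !scaler0.
  apply/funext => n; rewrite /ser_der /p /prim /v.
  rewrite !scalerA mulfK // sgnK scale1r castK /u fct_linE /dw.
  case: n => [|n] /=; first by rewrite scaleN1r addrAC addNr add0r.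
  by rewrite scaler0 add0r (raw0 (dif_lin _)) addr0.
rewrite /= (totalE Hp) big_ord_recl /=; rewrite -addrA; congr (_ + _).
have Hq : bounded (prim h z.2) (maxn 1 N).
  move=> n; rewrite geq_max => /andP[_ Hn].
  by rewrite /prim Hz' // (raw0 (cast_lin _)) !scaler0.
rewrite (totalE Hq).
transitivity (\sum_(n < maxn 1 N) (- prim h dw n + prim h z.2 n)).
  by apply: eq_bigr => n _; rewrite (prim_lin h n (-1)) scaleN1r.
rewrite big_split /= addrC; congr (_ + _); rewrite sumrN; congr (- _).
rewrite (@bounded_sum _ _ _ 1) ?leq_maxl //.
  by rewrite big_ord_recl big_ord0 addr0 /prim invr1 scale1r.
by case=> // n _; rewrite /prim (raw0 (cast_lin _)) !scaler0.
Qed.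
Lemma rep_form q j (z : replacement q j) : rep_S (sd_val z).
Proof. exact: (@sd_valP _ _ _ _ rep_sub q j z). Qed.

Lemma rep_closed q j (z : replacement q j) : dif (erefl (j + 1)) z = 0 ->
  path_dif erefl (sd_val z : path_gColl A B q j) = 0.
Proof. by move=> /(congr1 (@sd_val _ _ _ _ rep_sub q (j + 1))). Qed.

Lemma rep_eq q j (x y : sd_type rep_sub q j) : sd_val x = sd_val y -> x = y.
Proof. exact: val_inj. Qed.

Lemma rep_pr_fibration : acyclic_fibration rep_pr.
Proof.
move=> q i j h b z dz zb.
have [x [xS dx x1 _]] := path_integrate 0 (rep_form z) (rep_closed dz) (esym zb).
by exists (sd_mk (S := rep_sub) xS); split=> //; apply: rep_eq.
Qed.

(** Integrating [z] shows that its A-component has a boundary as image, so injectivity on cohomology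
    gives a primitive [u] in A. The path over [u] may end at the wrong point; surjectivity repairs
    this by a cocycle [v], up to a boundary absorbed by the free term of [path_integrate]. *)
Lemma rep_ev_fibration : weak_equivalence f -> acyclic_fibration rep_ev.
Proof.
move=> [finj fsurj] q i j h b z dz zb.
pose zv : path_gColl A B q j := sd_val z.
have zS : rep_S zv := rep_form z; have dzv : path_dif erefl zv = 0 := rep_closed dz.
have ztot : total zv.1.2 = dif h b := zb.
have cz : zv.1.1 \in cocycle.
  by rewrite cocycleE; apply/eqP; exact: (congr1 (fun u => u.1.1) dzv).
pose Q := total (prim h zv.2).
(* The fundamental theorem of calculus: the integral of the closed form over the interval bounds the
   difference of its two end values. *)
have dQ : dif h Q = dif h b - f q j zv.1.1.
  have [z0 [N [Hz Hz']]] := zS.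
  have Hq : bounded (prim h zv.2) N.
    by move=> n Hn; rewrite /prim Hz' // (raw0 (cast_lin _)) !scaler0.
  rewrite -ztot (totalE (boundedW Hz (leqnSn N))) big_ord_recl /= z0.
  rewrite addrAC subrr add0r /Q (totalE Hq) (raw_sum (dif_lin h)).
  by apply: eq_bigr => n _; apply: prim_dif.
have [|k [hk [u Hu]]] := finj q j zv.1.1 cz.
  by exists i, h, (b - Q); rewrite (rawB (dif_lin _)) dQ subKr.
have ki : k = i by apply: (addIr 1); rewrite hk h.
subst k; rewrite (eq_irrelevance hk h) in Hu.
(* The error at the endpoint when starting from [u]; it is closed, so its class comes from A. *)
pose y := b - Q - f q i u.
have cy : y \in cocycle.
  apply: (cocycleE' (h := h)); rewrite !(rawB (dif_lin _)) dQ subKr -(dgm_dif f) -Hu.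
  by rewrite subrr.
have [v cv [k [hk' [w Hw]]]] := fsurj q i y cy.
have ki : k = i - 1 by rewrite -hk' addrK.
subst k; pose w' := sgn rat i *: w.
have da : dif h (u + v) = zv.1.1.
  by rewrite (rawD (dif_lin _)) -Hu (cocycleP _ cv) addr0.
have [x [xS dx x1 xt]] := path_integrate w' zS dzv da.
exists (sd_mk (S := rep_sub) xS); split; last exact: rep_eq.
transitivity (total x.1.2) => //; rewrite xt.
have -> : cast (path_back h) (dif (path_hl h) w') = sgn rat i *: (f q i v - y).
  rewrite (rawZ (dif_lin _)) (rawZ (cast_lin _)) Hw; congr (_ *: _).
  by rewrite -[w in LHS](cast_id erefl) (cast_dif hk' (path_hl h) erefl (path_he h)) castK.
rewrite scalerA sgnK scale1r (rawD (om_lin f)) -/Q /y.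
rewrite -/y opprB addrA [LHS](ACl ((1*3*4)*(2*5))%AC) /= subrr addr0 /y.
by rewrite -[b - Q - f q i u]addrA -opprD [Q + f q i u]addrC addrC subrK.
Qed.
End Replacement.

(** * Zigzags over an extension field *)

Section Restriction.
Variables (K : fieldType) (phi : {rmorphism rat -> K}).

(** A fresh name for V, so that the scalar action of Q through [phi] does not clash with that of
    K. *)
Definition resm (V : lmodType K) : Type := V.
HB.instance Definition _ (V : lmodType K) := GRing.Zmodule.on (resm V).

Section ResModule.
Variable V : lmodType K.
Definition res_scale (a : rat) (x : resm V) : resm V := (phi a *: (x : V) : V).
Lemma res_scaleA a b v : res_scale a (res_scale b v) = res_scale (a * b) v.
Proof. by rewrite /res_scale scalerA rmorphM. Qed.
Lemma res_scale1 : left_id 1 res_scale.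
Proof. by move=> x; rewrite /res_scale rmorph1 scale1r. Qed.
Lemma res_scaleDr : right_distributive res_scale +%R.
Proof. by move=> a x y; rewrite /res_scale; exact: scalerDr. Qed.
Lemma res_scaleDl v : {morph res_scale^~ v : a b / a + b}.
Proof. by move=> a b; rewrite /res_scale rmorphD; exact: scalerDl. Qed.
Definition res_lmod : lmodType rat :=
  HB.pack (resm V) (GRing.Zmodule_isLmodule.Build rat (resm V)
    res_scaleA res_scale1 res_scaleDr res_scaleDl).
End ResModule.

Lemma res_scaleE (V : lmodType K) a (x : res_lmod V) : a *: x = (phi a *: (x : V)) :> V.
Proof. by []. Qed.

Lemma res_linear (V W : lmodType K) (f : V -> W) : linear f ->
  linear (f : res_lmod V -> res_lmod W).
Proof. move=> Hf a x y; exact: Hf. Qed.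

Context {disp : Order.disp_t} {Xi : orderType disp}.

Definition res_gColl (V : gColl Xi K) : gColl Xi rat.
Proof.
refine (@GColl _ _ _ (fun q i => res_lmod (V q i)) (fun q s hs i x => @act _ _ _ V q s hs i x) _ _ _).
- by move=> q s hs i; apply: res_linear; exact: act_lin.
- exact: (@act1 _ _ _ V).
- exact: (@actM _ _ _ V).
Defined.

Definition res_dgColl (V : dgColl Xi K) : dgColl Xi rat.
Proof.
refine (@DGColl _ _ _ (res_gColl V) (fun q i j h x => @dif _ _ _ V q i j h x) _ _ _).
- by move=> q i j h; apply: res_linear; exact: dif_lin.
- exact: (@dif_dif _ _ _ V).
- exact: (@dif_act _ _ _ V).
Defined.

Definition res_str (V : gColl Xi K) (o : operad_on V) : operad_on (res_gColl V).
Proof.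
refine (@OperadOn _ _ _ (res_gColl V) (fun q q1 q2 t i j k h x y => mu o t h x y)
  (fun c => oid o c) _ _ _ _ _ _ _).
- move=> q q1 q2 t i j k h y; apply: (res_linear (f := fun x => mu o t h x y)).
  exact: mu_linl.
- move=> q q1 q2 t i j k h x; apply: (res_linear (f := mu o t h x)); exact: mu_linr.
- exact: (mu_act o).
- exact: (mu_stacked o).
- move=> q m m' q0 q1 q2 u t u' t' E i j l ij il k hij hil h h' x y z.
  rewrite (mu_parallel o E hij hil h h') -(sgn_bc phi) -rmorphXn.
  reflexivity.
- exact: (@mu_idl _ _ _ _ o).
- exact: (@mu_idr _ _ _ _ o).
Defined.

Definition res_dg (A : dgOperad Xi K) : dgOperad Xi rat.
Proof.
refine (@DGOperad _ _ _ (res_dgColl A) (res_str (dgo_str A)) _ _).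
- exact: (@dif_oid _ _ _ A).
- move=> q q1 q2 t i j k i' j' k' h hi hj hk h1 h2 x y /=.
  by rewrite (dif_mu t h hi hj hk h1 h2) -(sgn_bc phi).
Defined.

Definition res_map_op (A B : dgOperad Xi K) (f : dg_map A B) :
  operad_map (dgo_operad (res_dg A)) (dgo_operad (res_dg B)).
Proof.
refine (@OperadMap _ _ _ (dgo_operad (res_dg A)) (dgo_operad (res_dg B))
  (fun q i x => f q i x) _ _ _ _).
- move=> q i; apply: (res_linear (f := f q i)); exact: om_lin.
- exact: (om_act f).
- exact: (om_mu f).
- exact: (om_oid f).
Defined.

Definition res_map (A B : dgOperad Xi K) (f : dg_map A B) : dg_map (res_dg A) (res_dg B).
Proof.
refine (@DGMap _ _ _ (res_dg A) (res_dg B) (res_map_op f) _); exact: (dgm_dif f).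
Defined.

Lemma res_weak (A B : dgOperad Xi K) (f : dg_map A B) :
  weak_equivalence f -> weak_equivalence (res_map f).
Proof. by []. Qed.

Definition bc_incl_op (O : dgOperad Xi rat) :
  operad_map (dgo_operad O) (dgo_operad (res_dg (base_change phi O))).
Proof.
refine (@OperadMap _ _ _ (dgo_operad O) (dgo_operad (res_dg (base_change phi O)))
  (fun q i x => bc_in phi x) _ _ _ _).
- move=> q i; exact: bc_inP.
- move=> q s hs i x; exact: (esym (bc_actE _ _ _)).
- move=> q q1 q2 t i j k h x y; exact: (esym (bc_muE _ _ _ _ _)).
- move=> c; reflexivity.
Defined.

Definition bc_incl (O : dgOperad Xi rat) : dg_map O (res_dg (base_change phi O)).
Proof.
refine (@DGMap _ _ _ O (res_dg (base_change phi O)) (bc_incl_op O) _).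
move=> q i j h x; exact: (esym (bc_difE _ _ _)).
Defined.
End Restriction.

Section Zigzags.
Context {disp : Order.disp_t} {Xi : orderType disp}.
Variables (P : pseudoCooperad Xi rat) (G : nat -> collSet P).
Hypotheses (Ggr : is_grading G) (Gfin : forall k, findim_collSet (G k)).
Variables (C : dgOperad Xi rat) (s : collHom P C 1).
Hypothesis Ccobar : is_cobar s.

Lemma transfer_weak (A B : dgOperad Xi rat) (f : dg_map A B) :
  weak_equivalence f -> transfer G A B.
Proof.
move=> wf; apply: (@transfer_trans _ _ P G _ (replacement f)).
  apply: transfer_sym.
  by apply: (transfer_fibration Ggr Gfin Ccobar (f := rep_pr f)); exact: rep_pr_fibration.
by apply: (transfer_fibration Ggr Gfin Ccobar (f := rep_ev f)); exact: rep_ev_fibration.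
Qed.

Lemma transfer_formal (K : fieldType) (phi : {rmorphism rat -> K}) (A B : dgOperad Xi K) :
  clos_refl_sym_trans _ (fun A B => exists f : dg_map A B, quasi_iso f) A B ->
  transfer G (res_dg phi A) (res_dg phi B).
Proof.
elim=> [{}A {}B [f Hf]|{}A|{}A {}B _|{}A D {}B _ HA _ HB].
- by apply: (@transfer_weak _ _ (res_map phi f)); apply: res_weak; exact: quasi_iso_weak.
- exact: (transfer_refl Ggr Gfin Ccobar).
- exact: transfer_sym.
- exact: transfer_trans HA HB.
Qed.
End Zigzags.

(** * Derivations of the cobar construction *)

Section Derivations.
Context {disp : Order.disp_t} {Xi : orderType disp}.
Variables (P : pseudoCooperad Xi rat) (G : nat -> collSet P).
Hypotheses (Ggr : is_grading G) (Gfin : forall k, findim_collSet (G k)).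
Variables (C : dgOperad Xi rat) (s : collHom P C 1).
Hypothesis Ccobar : is_cobar s.

(** Induction on a free operad: S carves out a graded suboperad containing the generators, the
    universal map lands in it, and followed by the inclusion it is the identity by uniqueness. The
    differential is replaced by 0 because S need not be stable under it. *)
Lemma cobar_ind (S : forall q i, C q i -> Prop) :
  (forall q i, S q i 0) ->
  (forall q i a x y, S q i x -> S q i y -> S q i (a *: x + y)) ->
  (forall q t (ht : @colperm _ _ q t) i x, S q i x -> S q i (act ht x)) ->
  (forall c, S (ucor c) 0 (oid (dgo_str C) c)) ->
  (forall q q1 q2 (t : tree2 q q1 q2) (i j k : int) (h : i + j = k) x y,
     S q1 i x -> S q2 j y -> S q k (mu (dgo_str C) t h x y)) ->
  (forall q (i j : int) (h : i + 1 = j) x, S q j (chom s h x)) ->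
  forall q i x, S q i x.
Proof.
move=> S0 Slin Sact Soid Smu Sgen.
pose Z := zero_dgOperad (dgo_operad C).
pose SS : subdg Z := @SubDg _ _ _ Z S S0 Slin Sact (fun q i j h x _ => S0 q j) Soid Smu.
pose SZ := dgo_operad (sub_dgOperad SS).
pose g q (i j : int) (h : i + 1 = j) (x : P q i) : SZ q j :=
  @sd_mk _ _ _ Z SS q j (chom s h x) (Sgen q i j h x).
have gl q i j h : linear (@g q i j h).
  by move=> a x y; apply: val_inj; exact: (chom_lin s h).
have ga q t (ht : colperm t) i j h x : @g q i j h (act ht x) = act ht (@g q i j h x).
  by apply: val_inj; exact: (chom_act s ht h).
pose f : collHom P SZ 1 := CollHom gl ga.
pose u := operad_comp (sub_incl_op SS) (ext Ccobar f).
have vl q i : linear (fun x : dgo_operad C q i => x : dgo_operad Z q i) by [].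
pose v : operad_map (dgo_operad C) (dgo_operad Z) := @OperadMap _ _ _
  (dgo_operad C) (dgo_operad Z) (fun q i x => x) vl (fun _ _ _ _ _ => erefl)
  (fun _ _ _ _ _ _ _ _ _ _ => erefl) (fun _ => erefl).
move=> q i x; have -> : x = u q i x.
  apply: (@ext_unique _ _ P C s Ccobar _ v u) => q' i' j' h y.
  exact: (esym (congr1 (fun w => sub_incl_op SS q' j' w) (extE Ccobar f h y))).
exact: (@sd_valP _ _ _ _ SS q i (ext Ccobar f q i x)).
Qed.

(** Derivations of degree 0 along F, hence a Leibniz rule without signs. *)
Record is_der (A : operad Xi rat) (F D : forall q i, C q i -> A q i) : Prop := IsDer {
  der_lin : forall q i, linear (D q i);
  der_act : forall q t (ht : @colperm _ _ q t) i x, D q i (act ht x) = act ht (D q i x);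
  der_mu : forall q q1 q2 (t : tree2 q q1 q2) (i j k : int) (h : i + j = k) x y,
    D q k (mu (dgo_str C) t h x y) =
    mu (op_str A) t h (D q1 i x) (F q2 j y) + mu (op_str A) t h (F q1 i x) (D q2 j y) }.

Arguments der_lin [A F D] _ q i _ _ _.

Definition two_terms (A : operad Xi rat) (f0 f1 : collHom P A 1) :
  collHom P (ser_operad A) 1.
Proof.
refine (@CollHom _ _ _ _ (ser_operad A) 1 (fun q i j h x n =>
  match n with 0%N => chom f0 h x | 1%N => chom f1 h x | _ => 0 end) _ _).
- move=> q i j h a x y; apply/funext => -[|[|n]]; rewrite [RHS]fct_linE.
  + exact: chom_lin.
  + exact: chom_lin.
  + by rewrite scaler0 addr0.
- move=> q t ht i j h x; apply/funext => -[|[|n]] /=.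
  + exact: chom_act.
  + exact: chom_act.
  + by rewrite (raw0 (act_lin _)).
Defined.

(** Extend f0 + lambda f1 to an operad map into A[[lambda]]: its constant coefficient is the
    extension of f0, and its coefficient of lambda is the derivation. *)
Lemma der_ex (A : operad Xi rat) (f0 f1 : collHom P A 1) :
  exists D : forall q i, C q i -> A q i,
    is_der (ext Ccobar f0) D /\
    forall q (i j : int) (h : i + 1 = j) x, D q j (chom s h x) = chom f1 h x.
Proof.
pose U := ext Ccobar (two_terms f0 f1).
have U0 q i x : U q i x 0%N = ext Ccobar f0 q i x.
  apply: (@ext_unique _ _ P C s Ccobar _ (operad_comp (ser_coef0 A) U)
    (ext Ccobar f0)) => q' i' j' h y.
  rewrite extE; exact: (congr1 (fun w => w 0%N) (extE Ccobar (two_terms f0 f1) h y)).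
exists (fun q i x => U q i x 1%N); split.
  split.
  - by move=> q i a x y; rewrite (@om_lin _ _ _ _ _ U).
  - by move=> q t ht i x; rewrite (om_act U).
  - move=> q q1 q2 t i j k h x y; rewrite (om_mu U) /= /ser_mu.
    by rewrite big_ord_recl big_ord1 /= !U0 addrC.
by move=> q i j h x; rewrite /U extE.
Qed.

Lemma der_term (A : operad Xi rat) (F D : forall q i, C q i -> A q i) q (i k : int)
   (h : i + (1 + 1) = k) (e : term P q i) : is_der F D ->
  D q k (term_val s s h e) = sgn rat 1 ^+ `|tma e|%N *:
    (mu (op_str A) (tmt e) (deg_hom2 (tmh e) h)
      (D _ _ (chom s erefl (tmy e))) (F _ _ (chom s erefl (tmz e))) +
     mu (op_str A) (tmt e) (deg_hom2 (tmh e) h)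
      (F _ _ (chom s erefl (tmy e))) (D _ _ (chom s erefl (tmz e)))).
Proof. by move=> DF; rewrite /term_val (rawZ (der_lin DF _ _)) (der_mu DF). Qed.

Lemma der_local m (A : operad Xi rat) (F D D' : forall q i, C q i -> A q i)
   q (i j k : int) (h : i + 1 = j) (h' : j + 1 = k) (x : P q i) :
  is_der F D -> is_der F D' -> G m x ->
  (forall r, (r < m)%N -> forall q (i j : int) (h : i + 1 = j) (y : P q i), G r y ->
     D q j (chom s h y) = D' q j (chom s h y)) ->
  D q k (dif h' (chom s h x)) = D' q k (dif h' (chom s h x)).
Proof.
move=> DF DF' Gx HD; have h2 : i + (1 + 1) = k by rewrite addrA h.
case: m Gx HD => [|m] Gx HD.
  rewrite (G_weight0 Ggr Gx) (raw0 (chom_lin s _)) (raw0 (dif_lin _)).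
  by rewrite (raw0 (der_lin DF _ _)) (raw0 (der_lin DF' _ _)).
have [I [Q [e [He -> _]]]] := ds_expand Ggr Gfin Ccobar h h' h2 Gx.
rewrite (rawB (der_lin DF _ _)) (rawB (der_lin DF' _ _)).
rewrite (rawN (der_lin DF _ _)) (rawN (der_lin DF' _ _)) (HD m) //; last exact: (G_dif Ggr).
rewrite (raw_sum (der_lin DF _ _)) (raw_sum (der_lin DF' _ _)); congr (_ - _).
apply: eq_bigr => l /He [r [t [E r0 t0 Gr Gt]]].
have rm : (r < m.+1)%N by rewrite -E -addn1 leq_add2l.
have tm : (t < m.+1)%N by rewrite -E -add1n leq_add2r.
by rewrite (der_term _ _ DF) (der_term _ _ DF') (HD r) // (HD t).
Qed.

Lemma ext_id q i (x : C q i) : ext Ccobar (A := dgo_operad C) s q i x = x.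
Proof.
pose v : operad_map (dgo_operad C) (dgo_operad C) := @OperadMap _ _ _
  (dgo_operad C) (dgo_operad C) (fun q i x => x) (fun _ _ _ _ _ => erefl)
  (fun _ _ _ _ _ => erefl) (fun _ _ _ _ _ _ _ _ _ _ => erefl) (fun _ => erefl).
apply: (@ext_unique _ _ P C s Ccobar _ (ext Ccobar (A := dgo_operad C) s) v).
by move=> *; rewrite extE.
Qed.

Lemma der_ext (A : operad Xi rat) (F F' D : forall q i, C q i -> A q i) :
  (forall q i x, F q i x = F' q i x) -> is_der F D -> is_der F' D.
Proof.
move=> E [h1 h2 h3]; split=> // q q1 q2 t i j k h x y.
by rewrite h3 !E.
Qed.

Definition inner_der (D : forall q i, C q i -> C q i) : Prop :=
  is_der (A := dgo_operad C) (fun q i x => x) D.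

Lemma inner_der_ex (f : collHom P C 1) : exists D, inner_der D /\
  forall q (i j : int) (h : i + 1 = j) x, D q j (chom s h x) = chom f h x.
Proof.
have [D [DF Ds]] := @der_ex (dgo_operad C) s f.
by exists D; split=> //; apply: der_ext DF; exact: ext_id.
Qed.

(* The commutator d D - D d of an inner derivation is again a derivation. *)
Lemma inner_der_closed m (D : forall q i, C q i -> C q i)
   q (i j k l : int) (h : i + 1 = j) (h' : j + 1 = k) (h'' : k + 1 = l) (x : P q i) :
  inner_der D -> G m x ->
  (forall r, (r < m)%N -> forall q (i j k : int) (h : i + 1 = j) (h' : j + 1 = k)
     (y : P q i), G r y -> dif h' (D q j (chom s h y)) = D q k (dif h' (chom s h y))) ->
  dif h'' (D q k (dif h' (chom s h x))) = 0.
Proof.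
move=> DF Gx HD; have h2 : i + (1 + 1) = k by rewrite addrA h.
have Dl := der_lin DF.
case: m Gx HD => [|m] Gx HD.
  rewrite (G_weight0 Ggr Gx) (raw0 (chom_lin s _)) (raw0 (dif_lin _)).
  by rewrite (raw0 (Dl _ _)) (raw0 (dif_lin _)).
pose E q' (i' j' : int) (h1 : i' + 1 = j') (u : C q' i') :=
  dif h1 (D q' i' u) - D q' j' (dif h1 u).
have Elin q' i' j' h1 : linear (@E q' i' j' h1).
  move=> a u v; rewrite /E Dl !dif_lin Dl.
  by rewrite opprD addrACA -scalerBr.
suff : E q k l h'' (dif h' (chom s h x)) = 0.
  by rewrite /E dif_dif (raw0 (Dl _ _)) subr0.
have [I [Q [e [He -> _]]]] := ds_expand Ggr Gfin Ccobar h h' h2 Gx.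
rewrite (rawB (Elin _ _ _ _)) (rawN (Elin _ _ _ _)) (raw_sum (Elin _ _ _ _)).
rewrite big1 => [|p /He [r [t [rt r0 t0 Gr Gt]]]].
  by rewrite subr0 /E (HD m) ?subrr ?oppr0 //; apply: (G_dif Ggr).
rewrite /term_val (rawZ (Elin _ _ _ _)) /E.
have rm : (r < m.+1)%N by rewrite -rt -addn1 leq_add2l.
have tm : (t < m.+1)%N by rewrite -rt -add1n leq_add2r.
set a := tma (e p); set b := tmb (e p).
have h3 : (a + 1 + 1) + (b + 1) = l.
  by rewrite -h'' -h2 -(tmh (e p)) -/a -/b -!addrA; congr (_ + _); rewrite addrCA; congr (_ + _); rewrite addrCA.
have h4 : (a + 1) + (b + 1 + 1) = l.
  by rewrite -h'' -h2 -(tmh (e p)) -/a -/b -!addrA; congr (_ + _); rewrite addrCA; congr (_ + _).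
rewrite (dif_mu (tmt (e p)) _ erefl erefl h'' h3 h4).
rewrite (rawD (Dl _ _)) (rawZ (Dl _ _)).
rewrite !(der_mu DF) /= (rawD (dif_lin h'')) !(dif_mu (tmt (e p)) _ erefl erefl h'' h3 h4).
rewrite (HD r rm _ _ _ _ _ _ _ Gr) (HD t tm _ _ _ _ _ _ _ Gt).
rewrite [X in _ *: X](_ : _ = 0) ?scaler0 //.
by rewrite scalerDr addrACA subrr.
Qed.

Section DerivationLifting.
Variables (H : dgOperad Xi rat) (rho : dg_map C H).
Hypothesis rho_af : acyclic_fibration rho.
Hypothesis H0 : forall q (i j : int) (h : i + 1 = j) (x : H q i), dif h x = 0.
Hypothesis rho_van : forall k, (2 <= k)%N -> vanish_on (@G k) (push rho s).

Lemma comp_der (D : forall q i, C q i -> C q i) : inner_der D ->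
  is_der (A := dgo_operad H) rho (fun q i x => rho q i (D q i x)).
Proof.
case=> h1 h2 h3; split.
- by move=> q i a x y; rewrite h1 (@om_lin _ _ _ _ _ rho).
- by move=> q t ht i x; rewrite h2 (om_act rho).
- by move=> q q1 q2 t i j k h x y; rewrite h3 (rawD (om_lin rho)) !(om_mu rho).
Qed.

(** On generators Dz lives in weight m and rho in weight 1, so a product in d (s x) survives only
    for weights m and 1, and the linear term only in weight m; both force x to have weight m+1. *)
Lemma der_weight_vanish (m : nat) (Dz : forall q i, C q i -> H q i) k
    q (i j l : int) (h : i + 1 = j) (h' : j + 1 = l) (x : P q i) :
  (2 <= m)%N -> is_der (A := dgo_operad H) rho Dz ->
  (forall r, r != m -> forall q (i j : int) (h : i + 1 = j) y, G r y ->
     Dz q j (chom s h y) = 0) ->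
  k != m.+1 -> G k x -> Dz q l (dif h' (chom s h x)) = 0.
Proof.
move=> m2 DF Dz0 km Gx; have h2 : i + (1 + 1) = l by rewrite addrA h.
case: k km Gx => [|k] km Gx.
  rewrite (G_weight0 Ggr Gx) (raw0 (chom_lin s _)) (raw0 (dif_lin _)).
  by rewrite (raw0 (der_lin DF _ _)).
have [I [Q [e [He -> _]]]] := ds_expand Ggr Gfin Ccobar h h' h2 Gx.
rewrite (rawB (der_lin DF _ _)) (rawN (der_lin DF _ _)) (raw_sum (der_lin DF _ _)).
rewrite (Dz0 k) ?oppr0 ?sub0r //; last exact: (G_dif Ggr).
rewrite big1 ?oppr0 // => p /He [r [t [rt r0 t0 Gr Gt]]].
rewrite (der_term _ _ DF).
have V a b (u : H a b) : 0 + u = u by rewrite add0r.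
have [rm|rm] := eqVneq r m; have [tm|tm] := eqVneq t m.
- rewrite -[rho _ _ (chom s erefl (tmz (e p)))]/(chom (push rho s) erefl (tmz (e p))).
  rewrite -[rho _ _ (chom s erefl (tmy (e p)))]/(chom (push rho s) erefl (tmy (e p))).
  rewrite (rho_van _ Gt) ?tm // (rho_van _ Gr) ?rm //.
  by rewrite (raw0 (mu_linl (dgo_str H) _ _ _)) (raw0 (mu_linr (dgo_str H) _ _ _)) addr0 scaler0.
- rewrite (Dz0 t tm _ _ _ _ _ Gt).
  rewrite -[rho _ _ (chom s erefl (tmz (e p)))]/(chom (push rho s) erefl (tmz (e p))).
  have t2 : (2 <= t)%N.
    rewrite ltn_neqAle eq_sym t0 andbT; apply: contraNneq km => t1.
    by rewrite -rt t1 rm addn1.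
  rewrite (rho_van t2 Gt) !(raw0 (mu_linr (dgo_str H) _ _ _)) addr0 scaler0 //.
- rewrite (Dz0 r rm _ _ _ _ _ Gr).
  rewrite -[rho _ _ (chom s erefl (tmy (e p)))]/(chom (push rho s) erefl (tmy (e p))).
  have r2 : (2 <= r)%N.
    rewrite ltn_neqAle eq_sym r0 andbT; apply: contraNneq km => r1.
    by rewrite -rt r1 tm add1n.
  by rewrite (rho_van r2 Gr) !(raw0 (mu_linl (dgo_str H) _ _ _)) addr0 scaler0.
rewrite (Dz0 r rm _ _ _ _ _ Gr) (Dz0 t tm _ _ _ _ _ Gt).
by rewrite (raw0 (mu_linl (dgo_str H) _ _ _)) (raw0 (mu_linr (dgo_str H) _ _ _)) addr0 scaler0.
Qed.

(** Weight by weight, D(s x) must lie over Dz(s x) with boundary D(d (s x)). The latter is closed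
    and maps to Dz(d (s x)) = 0, so the lifting property of rho yields it. Only the extra condition
    in weight m+1 has to be assumed. *)
Lemma derivation_lift m (Dz : forall q i, C q i -> H q i) N : (2 <= m)%N ->
  is_der (A := dgo_operad H) rho Dz ->
  (forall r, r != m -> forall q (i j : int) (h : i + 1 = j) y, G r y ->
     Dz q j (chom s h y) = 0) ->
  (forall q (i j k : int) (h : i + 1 = j) (h' : j + 1 = k) x, G m.+1 x ->
     Dz q k (dif h' (chom s h x)) = 0) ->
  exists D, [/\ inner_der D,
    forall r, (r <= N)%N -> forall q (i j : int) (h : i + 1 = j) y, G r y ->
      rho q j (D q j (chom s h y)) = Dz q j (chom s h y) &
    forall r, (r <= N)%N -> forall q (i j k : int) (h : i + 1 = j) (h' : j + 1 = k) y,
      G r y -> dif h' (D q j (chom s h y)) = D q k (dif h' (chom s h y))].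
Proof.
move=> m2 DF Dz0 Dzc.
have Dzd k q (i j l : int) (h : i + 1 = j) (h' : j + 1 = l) (x : P q i) :
    G k x -> Dz q l (dif h' (chom s h x)) = 0.
  have [->|km] := eqVneq k m.+1; first exact: Dzc.
  move=> Gx; exact: (der_weight_vanish h h' m2 DF Dz0 km Gx).
elim: N => [|N [D [D1 D2 D3]]].
  have [D [D1 D2]] := inner_der_ex (hom0 P C 1).
  exists D; split=> // r; rewrite leqn0 => /eqP-> q i j.
    move=> h y /(G_weight0 Ggr) ->; rewrite (raw0 (chom_lin s _)).
    by rewrite (raw0 (der_lin D1 _ _)) (raw0 (der_lin DF _ _)) (raw0 (om_lin rho)).
  move=> k h h' y /(G_weight0 Ggr) ->; rewrite (raw0 (chom_lin s _)) (raw0 (dif_lin _)).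
  by rewrite !(raw0 (der_lin D1 _ _)) (raw0 (dif_lin _)).
have Dsl q (i j : int) (h : i + 1 = j) : linear (fun x => D q j (chom s h x)).
  by move=> a x y; rewrite (chom_lin s) (der_lin D1).
have Dsa q t (ht : colperm t) (i j : int) (h : i + 1 = j) x :
    D q j (chom s h (act ht x)) = act ht (D q j (chom s h x)).
  by rewrite chom_act (der_act D1).
pose delta : collHom P C 1 := CollHom Dsl Dsa.
pose T q (i j : int) (h : i + 1 = j) (x : P q i) (y : C q j) :=
  rho q j y = Dz q j (chom s h x) /\ forall (k : int) (h' : j + 1 = k),
    dif h' y = D q k (dif h' (chom s h x)).
have [||q i j h x Gx|delta' [Hd HT]] := @equivariant_section _ _ P G Ggr Gfin C 1 N.+1 T delta.
- move=> q i j h c x y x' y' [fy dy] [fy' dy']; split=> [|k h'].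
    by rewrite (@om_lin _ _ _ _ _ rho) fy fy' (chom_lin s) (der_lin DF).
  by rewrite (chom_lin s) !dif_lin (der_lin D1) dy dy'.
- move=> q i j h t ht x y [fy dy]; split=> [|k h'].
    by rewrite (om_act rho) fy chom_act (der_act DF).
  by rewrite chom_act !dif_act (der_act D1) dy.
- have [||y [fy dy]] := rho_af (h := erefl (j + 1)) (b := Dz q j (chom s h x))
    (a' := D q (j + 1) (dif erefl (chom s h x))).
  + by apply: (inner_der_closed _ _ _ D1 Gx) => r rN; apply: D3.
  + rewrite H0 -[RHS](Dzd _ _ _ _ _ h erefl x Gx).
    apply: (der_local _ _ (comp_der D1) DF Gx) => r rN q' i' j' h1 y Gy.
    exact: (D2 r).
  by exists y; split=> // k h'; subst k.
have [D' [D1' D2']] := inner_der_ex delta'.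
have DD r q (i j : int) (h : i + 1 = j) (y : P q i) : (r <= N)%N -> G r y ->
    D' q j (chom s h y) = D q j (chom s h y).
  by move=> rN Gy; rewrite D2' (Hd r) // ltn_eqF.
exists D'; split=> // r; rewrite leq_eqVlt => /orP[/eqP->|rN] q i j.
- by move=> h y Gy; rewrite D2'; have [-> _] := HT q i j h y Gy.
- by move=> h y Gy; rewrite (DD r) // (D2 r).
- move=> k h h' y Gy; rewrite D2'; have [_ ->] := HT q i j h y Gy.
  apply: (der_local _ _ D1 D1' Gy) => t tN q' i' j' h1 z Gz.
  by rewrite (DD t).
- move=> k h h' y Gy; rewrite (DD r) // (D3 r) //.
  apply: (der_local _ _ D1 D1' Gy) => t tr q' i' j' h1 z Gz.
  by rewrite (DD t) // (leq_trans (ltnW tr)).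
Qed.
End DerivationLifting.
End Derivations.

(** * Rational structures *)

(** An entry of the product with the cokernel matrix of S, chosen nonzero at v. *)
Lemma separating_functional (K : fieldType) (V : lmodType K) (S : set V) (v : V) :
  findim_set (@setT V) -> S 0 -> (forall a x y, S x -> S y -> S (a *: x + y)) ->
  ~ S v -> exists f : V -> K^o, [/\ linear f, forall x, S x -> f x = 0 & f v <> 0].
Proof.
move=> fin S0 Slin Sv.
have [N [e [co [_ ef eE colin]]]] := findim_coord fin (fun _ _ _ _ _ => I).
have {}colin : linear co by move=> a x y; apply: colin.
have [r [b [bS bf bE]]] : exists (r : nat) (b : 'I_r -> V), [/\ forall l, S (b l),
    lin_free b & forall x, S x -> exists c : 'rV[K]_r, x = \sum_l c 0 l *: b l].
  by apply: findim_basis; have [s Hs] := fin; exists s => x _; apply: Hs.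
pose M : 'M[K]_(r, N) := \matrix_l co (b l).
have coS (c : 'rV[K]_r) : co (\sum_l c 0 l *: b l) = c *m M.
  rewrite (raw_sum colin) mulmx_sum_row; apply: eq_bigr => l _.
  by rewrite (rawZ colin) rowK.
have nv : ~~ (co v <= M)%MS.
  apply/negP => /submxP [c Hc]; apply: Sv.
  have -> : v = \sum_l c 0 l *: b l.
    by rewrite (eE v) // [RHS](eE _) // Hc coS.
  elim/big_ind: _ => // [x y Sx Sy|l _].
    by rewrite -[x]scale1r; apply: Slin.
  by rewrite -[_ *: _]addr0; apply: Slin.
move: nv; rewrite submxE => /eqP nv.
have [j Hj] : exists j, (co v *m cokermx M) 0 j <> 0.
  apply: contrapT => H; apply: nv; apply/rowP => j; rewrite [RHS]mxE.
  by apply: contrapT => Hj; apply: H; exists j.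
exists (fun x => (co x *m cokermx M) 0 j); split=> // [a x y|x Sx].
  by rewrite colin mulmxDl -scalemxAl !mxE.
have [c ->] := bE x Sx; rewrite coS.
have /eqP : (c *m M <= M)%MS by apply: submxMl.
by rewrite eqb_id submxE => /eqP->; rewrite mxE.
Qed.

Section KForms.
Variables (K : fieldType) (phi : {rmorphism rat -> K}).
Context {disp : Order.disp_t} {Xi : orderType disp}.

Definition kfree M (kappa : 'I_M -> K) :=
  @lin_free _ (res_lmod phi K^o) M kappa.

(* W is obtained from V by extension of scalars along phi. *)
Record kform (V : gColl Xi rat) (W : gColl Xi K) (b : forall q i, V q i -> W q i) : Prop :=
  KForm {
  kf_lin : forall q i, linear (b q i : V q i -> res_lmod phi (W q i));
  kf_act : forall q s (hs : @colperm _ _ q s) i x, b q i (act hs x) = act hs (b q i x);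
  kf_span : forall q i (w : W q i), exists l : seq (K * V q i),
    w = \sum_(p <- l) p.1 *: b q i p.2;
  kf_inj : forall q i M (kappa : 'I_M -> K) (v : 'I_M -> V q i), kfree kappa ->
    \sum_l kappa l *: b q i (v l) = 0 -> forall l, v l = 0 }.

Arguments kf_lin [V W b] _ q i _ _ _.

Lemma span_seq (V : lmodType rat) (s : seq V) x : x \in s -> spanned_by s x.
Proof.
move=> xs; have ix : (index x s < size s)%N by rewrite index_mem.
exists (fun l => (l == Ordinal ix)%:R).
rewrite (bigD1 (Ordinal ix)) //= eqxx scale1r (tnth_nth 0) /= nth_index //.
by rewrite big1 ?addr0 // => l /negbTE->; rewrite scale0r.
Qed.

Lemma kfree_span (S : seq K) : exists (M : nat) (kappa : 'I_M -> K), kfree kappa /\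
  forall k, k \in S -> exists c : 'I_M -> rat, k = \sum_l phi (c l) * kappa l.
Proof.
pose V : lmodType rat := res_lmod phi K^o.
have [|M [kappa [_ kf kE]]] := @findim_basis _ V (@spanned_by _ V S).
  by exists S.
exists M, kappa; split=> // k kS.
have [|c Hc] := kE k; first exact: (@span_seq V).
by exists (fun l => c 0 l).
Qed.

(** * Expansion of maps over K into rational maps *)

Section Decomposition.
Variables (V : gColl Xi rat) (W : gColl Xi K) (b : forall q i, V q i -> W q i).
Hypothesis bk : kform b.

Definition expressed (S : seq K) q i (w : W q i) := exists l : seq (K * V q i),
  (forall p, p \in l -> p.1 \in S) /\ w = \sum_(p <- l) p.1 *: b p.2.

Lemma expressed_sub (S S' : seq K) q i (w : W q i) :
  {subset S <= S'} -> expressed S w -> expressed S' w.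
Proof. by move=> H [l [lS ->]]; exists l; split=> // p /lS /H. Qed.

Lemma expressed_ex q i (w : W q i) : exists S, expressed S w.
Proof.
have [l Hl] := kf_span bk w; exists (map fst l), l; split=> // p pl.
by apply/mapP; exists p.
Qed.

Lemma expressed0 S q i : expressed S (0 : W q i).
Proof. by exists [::]; rewrite big_nil. Qed.

Lemma expressed_lin S q i (a : rat) (x y : W q i) :
  expressed S x -> expressed S y -> expressed S (phi a *: x + y).
Proof.
move=> [l [lS ->]] [m [mS ->]].
exists ([seq (p.1, a *: p.2) | p <- l] ++ m); split=> [p|].
  by rewrite mem_cat => /orP[/mapP[p' /lS ? ->]|/mS].
rewrite big_cat big_map /= scaler_sumr; congr (_ + _); apply: eq_bigr => p _.
by rewrite (rawZ (kf_lin bk _ _)) res_scaleE !scalerA mulrC.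
Qed.

Lemma expressed_free S q i (w : W q i) M (kappa : 'I_M -> K) :
  (forall k, k \in S -> exists c : 'I_M -> rat, k = \sum_l phi (c l) * kappa l) ->
  expressed S w -> exists v : 'I_M -> V q i, w = \sum_l kappa l *: b (v l).
Proof.
move=> Hk [l [lS ->]]; elim: l lS => [|p l IH] lS.
  exists (fun=> 0); rewrite big_nil big1 // => m _.
  by rewrite (raw0 (kf_lin bk _ _)) scaler0.
have [v Hv] := IH (fun p' h => lS p' (mem_behead (s := p :: l) h)).
have [c Hc] := Hk p.1 (lS p (mem_head _ _)).
exists (fun m => c m *: p.2 + v m); rewrite big_cons Hv {1}Hc scaler_suml -big_split.
apply: eq_bigr => m _ /=.
by rewrite (kf_lin bk) res_scaleE scalerDr !scalerA mulrC.
Qed.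

Variables (P : pseudoCooperad Xi rat) (G : nat -> collSet P).
Hypotheses (Ggr : is_grading G) (Gfin : forall k, findim_collSet (G k)).
Variable a : collHom P (res_gColl phi W) 1.

(** It is the set of scalars that is bounded: each weight is finite dimensional in total, so the
    values on finitely many basis vectors already use all the scalars required. *)
Lemma expressed_bounded N : exists S : seq K, forall k, (k <= N)%N ->
  forall q (i j : int) (h : i + 1 = j) x, G k x -> expressed S (chom a h x : W q j).
Proof.
have one k q (i : int) : exists S : seq K,
    forall (j : int) (h : i + 1 = j) x, G k x -> expressed S (chom a h x : W q j).
  have [M [e [eG _ eE]]] := findim_basis ((Gfin k).1 q i).
  have Hs l := expressed_ex (chom a erefl (e l) : W q (i + 1)).
  pose S l := projT1 (cid (Hs l)).
  exists (flatten [seq S l | l <- enum 'I_M]) => j h x Gx; subst j.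
  have [c ->] := eE x Gx; rewrite (raw_sum (chom_lin a _)).
  elim/big_ind: _ => [|u v Hu Hv|l _]; first exact: expressed0.
    by have := expressed_lin 1 Hu Hv; rewrite rmorph1 scale1r.
  rewrite (rawZ (chom_lin a _)) res_scaleE -[_ *: _]addr0.
  apply: expressed_lin; last exact: expressed0.
  apply: expressed_sub (projT2 (cid (Hs l))) => k' Hk'.
  by apply/flattenP; exists (S l) => //; apply/mapP; exists l; rewrite ?mem_enum.
elim: N => [|N [S HS]].
  exists [::] => k; rewrite leqn0 => /eqP-> q i j h x /(G_weight0 Ggr) ->.
  by rewrite (raw0 (chom_lin a _)); apply: expressed0.
have [L HL] := (Gfin N.+1).2.
pose T (p : corolla * int) := projT1 (cid (one N.+1 p.1 p.2)).
exists (S ++ flatten (map T L)) => k; rewrite leq_eqVlt => /orP[/eqP->|kN] q i j h x Gx.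
  have [->|x0] := eqVneq x 0; first by rewrite (raw0 (chom_lin a _)); apply: expressed0.
  apply: expressed_sub (projT2 (cid (one N.+1 q i)) j h x Gx) => k' Hk'.
  rewrite mem_cat; apply/orP; right; apply/flattenP; exists (T (q, i)) => //.
  by apply/mapP; exists (q, i) => //; apply: HL Gx _; apply/eqP.
by apply: expressed_sub (HS k kN _ _ _ h _ Gx) => k' Hk'; rewrite mem_cat Hk'.
Qed.

(** Coordinates with respect to a family of scalars independent over Q are unique, so the rational
    components inherit linearity and equivariance. The number 1 is kept in the span, with
    coordinates [c], so that rational data can be expanded in the same family. *)
Lemma decomposition N : exists (M : nat) (kappa : 'I_M -> K) (c : 'I_M -> rat)
    (al : 'I_M -> collHom P V 1),
  [/\ kfree kappa, 1 = \sum_l phi (c l) * kappa l &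
    forall k, (k <= N)%N -> forall q (i j : int) (h : i + 1 = j) x, G k x ->
      chom a h x = \sum_l kappa l *: b (chom (al l) h x) :> W q j].
Proof.
have [S HS] := expressed_bounded N.
have [M [kappa [kf kE]]] := kfree_span (1 :: S).
have [c Hc] := kE 1 (mem_head _ _).
have Hv q (i j : int) (h : i + 1 = j) (x : P q i) :
    exists v : 'I_M -> V q j, chom a h (trunc_proj Ggr N.+1 x) = \sum_l kappa l *: b (v l) :> W q j.
  apply: (expressed_free (S := S)).
    by move=> k kS; apply: kE; rewrite inE kS orbT.
  rewrite /trunc_proj (raw_sum (chom_lin a _)).
  elim/big_ind: _ => [|u v Hu Hv|k _]; first exact: expressed0.
    by have := expressed_lin 1 Hu Hv; rewrite rmorph1 scale1r.
  by apply: (HS k); [rewrite -ltnS | exact: projG].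
pose v q i j h x := projT1 (cid (Hv q i j h x)).
have vE q i j h x : chom a h (trunc_proj Ggr N.+1 x) = \sum_l kappa l *: b (v q i j h x l) :> W q j :=
  projT2 (cid (Hv q i j h x)).
have vuniq q (j : int) (u w : 'I_M -> V q j) :
    \sum_l kappa l *: b (u l) = \sum_l kappa l *: b (w l) -> forall l, u l = w l.
  move=> E l; apply/eqP; rewrite -subr_eq0; apply/eqP.
  apply: (kf_inj bk (v := fun l => u l - w l) kf).
  under eq_bigr => m _ do rewrite (rawB (kf_lin bk _ _)) scalerBr.
  by rewrite sumrB E subrr.
have vl l q (i j : int) (h : i + 1 = j) : linear (fun x => v q i j h x l).
  move=> d x y; move: l; apply: (vuniq q j _ (fun l => d *: v q i j h x l + v q i j h y l)).
  rewrite -vE trunc_proj_lin (chom_lin a) res_scaleE !vE scaler_sumr -big_split.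
  apply: eq_bigr => l _ /=.
  by rewrite (kf_lin bk) res_scaleE scalerDr !scalerA mulrC.
have va l q t (ht : colperm t) (i j : int) (h : i + 1 = j) x :
    v q i j h (act ht x) l = act ht (v q i j h x l).
  move: l; apply: (vuniq q j _ (fun l => act ht (v q i j h x l))).
  rewrite -vE trunc_proj_act chom_act vE.
  rewrite -[LHS]/(@act _ _ _ W q t ht j (\sum_l kappa l *: b (v q i j h x l))).
  rewrite (raw_sum (act_lin _)); apply: eq_bigr => l _.
  by rewrite (rawZ (act_lin _)) (kf_act bk).
exists M, kappa, c, (fun l => CollHom (vl l) (va l)); split=> // k kN q i j h x Gx /=.
by rewrite -vE (trunc_projG Ggr _ Gx) ltnS kN.
Qed.
End Decomposition.

Section Instances.
Variable O : dgOperad Xi rat.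
Hypothesis O_fin : forall q i, findim_set (@setT (O q i)).
Local Notation OK := (base_change phi O).

(* A functional on V extends to the base change, and the extension detects
   linear combinations with coefficients independent over Q. *)
Lemma functional_kills (V : lmodType rat) (f : V -> rat^o) M (kappa : 'I_M -> K)
    (v : 'I_M -> V) : linear f -> kfree kappa ->
  ulift (fun x => phi (f x) : K^o) (\sum_l kappa l *: bc_in phi (v l)) = 0 ->
  forall l, f (v l) = 0.
Proof.
move=> fl kf; have adm : Defs.semilinear phi (fun x => phi (f x) : K^o).
  by move=> a x y; rewrite fl rmorphD rmorphM.
rewrite (raw_sum (ulift_lin adm)) => E l.
suff /rowP/(_ l) : \row_l f (v l) = 0 by rewrite !mxE.
apply: kf; rewrite -[RHS]E; apply: eq_bigr => m _.
by rewrite mxE res_scaleE (rawZ (ulift_lin adm)) (ulift_gen _ adm) [RHS]mulrC.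
Qed.

(** For injectivity, a rational functional not vanishing at [v l] would extend to the base change
    and contradict the independence of [kappa]. *)
Lemma bc_kform : kform (V := O) (W := OK) (fun q i x => bc_in phi x).
Proof.
split.
- by move=> q i; exact: bc_inP.
- by move=> q t ht i x; rewrite -(bc_actE phi ht).
- by move=> q i w; have [l Hl] := umod_gen w; exists l.
- move=> q i M kappa v kf E l; apply: contrapT => vl.
  have [|||f [fl _ fv]] := @separating_functional _ _ [set 0]%classic (v l) (O_fin q i).
  + by [].
  + by move=> a x y -> ->; rewrite scaler0 addr0.
  + exact: vl.
  apply: fv; apply: (functional_kills fl kf); rewrite E.
  have adm : Defs.semilinear phi (fun x => phi (f x) : K^o).
    by move=> a x y; rewrite fl rmorphD rmorphM.
  exact: (raw0 (ulift_lin adm)).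
Qed.

Definition coh_bc q i (z : coh O q i) : coh OK q i := cls (bc_in phi (rep z) : OK q i).

Lemma bc_cocycle q i (x : O q i) : x \in cocycle -> (bc_in phi x : OK q i) \in cocycle.
Proof.
move=> /cocycleP hx; apply: (cocycleE' (h := erefl)).
by rewrite -[LHS]/(bc_dif erefl (bc_in phi x)) bc_difE hx bc_in0.
Qed.

Lemma bc_coboundary q i (x : O q i) : coboundary x -> coboundary (bc_in phi x : OK q i).
Proof.
move=> [j [h [y ->]]]; exists j, h, (bc_in phi y : OK q j).
by rewrite -[RHS]/(bc_dif h (bc_in phi y)) bc_difE.
Qed.

Lemma bc_inB (V : lmodType rat) (x y : V) : bc_in phi (x - y) = bc_in phi x - bc_in phi y.
Proof. by rewrite bc_inD -scaleN1r bc_inZ rmorphN1 scaleN1r. Qed.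

Lemma coh_bcE q i (x : O q i) : x \in cocycle ->
  coh_bc (cls x) = cls (bc_in phi x : OK q i).
Proof.
move=> hx; apply: cls_eq; try exact: bc_cocycle.
  by apply: bc_cocycle; apply: rep_cocycle.
by rewrite -bc_inB; apply: bc_coboundary; apply: rep_cls.
Qed.

Lemma cls_lin_sum q i M (kappa : 'I_M -> K) (x : 'I_M -> O q i) :
  (forall l, x l \in cocycle) ->
  \sum_l kappa l *: bc_in phi (x l) \in @Defs.cocycle _ _ _ OK q i /\
  cls (\sum_l kappa l *: bc_in phi (x l) : OK q i) = \sum_l kappa l *: coh_bc (cls (x l)).
Proof.
move=> hx; have H l : (bc_in phi (x l) : OK q i) \in cocycle by apply: bc_cocycle.
split; first by apply: rpred_sum => l _; apply: rpredZ.
elim: M kappa x hx H => [|M IH] kappa x hx H.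
  rewrite !big_ord0; have := @clsZ _ _ _ OK q i 0 0 (rpred0 _).
  by rewrite !scale0r.
rewrite !big_ord_recl cls_lin //; last first.
  by apply: rpred_sum => l _; apply: rpredZ.
by rewrite -coh_bcE // IH.
Qed.

(** Cohomology commutes with extension of the field. Injectivity uses a rational functional that
    vanishes on coboundaries, and whose extension therefore does too. *)
Lemma coh_bc_kform :
  kform (V := coh_operad O) (W := coh_operad OK) coh_bc.
Proof.
split.
- move=> q i a z w; have [x hx ->] := cohE z; have [y hy ->] := cohE w.
  rewrite -cls_lin // !coh_bcE ?rpredD ?rpredZ //.
  by rewrite bc_inP cls_lin ?bc_cocycle.
- move=> q t ht i z; have [x hx ->] := cohE z.
  have e1 : coh_act ht (cls x) = cls (act ht x) := coh_actE ht hx.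
  have e2 : coh_act ht (cls (bc_in phi x : OK q i)) = cls (act ht (bc_in phi x : OK q i)) :=
    coh_actE ht (bc_cocycle hx).
  rewrite -[LHS]/(coh_bc (coh_act ht (cls x))) -[RHS]/(coh_act ht (coh_bc (cls x))).
  rewrite e1 !coh_bcE ?act_cocycle // e2.
  by rewrite -[act ht (bc_in phi x : OK q i)]/(bc_act ht (bc_in phi x)) bc_actE.
- move=> q i w; have [y hy ->] := cohE w.
  have [S HS] := expressed_ex bc_kform y.
  have [M [kappa [kf kE]]] := kfree_span S.
  have [v Hv] := expressed_free bc_kform kE HS.
  (* A closed combination over independent scalars has closed rational components. *)
  have hv l : v l \in cocycle.
    apply: (cocycleE' (h := erefl)); move: l.
    apply: (kf_inj bc_kform (v := fun l => dif erefl (v l)) kf).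
    rewrite -[RHS](cocycleP (erefl (i + 1)) hy) Hv (raw_sum (dif_lin _)).
    apply: eq_bigr => l _; rewrite (rawZ (dif_lin _)).
    by rewrite -[dif erefl (bc_in phi (v l) : OK q i)]/(bc_dif erefl (bc_in phi (v l))) bc_difE.
  exists [seq (kappa l, cls (v l)) | l <- enum 'I_M].
  rewrite big_map big_enum /=; transitivity (cls (\sum_m kappa m *: bc_in phi (v m) : OK q i)).
    by rewrite -Hv.
  exact: (cls_lin_sum kappa hv).2.
- move=> q i M kappa z kf E l; apply: contrapT => zl.
  pose x m := rep (z m); have hx m : x m \in cocycle by apply: rep_cocycle.
  have xz m : cls (x m) = z m by rewrite /x cls_rep.
  have [cs cE] := cls_lin_sum kappa hx.
  have [j [h [y Hy]]] : coboundary (\sum_l kappa l *: bc_in phi (x l) : OK q i).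
    rewrite -[X in coboundary X]subr0; apply/clsP => //; first exact: rpred0.
    rewrite cE; transitivity (0 : coh_operad OK q i).
      by rewrite -[RHS]E; apply: eq_bigr => m _; rewrite xz.
    have := @clsZ _ _ _ OK q i 0 0 (rpred0 _).
    by rewrite !scale0r.
  have [|||f [fl fb fv]] := @separating_functional _ _
      (fun u => coboundary (u : O q i)) (x l) (O_fin q i).
  + exact: coboundary0.
  + exact: coboundary_lin.
  + move=> cx; apply: zl; rewrite -xz; have h0 := @clsZ _ _ _ O q i 0 0 (rpred0 _).
    rewrite !scale0r in h0; rewrite -h0; apply/clsP => //; first exact: rpred0.
    by rewrite subr0.
  apply: fv; apply: (functional_kills fl kf); rewrite Hy.
  have adm : Defs.semilinear phi (fun x => phi (f x) : K^o).
    by move=> a u v; rewrite fl rmorphD rmorphM.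
  move: y {Hy}; apply: (@bc_ext _ _ phi _ _ (fun y => ulift (fun x => phi (f x) : K^o)
    (@dif _ _ _ OK q j i h y)) (fun=> 0)).
  + apply: (lin_comp (ulift_lin adm)); exact: (@dif_lin _ _ _ OK q j i h).
  + by move=> a u v; rewrite scaler0 addr0.
  move=> u; rewrite -[@dif _ _ _ OK q j i h (bc_in phi u)]/(bc_dif h (bc_in phi u)) bc_difE.
  rewrite (ulift_gen _ adm) fb ?rmorph0 //.
  by exists j, h, u.
Qed.
End Instances.
End KForms.

(** * The scaling deformation *)

Arguments der_lin {disp Xi C A F D} _ q i _ _ _.
Arguments kf_lin {K phi disp Xi V W b} _ q i _ _ _.

Lemma sum_addZ (K : pzRingType) (V : lmodType K) c I (r : seq I) (Q : pred I) (f g : I -> V) :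
  \sum_(l <- r | Q l) f l + c *: \sum_(l <- r | Q l) g l =
  \sum_(l <- r | Q l) (f l + c *: g l).
Proof. by rewrite scaler_sumr -big_split. Qed.

Section Shifts.
Definition ser_shift (V : nmodType) (x : nat -> V) : nat -> V :=
  fun j => if j is j'.+1 then x j' else 0.

Lemma iter_shift (V : nmodType) p (x : nat -> V) j :
  iter p (@ser_shift V) x j = if (p <= j)%N then x (j - p)%N else 0.
Proof.
elim: p j => [|p IH] j; first by rewrite subn0.
by case: j => [|j] //=; rewrite IH ltnS subSS.
Qed.

Context {disp : Order.disp_t} {Xi : orderType disp} {K : fieldType}.

Lemma ser_shift_lin (V : lmodType K) : linear (@ser_shift V).
Proof.
move=> a x y; apply/funext => -[|j] /=; rewrite [RHS]fct_linE //=.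
by rewrite scaler0 addr0.
Qed.

Lemma ser_mu_shiftl (A : operad Xi K) q q1 q2 (t : tree2 q q1 q2) (i j k : int)
    (h : i + j = k) (x : nat -> A q1 i) (y : nat -> A q2 j) :
  ser_mu t h (ser_shift x) y = ser_shift (ser_mu t h x y).
Proof.
apply/funext => -[|n]; rewrite /ser_mu /=.
  by rewrite big_ord_recl big_ord0 addr0 /= (raw0 (mu_linl _ t h _)).
rewrite big_ord_recl /= (raw0 (mu_linl _ t h _)) add0r.
by apply: eq_bigr => a _; rewrite /= subSS.
Qed.

Lemma ser_mu_shiftr (A : operad Xi K) q q1 q2 (t : tree2 q q1 q2) (i j k : int)
    (h : i + j = k) (x : nat -> A q1 i) (y : nat -> A q2 j) :
  ser_mu t h x (ser_shift y) = ser_shift (ser_mu t h x y).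
Proof.
apply/funext => -[|n]; rewrite /ser_mu /=.
  by rewrite big_ord_recl big_ord0 addr0 /= (raw0 (mu_linr _ t h _)).
rewrite big_ord_recr /= subnn (raw0 (mu_linr _ t h _)) addr0.
by apply: eq_bigr => a _; rewrite /= subSn // -ltnS.
Qed.
End Shifts.

Section Euler.
Context {disp : Order.disp_t} {Xi : orderType disp}.
Variables (P : pseudoCooperad Xi rat) (G : nat -> collSet P).
Hypotheses (Ggr : is_grading G) (Gfin : forall k, findim_collSet (G k)).
Variables (C : dgOperad Xi rat) (s : collHom P C 1).
Hypothesis Ccobar : is_cobar s.
Variables (H : dgOperad Xi rat) (rho : dg_map C H).
Hypothesis rho_af : acyclic_fibration rho.
Hypothesis H0 : forall q (i j : int) (h : i + 1 = j) (x : H q i), dif h x = 0.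
Hypothesis rho_van : forall k, (2 <= k)%N -> vanish_on (@G k) (push rho s).
Variables (K : fieldType) (phi : {rmorphism rat -> K}) (W : dgOperad Xi K).
Hypothesis W0 : forall q (i j : int) (h : i + 1 = j) (x : W q i), dif h x = 0.
Local Notation WR := (dgo_operad (res_dg phi W)).
Variable b : operad_map (dgo_operad H) WR.
Hypothesis bk : kform phi (V := H) (W := W) b.
Variables (n : nat) (alpha : collHom P (res_dg phi W) 1).
Hypotheses (n2 : (2 <= n)%N) (alpha_sprout : is_sprout G n alpha).
Let brho := operad_comp b rho.
Hypothesis alpha1 : eq_on (@G 1%N) alpha (push brho s).

Lemma fam_lin q (i j : int) (h : i + 1 = j) :
  linear (fun (x : P q i) (l : nat) => if (l.+2 <= n)%N then chom alpha h (proj Ggr l.+1 x)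
    else 0 : WR q j).
Proof.
move=> a x y; apply/funext => l; rewrite [RHS]fct_linE.
by case: ifP => _; rewrite ?scaler0 ?addr0 // proj_lin chom_lin.
Qed.

Lemma fam_act q t (ht : @colperm _ _ q t) (i j : int) (h : i + 1 = j) x :
  (fun l => if (l.+2 <= n)%N then chom alpha h (proj Ggr l.+1 (act ht x)) else 0 : WR q j) =
  (fun l => act ht (if (l.+2 <= n)%N then chom alpha h (proj Ggr l.+1 x) else 0 : WR q j)).
Proof.
apply/funext => l; case: ifP => _; first by rewrite proj_act chom_act.
by rewrite (raw0 (act_lin _)).
Qed.

(* Rescaling by a parameter: coefficient l of the power series is the part of
   alpha of weight l+1, cut off at weight n. *)
Definition fam : collHom P (ser_operad WR) 1 :=
  @CollHom _ _ _ _ (ser_operad WR) 1 _ fam_lin fam_act.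

Let F := ext Ccobar fam.
Local Notation SW := (ser_operad WR).

Lemma F_gen r q (i j : int) (h : i + 1 = j) (x : P q i) l : G r x ->
  F q j (chom s h x) l = if (l.+1 == r) && (l.+2 <= n)%N then chom alpha h x else 0.
Proof.
move=> Gx; rewrite /F extE /= (proj_G Ggr _ Gx).
by case: eqP => _ /=; case: ifP => // _; rewrite (raw0 (chom_lin alpha _)).
Qed.

Lemma F_lin q i : linear (F q i : C q i -> (nat -> WR q i)).
Proof. exact: (@om_lin _ _ _ _ _ F). Qed.

Lemma F_mu q q1 q2 (t : tree2 q q1 q2) (i j k : int) (h : i + j = k) x y :
  F q k (mu (dgo_str C) t h x y) = ser_mu t h (F q1 i x) (F q2 j y).
Proof. exact: (om_mu F). Qed.

(** Order 0 sees only weight 1, where alpha is given by rho; in higher weights rho vanishes on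
    generators. *)
Lemma F0E q i x : F q i x 0%N = brho q i x.
Proof.
apply: (@ext_unique _ _ P C s Ccobar _ (operad_comp (ser_coef0 WR) F) brho).
move=> q' i' j' h y; rewrite -[LHS]/(F q' j' (chom s h y) 0%N).
have [N [_ /(_ N (leqnn N)) ->]] := proj_spec Ggr y.
rewrite !(raw_sum (chom_lin s _)) (raw_sum (om_lin brho)).
have -> : F q' j' (\sum_(k < N) chom s h (proj Ggr k y)) 0%N =
   \sum_(k < N) F q' j' (chom s h (proj Ggr k y)) 0%N.
  apply: (raw_sum (f := fun u => F q' j' u 0%N)) => a u v.
  by rewrite F_lin.
apply: eq_bigr => k _; rewrite (F_gen _ _ (projG Ggr k y)) n2 andbT.
case: eqP => [k1|k1].
  have G1 := projG Ggr k y; rewrite -k1 in G1 *.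
  exact: alpha1.
rewrite -[RHS]/(b _ _ (chom (push rho s) h (proj Ggr k y))).
have [k2|] := leqP 2 k.
  by rewrite (rho_van k2 (projG Ggr k y)) (raw0 (om_lin b)).
case: (nat_of_ord k) k1 (projG Ggr k y) => [_ /(G_weight0 Ggr) ->|[|//] []] //.
by rewrite (raw0 (chom_lin _ _)) (raw0 (om_lin b)).
Qed.

(** On a generator of weight t < n, F is a monomial of order t - 1, so a Cauchy product with it has
    a single term, with the other factor in order l - (t - 1). *)
Lemma mu_F_r q q1 q2 (tr : tree2 q q1 q2) (i j k j' : int) (h : i + j = k)
    (h' : j' + 1 = j) (u : nat -> WR q1 i) t (z : P q2 j') l : (0 < t)%N -> G t z ->
  ser_mu tr h u (F q2 j (chom s h' z)) l =
  if (t <= l.+1)%N && (t < n)%N then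
    mu (op_str WR) tr h (u (l.+1 - t)%N) (chom alpha h' z) else 0.
Proof.
move=> t0 Gz; rewrite /ser_mu.
have E a : mu (op_str WR) tr h (u a) (F q2 j (chom s h' z) (l - a)%N) =
    if ((l - a).+1 == t) && (t < n)%N then mu (op_str WR) tr h (u a) (chom alpha h' z) else 0.
  rewrite (F_gen _ _ Gz); case: eqP => [<-|_] /=.
    by case: ifP => // _; rewrite (raw0 (mu_linr (op_str WR) tr h _)).
  by rewrite (raw0 (mu_linr (op_str WR) tr h _)).
under eq_bigr => a _ do rewrite E.
have [tn|tn] := ltnP t n; last by rewrite andbF big1 // => a _; rewrite andbF.
rewrite andbT; have [tl|tl] := leqP t l.+1; last first.
  rewrite big1 // => a _; rewrite andbT; case: eqP => // Et.
  by move: tl; rewrite -Et ltnS ltnNge leq_subr.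
have al : (l.+1 - t < l.+1)%N by rewrite ltn_subrL t0.
rewrite (bigD1 (Ordinal al)) //= big1 ?addr0 => [|a /eqP na].
  have -> : (l - (l.+1 - t)).+1 = t by rewrite -subSn ?subKn // -ltnS.
  by rewrite eqxx.
rewrite andbT; case: eqP => // Et; case: na; apply: val_inj => /=.
by rewrite -Et subSS subKn // -ltnS.
Qed.

Lemma mu_F_l q q1 q2 (tr : tree2 q q1 q2) (i j k i' : int) (h : i + j = k)
    (h' : i' + 1 = i) (u : nat -> WR q2 j) r (y : P q1 i') l : (0 < r)%N -> G r y ->
  ser_mu tr h (F q1 i (chom s h' y)) u l =
  if (r <= l.+1)%N && (r < n)%N then
    mu (op_str WR) tr h (chom alpha h' y) (u (l.+1 - r)%N) else 0.
Proof.
move=> r0 Gy; rewrite /ser_mu.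
have E a : mu (op_str WR) tr h (F q1 i (chom s h' y) a) (u (l - a)%N) =
    if (a.+1 == r) && (r < n)%N then mu (op_str WR) tr h (chom alpha h' y) (u (l - a)%N) else 0.
  rewrite (F_gen _ _ Gy); case: eqP => [<-|_] /=.
    by case: ifP => // _; rewrite (raw0 (mu_linl (op_str WR) tr h _)).
  by rewrite (raw0 (mu_linl (op_str WR) tr h _)).
under eq_bigr => a _ do rewrite E.
have [rn|rn] := ltnP r n; last by rewrite andbF big1 // => a _; rewrite andbF.
rewrite andbT; have [rl|rl] := leqP r l.+1; last first.
  rewrite big1 // => a _; rewrite andbT; case: eqP => // Er.
  by move: rl; rewrite -Er ltnS ltnNge -ltnS ltn_ord.
case: r r0 {Gy E rn} rl => // r _ rl.
rewrite (bigD1 (Ordinal rl)) //= eqxx big1 ?addr0 ?subSS // => a /eqP na.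
by rewrite andbT eqSS; case: eqP => // Er; case: na; apply: val_inj.
Qed.

(** The given sprout cut off to weights below n, that is the family F at lambda = 1; the component
    of weight n is discarded. *)
Definition gamma : collHom P WR 1 := precomp (trunc_proj_lin Ggr n) (trunc_proj_act Ggr n) alpha.

Lemma gammaG r q (i j : int) (h : i + 1 = j) (x : P q i) : G r x ->
  chom gamma h x = if (r < n)%N then chom alpha h x else 0.
Proof.
move=> Gx; rewrite /= (trunc_projG Ggr n Gx); case: ifP => // _.
by rewrite (raw0 (chom_lin alpha _)).
Qed.

(* As F scales weight r by lambda^(r-1) and d (s x) consists of weight m-1 and of
   products of total weight m, all its terms have degree m-2 in lambda. *)
Lemma Fd_expand m q (i j k : int) (h : i + 1 = j) (h' : j + 1 = k) (x : P q i) l :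
  G m x -> F q k (dif h' (chom s h x)) l =
    if (l.+2 == m) then ext Ccobar gamma q k (dif h' (chom s h x)) else 0.
Proof.
move=> Gx; have h2 : i + (1 + 1) = k by rewrite addrA h.
have Fl : linear (fun u : C q k => F q k u l) by move=> a u v; rewrite F_lin.
case: m Gx => [|m] Gx.
  rewrite (G_weight0 Ggr Gx) (raw0 (chom_lin s _)) (raw0 (dif_lin _)).
  by rewrite (raw0 Fl).
have [I [Q [e [He -> _]]]] := ds_expand Ggr Gfin Ccobar h h' h2 Gx.
rewrite (rawB Fl) (rawN Fl) (raw_sum Fl).
rewrite (F_gen _ _ (G_dif Ggr h Gx)).
have T p : Q p -> F q k (term_val s s h2 (e p)) l =
    if (l.+2 == m.+1) then ext Ccobar gamma q k (term_val s s h2 (e p)) else 0.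
  move=> /He [r [t [rt r0 t0 Gr Gt]]].
  rewrite /term_val (rawZ Fl) F_mu (mu_F_r _ _ _ _ _ t0 Gt) (F_gen _ _ Gr).
  rewrite (rawZ (@om_lin _ _ _ _ _ (ext Ccobar gamma) _ _)) (om_mu (ext Ccobar gamma)).
  rewrite !extE (gammaG _ Gr) (gammaG _ Gt).
  rewrite -rt; have [E|E] := eqVneq l.+2 (r + t)%N.
    have tl : (t <= l.+1)%N by rewrite -ltnS E -add1n leq_add2r.
    have lt : (l.+1 - t).+1 = r by rewrite -subSn // E addnK.
    rewrite tl lt eqxx /=; case: (t < n)%N => //.
    by rewrite (raw0 (mu_linr (op_str WR) _ _ _)).
  case: ifP => [/andP[tl _]|_]; last by rewrite scaler0.
  have -> : ((l.+1 - t).+1 == r) = false.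
    by apply/eqP => Er; case/eqP: E; rewrite -Er addSn subnK.
  by rewrite (raw0 (mu_linl (op_str WR) _ _ _)) scaler0.
under eq_bigr => p Qp do rewrite T //.
have [E|E] := eqVneq l.+2 m.+1; last first.
  rewrite big1 // subr0; case: eqP => [Em|_]; last by rewrite oppr0.
  by rewrite Em eqxx in E.
rewrite (rawB (@om_lin _ _ _ _ _ (ext Ccobar gamma) _ _)).
rewrite (rawN (@om_lin _ _ _ _ _ (ext Ccobar gamma) _ _)).
rewrite (raw_sum (@om_lin _ _ _ _ _ (ext Ccobar gamma) _ _)).
rewrite extE (gammaG _ (G_dif Ggr h Gx)); congr (- _ - _).
by case: E => ->; rewrite eqxx.
Qed.

Lemma ext_gamma m q (i j k : int) (h : i + 1 = j) (h' : j + 1 = k) (x : P q i) :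
  (m <= n)%N -> G m x -> ext Ccobar gamma q k (dif h' (chom s h x)) = 0.
Proof.
move=> mn Gx.
have /(sproutP Ggr Gfin Ccobar) /(_ m mn _ _ _ _ h h' x Gx) := alpha_sprout.
rewrite -[dif h' (chom alpha h x)]/(@dif _ _ _ W q j k h' (chom alpha h x)) W0 => E.
rewrite [RHS]E; apply: (ext_local Ggr Gfin Ccobar h h' Gx) => r rm q' i' j' h1 y Gy.
by rewrite !extE (gammaG _ Gy) (leq_trans rm mn).
Qed.

(** Order l sees boundaries of generators of weight l + 2 only, where gamma satisfies the sprout
    equation; the Leibniz rule propagates this to products. It is stated on all of C because it is
    applied to values of derivations of C. *)
Lemma Fd_zero q (i j : int) (h : i + 1 = j) (x : C q i) l : (l.+2 <= n)%N ->
  F q j (dif h x) l = 0.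
Proof.
pose S q (i : int) (x : C q i) := forall (j : int) (h : i + 1 = j) l,
  (l.+2 <= n)%N -> F q j (dif h x) l = 0.
suff : S q i x by move=> HS ln; exact: HS.
have Fl q' k l' : linear (fun u : C q' k => F q' k u l') by move=> a u v; rewrite F_lin.
move: q i x {j h l}; apply: (cobar_ind Ccobar).
- by move=> q i j h l _; rewrite (raw0 (dif_lin _)) (raw0 (Fl _ _ _)).
- move=> q i a x y Sx Sy j h l ln.
  by rewrite dif_lin (Fl q j l a) Sx // Sy // scaler0 addr0.
- move=> q t ht i x Sx j h l ln.
  rewrite dif_act (om_act F) -[LHS]/(act ht (F q j (dif h x) l)) Sx //.
  exact: (raw0 (@act_lin _ _ _ WR _ _ ht _)).
- by move=> c j h l _; rewrite dif_oid (raw0 (Fl _ _ _)).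
- move=> q q1 q2 t i j k h x y Sx Sy k' hk l ln.
  have h1 : i + 1 + j = k' by rewrite -hk -h addrAC.
  have h2 : i + (j + 1) = k' by rewrite -hk -h addrA.
  rewrite (dif_mu t h erefl erefl hk h1 h2) (rawD (Fl _ _ _)) (rawZ (Fl _ _ _)) !F_mu.
  rewrite /ser_mu !big1 ?scaler0 ?addr0 // => a _.
    rewrite Sy ?(raw0 (mu_linr (op_str WR) _ _ _)) //.
    by apply: leq_trans ln; rewrite !ltnS leq_subr.
  rewrite Sx ?(raw0 (mu_linl (op_str WR) _ _ _)) //.
  by apply: leq_trans ln; rewrite !ltnS -ltnS.
- move=> q i j h x k h' l ln.
  have [N [_ /(_ N (leqnn N)) ->]] := proj_spec Ggr x.
  rewrite (raw_sum (chom_lin s _)) (raw_sum (dif_lin _)) (raw_sum (Fl _ _ _)).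
  rewrite big1 // => m _; rewrite (Fd_expand h h' l (projG Ggr m x)).
  case: eqP => // E; apply: (ext_gamma h h' _ (projG Ggr m x)).
  by rewrite -E.
Qed.

(** The diagonal entry of E in weight r is its coefficient of order r - 2, where dF/dlambda lives.
    With diagonal entries of weights 2 to m - 1 equal to zero, order m - 2 of E(d (s x)) keeps only
    the linear term and products of weights m and 1, which is the derivation Dz along b rho. *)
Lemma der_diagonal m (E : forall q i, C q i -> SW q i) (Dz : forall q i, C q i -> WR q i)
   q (i j k : int) (h : i + 1 = j) (h' : j + 1 = k) (x : P q i) :
  (2 <= m <= n)%N -> is_der F E -> is_der brho Dz ->
  (forall r, (2 <= r < m)%N -> forall q (i j : int) (h : i + 1 = j) (y : P q i),
     G r y -> E q j (chom s h y) (r - 2)%N = 0) ->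
  (forall r, forall q (i j : int) (h : i + 1 = j) (y : P q i), G r y ->
     Dz q j (chom s h y) = if r == m then E q j (chom s h y) (m - 2)%N else 0) ->
  G m.+1 x -> E q k (dif h' (chom s h x)) (m - 2)%N = Dz q k (dif h' (chom s h x)).
Proof.
move=> /andP[m2 mn] DE DD Ev Ez Gx; have h2 : i + (1 + 1) = k by rewrite addrA h.
have El q' k' l' : linear (fun u : C q' k' => E q' k' u l') by move=> a u v; rewrite (der_lin DE).
have [I [Q [e [He -> _]]]] := ds_expand Ggr Gfin Ccobar h h' h2 Gx.
rewrite (rawB (El _ _ _)) (rawN (El _ _ _)) (raw_sum (El _ _ _)).
rewrite (rawB (der_lin DD _ _)) (rawN (der_lin DD _ _)) (raw_sum (der_lin DD _ _)).
rewrite (Ez m _ _ _ _ _ (G_dif Ggr h Gx)) eqxx; congr (_ - _).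
have m1 : (m - 2).+1 = (m - 1)%N by lia.
apply: eq_bigr => p /He [r [t [rt r0 t0 Gr Gt]]].
rewrite (der_term s _ _ DE) (der_term s _ _ DD).
rewrite -[LHS]/(sgn rat 1 ^+ `|tma (e p)| *:
  (ser_mu (tmt (e p)) (deg_hom2 (tmh (e p)) h2)
     (E _ _ (chom s erefl (tmy (e p)))) (F _ _ (chom s erefl (tmz (e p)))) (m - 2)%N +
   ser_mu (tmt (e p)) (deg_hom2 (tmh (e p)) h2)
     (F _ _ (chom s erefl (tmy (e p)))) (E _ _ (chom s erefl (tmz (e p)))) (m - 2)%N)).
rewrite (mu_F_r _ _ _ _ _ t0 Gt) (mu_F_l _ _ _ _ _ r0 Gr) m1.
rewrite (Ez r _ _ _ _ _ Gr) (Ez t _ _ _ _ _ Gt).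
have n1 : (1 < n)%N by [].
congr (_ *: (_ + _)).
  have [rm|rm] := eqVneq r m.
    have t1 : t = 1%N by lia.
    have -> : (t <= m - 1)%N && (t < n)%N by lia.
    have -> : (m - 1 - t = m - 2)%N by lia.
    rewrite t1 in Gt; by rewrite (alpha1 Gt).
  rewrite (raw0 (mu_linl (op_str WR) _ _ _)).
  case: ifP => // /andP[tm _].
  have er : (m - 1 - t = r - 2)%N by lia.
  have r2 : (2 <= r < m)%N by lia.
  by rewrite er (Ev r) // (raw0 (mu_linl (op_str WR) _ _ _)).
have [tm|tm] := eqVneq t m.
  have r1 : r = 1%N by lia.
  have -> : (r <= m - 1)%N && (r < n)%N by lia.
  have -> : (m - 1 - r = m - 2)%N by lia.
  rewrite r1 in Gr; by rewrite (alpha1 Gr).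
rewrite (raw0 (mu_linr (op_str WR) _ _ _)).
case: ifP => // /andP[rm _].
have et : (m - 1 - r = t - 2)%N by lia.
have t2 : (2 <= t < m)%N by lia.
by rewrite et (Ev t) // (raw0 (mu_linr (op_str WR) _ _ _)).
Qed.

Lemma is_der_lincomb (A : operad Xi rat) (B D E : forall q i, C q i -> A q i) a :
  is_der B D -> is_der B E -> is_der B (fun q i x => a *: D q i x + E q i x).
Proof.
move=> HD HE; split.
- move=> q i c x y; rewrite (der_lin HD) (der_lin HE) !scalerDr !scalerA.
  by rewrite [a * c]mulrC addrACA.
- move=> q t ht i x; rewrite (Defs.act_lin) //.
  by rewrite (der_act HD) (der_act HE).
- move=> q q1 q2 t i j k h x y; rewrite (der_mu HD) (der_mu HE).
  rewrite (mu_linl (op_str A) t h) (mu_linr (op_str A) t h) scalerDr.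
  by rewrite addrACA.
Qed.

Lemma is_der_shift (D : forall q i, C q i -> SW q i) p : is_der F D ->
  is_der F (fun q i x => iter p (@ser_shift (WR q i)) (D q i x) : SW q i).
Proof.
move=> HD; elim: p => [//|p [h1 h2 h3]]; split.
- move=> q i a x y; rewrite !iterS h1.
  exact: (ser_shift_lin (V := WR q i)).
- move=> q t ht i x; rewrite !iterS h2; apply/funext => -[|l] //=.
  by rewrite (raw0 (@act_lin _ _ _ WR _ _ ht _)).
- move=> q q1 q2 t i j k h x y; rewrite !iterS h3.
  rewrite (rawD (ser_shift_lin (V := WR q k))).
  congr (_ + _); first exact: (esym (ser_mu_shiftl (A := WR) t h _ _)).
  exact: (esym (ser_mu_shiftr (A := WR) t h _ _)).
Qed.

Lemma kscale_lin q i (k : K) : linear (fun x : WR q i => (k *: (x : W q i)) : WR q i).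
Proof.
move=> a x y; rewrite -[LHS]/(k *: (phi a *: (x : W q i) + y)) scalerDr scalerA mulrC.
by rewrite -scalerA.
Qed.

Lemma kscale_act q i (k : K) t (ht : @colperm _ _ q t) (x : WR q i) :
  (k *: (act ht x : W q i)) = act ht (k *: (x : W q i) : WR q i) :> W q i.
Proof. exact: (esym (rawZ (@act_lin _ _ _ W _ _ ht _) _ _)). Qed.

Lemma kscale_mul q q1 q2 (t : tree2 q q1 q2) (i j l : int) (h : i + j = l) (k : K)
    (x : WR q1 i) (y : WR q2 j) :
  (k *: (mu (op_str WR) t h x y : W q l)) = mu (op_str WR) t h (k *: (x : W q1 i) : WR q1 i) y :> W q l.
Proof. exact: (esym (rawZ (mu_linl (dgo_str W) t h y) _ _)). Qed.

Lemma kscale_mur q q1 q2 (t : tree2 q q1 q2) (i j l : int) (h : i + j = l) (k : K)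
    (x : WR q1 i) (y : WR q2 j) :
  (k *: (mu (op_str WR) t h x y : W q l)) = mu (op_str WR) t h x (k *: (y : W q2 j) : WR q2 j) :> W q l.
Proof. exact: (esym (rawZ (mu_linr (dgo_str W) t h x) _ _)). Qed.

Definition ksum M (kappa : 'I_M -> K) q i (v : 'I_M -> WR q i) : WR q i :=
  \sum_l ((kappa l *: (v l : W q i)) : WR q i).

Lemma ksum_der M (kappa : 'I_M -> K) (D : 'I_M -> forall q i, C q i -> WR q i)
    (B : forall q i, C q i -> WR q i) :
  (forall l, is_der B (D l)) -> is_der B (fun q i x => ksum kappa (fun l => D l q i x)).
Proof.
move=> HD; split.
- move=> q i a x y; rewrite /ksum scaler_sumr -big_split; apply: eq_bigr => l _.
  by rewrite (der_lin (HD l)) (kscale_lin (kappa l)).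
- move=> q t ht i x; rewrite /ksum (raw_sum (@act_lin _ _ _ WR _ _ ht _)).
  by apply: eq_bigr => l _; rewrite (der_act (HD l)) kscale_act.
- move=> q q1 q2 t i j k h x y; rewrite /ksum.
  rewrite (raw_sum (mu_linl (op_str WR) t h _)) (raw_sum (mu_linr (op_str WR) t h _)).
  rewrite -big_split; apply: eq_bigr => l _.
  rewrite (der_mu (HD l)) (rawD (kscale_lin (kappa l))).
  by rewrite kscale_mul kscale_mur.
Qed.

Lemma ksum_ser_der M (kappa : 'I_M -> K) (D : 'I_M -> forall q i, C q i -> SW q i) :
  (forall l, is_der F (D l)) ->
  is_der F (fun q i x => (fun j => ksum kappa (fun l => D l q i x j)) : SW q i).
Proof.
move=> HD; split.
- move=> q i a x y; apply/funext => j; rewrite [RHS]fct_linE.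
  rewrite /ksum scaler_sumr -big_split; apply: eq_bigr => l _.
  rewrite (der_lin (HD l)); exact: (kscale_lin (kappa l) a (D l q i x j)).
- move=> q t ht i x; apply/funext => j.
  rewrite -[RHS]/(act ht (ksum kappa (fun l => D l q i x j))) /ksum.
  rewrite (raw_sum (@act_lin _ _ _ WR _ _ ht _)); apply: eq_bigr => l _.
  rewrite (der_act (HD l)); exact: (kscale_act (kappa l) ht (D l q i x j)).
- move=> q q1 q2 t i j k h x y; apply/funext => m.
  rewrite -[RHS]/(ser_mu t h (fun j => ksum kappa (fun l => D l _ _ x j)) (F _ _ y) m +
    ser_mu t h (F _ _ x) (fun j => ksum kappa (fun l => D l _ _ y j)) m).
  rewrite /ser_mu /ksum -big_split.
  under [RHS]eq_bigr => a _ do rewrite (raw_sum (mu_linl (op_str WR) t h _))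
    (raw_sum (mu_linr (op_str WR) t h _)) -big_split.
  rewrite exchange_big /=; apply: eq_bigr => l _.
  rewrite (der_mu (HD l)).
  rewrite -[X in kappa l *: X]/(ser_mu t h (D l _ _ x) (F _ _ y) m +
     ser_mu t h (F _ _ x) (D l _ _ y) m) /ser_mu -big_split.
  rewrite (raw_sum (kscale_lin (kappa l))); apply: eq_bigr => a _.
  by rewrite (rawD (kscale_lin (kappa l))) kscale_mul kscale_mur.
Qed.

(* E is what remains of dF/dlambda after the corrections in weights < m: it acts
   on boundaries as dF/dlambda does, and the diagonal entries that have been
   treated vanish. *)
Definition euler_inv m (E : forall q i, C q i -> SW q i) : Prop :=
  [/\ is_der F E,
    forall k, (k <= n.+1)%N -> forall q (i j l : int) (h : i + 1 = j) (h' : j + 1 = l)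
      (x : P q i) a, (a.+2 <= n)%N -> G k x ->
      E q l (dif h' (chom s h x)) a = a.+1%:R *: F q l (dif h' (chom s h x)) a.+1 &
    forall r, (2 <= r < m)%N -> forall q (i j : int) (h : i + 1 = j) (y : P q i),
      G r y -> E q j (chom s h y) (r - 2)%N = 0].

Lemma euler_inv2 : euler_inv 2 (fun q i x => ser_der (F q i x) : SW q i).
Proof.
split.
- split.
  + by move=> q i a x y; rewrite F_lin; exact: (ser_der_lin (V := WR q i)).
  + move=> q t ht i x; rewrite (om_act F); apply/funext => l.
    exact: (esym (rawZ (@act_lin _ _ _ WR _ _ ht _) _ _)).
  + by move=> q q1 q2 t i j k h x y; rewrite F_mu ser_mu_der.
- by [].
- by move=> r /andP[h1 h2]; move: (leq_ltn_trans h1 h2); rewrite ltnn.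
Qed.

Section DiagonalDefect.
Variables (m : nat) (E : forall q i, C q i -> SW q i).
Hypotheses (DE : is_der F E) (mn : (2 <= m <= n)%N).

Lemma defect_lin q (i j : int) (h : i + 1 = j) :
  linear (fun x : P q i => @E q j (chom s h (proj Ggr m x)) (m - 2)%N : WR q j).
Proof. by move=> a x y; rewrite proj_lin chom_lin (der_lin DE). Qed.

Lemma defect_act q t (ht : @colperm _ _ q t) (i j : int) (h : i + 1 = j) x :
  @E q j (chom s h (proj Ggr m (act ht x))) (m - 2)%N =
  act ht (@E q j (chom s h (proj Ggr m x)) (m - 2)%N).
Proof. by rewrite proj_act chom_act (der_act DE). Qed.

(** The next diagonal entry to be removed from E, extended by 0 to the other weights. *)
Definition defect : collHom P WR 1 := CollHom defect_lin defect_act.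

Lemma defectG r q (i j : int) (h : i + 1 = j) (y : P q i) : G r y ->
  chom defect h y = if r == m then @E q j (chom s h y) (m - 2)%N else 0.
Proof.
move=> Gy; rewrite /= (proj_G Ggr _ Gy) eq_sym; case: eqP => // _.
by rewrite (raw0 (chom_lin s _)) (raw0 (der_lin DE _ _)).
Qed.

Lemma defect_der_ex : exists Dz : forall q i, C q i -> WR q i, is_der brho Dz /\
  forall q (i j : int) (h : i + 1 = j) x, Dz q j (chom s h x) = chom defect h x.
Proof.
have [D [DF Ds]] := der_ex Ccobar (push brho s) defect.
exists D; split=> //; apply: der_ext DF => q i x.
by apply: (ext_unique Ccobar) => *; rewrite extE.
Qed.
End DiagonalDefect.

(** The defect in weight m defines a derivation Dz along b rho, closed by [der_diagonal]. Its
    rational components lift to derivations of C commuting with d; composing these with F and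
    shifting by m - 2 orders gives a derivation along F with the same diagonal entry in weight m,
    which is subtracted. *)
Lemma euler_step m E : (2 <= m < n)%N -> euler_inv m E -> exists E', euler_inv m.+1 E'.
Proof.
move=> /andP[m2 mn] [DE Ed Ec].
have mn' : (2 <= m <= n)%N by rewrite m2 ltnW.
have [Dz [DDz Dzs]] := defect_der_ex m DE.
have DzG r q (i j : int) (h : i + 1 = j) (y : P q i) : G r y ->
    Dz q j (chom s h y) = if r == m then E q j (chom s h y) (m - 2)%N else 0.
  by move=> Gy; rewrite Dzs (defectG m DE _ Gy).
(* The map rho is rational, so the defect is split into rational pieces before being lifted along
   it. *)
have [M [kappa [c [al [kf _ Hal]]]]] := decomposition bk Ggr Gfin (defect m DE) n.+1.
pose zl l : collHom P H 1 := precomp (@proj_lin _ _ _ _ _ Ggr m) (@proj_act _ _ _ _ _ Ggr m) (al l).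
have Hl l := der_ex Ccobar (A := dgo_operad H) (push rho s) (zl l).
pose Dl l := projT1 (cid (Hl l)).
have Dls l : forall q (i j : int) (h : i + 1 = j) x,
    Dl l q j (chom s h x) = chom (zl l) h x := (projT2 (cid (Hl l))).2.
have DDl l : is_der (A := dgo_operad H) rho (Dl l).
  apply: der_ext (projT2 (cid (Hl l))).1 => q i x.
  by apply: (@ext_unique _ _ P C s Ccobar _ (ext Ccobar (push rho s)) rho) => *; rewrite extE.
have zlG l r q (i j : int) (h : i + 1 = j) (y : P q i) : G r y ->
    Dl l q j (chom s h y) = if r == m then chom (al l) h y else 0.
  move=> Gy; rewrite Dls /= (proj_G Ggr _ Gy) eq_sym; case: eqP => // _.
  by rewrite (raw0 (chom_lin (al l) _)).
pose SB q i x := ksum kappa (fun l => b q i (Dl l q i x)).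
have DSB : is_der brho SB.
  apply: (@ksum_der M kappa (fun l q i x => b q i (Dl l q i x)) brho) => l.
  case: (DDl l) => h1 h2 h3; split.
  - by move=> q i a x y; rewrite h1 (@om_lin _ _ _ _ _ b).
  - by move=> q t ht i x; rewrite h2 (om_act b).
  - by move=> q q1 q2 t i j k h x y; rewrite h3 (rawD (om_lin b)) !(om_mu b).
have SBs r q (i j : int) (h : i + 1 = j) (y : P q i) : G r y ->
    SB q j (chom s h y) = Dz q j (chom s h y).
  move=> Gy; rewrite (DzG r) // /SB /ksum.
  under eq_bigr => l _ do rewrite (zlG l r) //.
  case: eqP => [rm|_].
    have -> : E q j (chom s h y) (m - 2)%N = chom (defect m DE) h y.
      by rewrite (defectG m DE h Gy) rm eqxx.
    by rewrite (Hal m _ _ _ _ h y) ?(leq_trans (ltnW mn)) // -rm.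
  rewrite big1 // => l _; rewrite (raw0 (om_lin b)).
  exact: (raw0 (kscale_lin (kappa l))).
have Dlc l q (i j k : int) (h : i + 1 = j) (h' : j + 1 = k) x : G m.+1 x ->
    Dl l q k (dif h' (chom s h x)) = 0.
  move=> Gx; move: l; apply: (kf_inj bk kf).
  transitivity (SB q k (dif h' (chom s h x))) => //.
  rewrite (der_local Ggr Gfin Ccobar h h' DSB DDz Gx); last first.
    by move=> r rm q' i' j' h1 y Gy; apply: SBs Gy.
  rewrite -(der_diagonal h h' mn' DE DDz Ec DzG Gx).
  (* Here m < n is used: the next order m - 1 of F on boundaries must still be in the range where it
     vanishes. For m = n this term is the obstruction itself. *)
  rewrite (Ed m.+1) ?ltnS ?(ltnW mn) //; last by lia.
  by rewrite Fd_zero ?scaler0 //; lia.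
have Hlift l : exists D : forall q i, C q i -> C q i, [/\ inner_der D,
    forall r, (r <= n.+1)%N -> forall q (i j : int) (h : i + 1 = j) y, G r y ->
      rho q j (D q j (chom s h y)) = Dl l q j (chom s h y) &
    forall r, (r <= n.+1)%N -> forall q (i j k : int) (h : i + 1 = j) (h' : j + 1 = k) y,
      G r y -> dif h' (D q j (chom s h y)) = D q k (dif h' (chom s h y))].
  have van r : r != m -> forall q (i j : int) (h : i + 1 = j) y, G r y ->
      Dl l q j (chom s h y) = 0.
    by move=> rm q i j h y Gy; rewrite (zlG l r) // (negbTE rm).
  have [D0 HD0] := derivation_lift Ggr Gfin Ccobar rho_af H0 rho_van n.+1 m2 (DDl l) van
    (fun q i j k h h' x Gx => Dlc l q i j k h h' x Gx).
  by exists D0.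
pose D l := projT1 (cid (Hlift l)).
have DD l : inner_der (D l) by have [] := projT2 (cid (Hlift l)).
have Drho l : forall r, (r <= n.+1)%N -> forall q (i j : int) (h : i + 1 = j) y, G r y ->
    rho q j (D l q j (chom s h y)) = Dl l q j (chom s h y).
  by have [] := projT2 (cid (Hlift l)).
have Ddif l : forall r, (r <= n.+1)%N -> forall q (i j k : int) (h : i + 1 = j)
    (h' : j + 1 = k) y, G r y ->
    dif h' (D l q j (chom s h y)) = D l q k (dif h' (chom s h y)).
  by have [] := projT2 (cid (Hlift l)).
pose T q i (x : C q i) : SW q i := fun j => ksum kappa (fun l => F q i (D l q i x) j).
have DT : is_der F T.
  apply: (@ksum_ser_der M kappa (fun l q i x => F q i (D l q i x))) => l.
  case: (DD l) => h1 h2 h3; split.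
  - by move=> q i a x y; rewrite h1 (@om_lin _ _ _ _ _ F).
  - by move=> q t ht i x; rewrite h2 (om_act F).
  - move=> q q1 q2 t i j k h x y.
    by rewrite h3 (rawD (om_lin F)) !(om_mu F).
have T0 r q (i j : int) (h : i + 1 = j) (y : P q i) : (r <= n.+1)%N -> G r y ->
    T q j (chom s h y) 0%N = Dz q j (chom s h y).
  move=> rn Gy; rewrite -(SBs r) // /T /SB /ksum; apply: eq_bigr => l _.
  by rewrite F0E /= (Drho l r).
have Td r q (i j k : int) (h : i + 1 = j) (h' : j + 1 = k) (y : P q i) a :
    (r <= n.+1)%N -> G r y -> (a.+2 <= n)%N -> T q k (dif h' (chom s h y)) a = 0.
  move=> rn Gy an; rewrite /T /ksum big1 // => l _.
  by rewrite -(Ddif l r) // Fd_zero //; exact: (raw0 (kscale_lin (kappa l))).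
(* The shift moves order 0 of T, which is Dz on generators, to the diagonal position of weight m;
   the earlier entries, of orders r - 2 < m - 2, are untouched. *)
pose E' q i (x : C q i) : SW q i :=
  (-1) *: (iter (m - 2) (@ser_shift (WR q i)) (T q i x) : SW q i) + E q i x.
have E'E q i x a : E' q i x a =
    - (if (m - 2 <= a)%N then T q i x (a - (m - 2))%N else 0) + E q i x a.
  by rewrite /E' fct_linE iter_shift scaleN1r.
exists E'; split.
- by apply: is_der_lincomb => //; apply: is_der_shift.
- move=> k kn q i j l h h' x a an Gx; rewrite E'E (Ed k) //.
  case: ifP => _; last by rewrite oppr0 add0r.
  by rewrite (Td k) ?oppr0 ?add0r //; apply: leq_trans an; rewrite !ltnS leq_subr.
- move=> r /andP[r2]; rewrite ltnS leq_eqVlt => /orP[/eqP->|rm] q i j h y Gy.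
    rewrite E'E leqnn subnn (T0 m) ?(leq_trans (ltnW mn)) //.
    by rewrite (DzG m) // eqxx addNr.
  rewrite E'E (Ec r) ?r2 // addr0 ifF ?oppr0 //.
  by lia.
Qed.

Lemma euler_inv_ex : exists E, euler_inv n E.
Proof.
have : forall k, (2 + k <= n)%N -> exists E, euler_inv (2 + k) E.
  elim=> [_|k IH kn]; first by eexists; exact: euler_inv2.
  have [E HE] := IH (ltnW kn).
  by rewrite addnS; apply: euler_step HE; rewrite leq_addr.
by move/(_ (n - 2)%N); rewrite subnKC //; apply.
Qed.

(** For m = n, [der_diagonal] says that Dz(d (s x)) is n - 1 times the value of gamma on d (s x),
    the obstruction. The component of weight n is therefore taken to be the defect divided by -(n -
    1), and that of weight n+1 to be 0, as W has zero differential. *)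
Lemma euler_extension : exists alpha' : collHom P (res_dg phi W) 1,
  is_sprout G n.+1 alpha' /\ forall k, (k < n)%N -> eq_on (@G k) alpha' alpha.
Proof.
have [E [DE Ed Ec]] := euler_inv_ex.
have mn : (2 <= n <= n)%N by rewrite n2 leqnn.
have [Dz [DDz Dzs]] := defect_der_ex n DE.
pose z : collHom P WR 1 := defect n DE.
have zG r q (i j : int) (h : i + 1 = j) (y : P q i) : G r y ->
    chom z h y = if r == n then E q j (chom s h y) (n - 2)%N else 0.
  by move=> Gy; rewrite (defectG n DE _ Gy).
pose cn : rat := - (n - 1)%:R^-1.
have gl q (i j : int) (h : i + 1 = j) :
    linear (fun x : P q i => chom gamma h x + cn *: chom z h x : WR q j).
  move=> a x y; rewrite !chom_lin !scalerDr !scalerA [cn * a]mulrC.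
  by rewrite addrACA.
have ga q t (ht : colperm t) (i j : int) (h : i + 1 = j) (x : P q i) :
    chom gamma h (act ht x) + cn *: chom z h (act ht x) =
    act ht (chom gamma h x + cn *: chom z h x : WR q j).
  rewrite !chom_act (rawD (act_lin _)).
  by rewrite (rawZ (act_lin _)).
pose g' : collHom P WR 1 := CollHom gl ga.
have g'E q (i j : int) (h : i + 1 = j) (x : P q i) :
  chom g' h x = chom gamma h x + cn *: chom z h x by [].
have g'low r : (r < n)%N -> eq_on (@G r) g' alpha.
  move=> rn q i x Gx j h; rewrite g'E (zG r) // (gammaG _ Gx) rn ltn_eqF //.
  by rewrite scaler0 addr0.
exists g'; split=> //; apply/(sproutP Ggr Gfin Ccobar).
move=> m mn1 q i j k h h' x Gx.
rewrite -[LHS]/(@dif _ _ _ W q j k h' (chom g' h x)) W0; symmetry.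
have [mn0|nm] := leqP m n.
  rewrite -[RHS](ext_gamma h h' mn0 Gx).
  apply: (@ext_local _ _ P G Ggr Gfin C s Ccobar m WR (ext Ccobar g')
    (ext Ccobar gamma) _ _ _ _ h h' _ Gx) => r rm q' i' j' h1 y Gy.
  have rn := leq_trans rm mn0.
  by rewrite !extE (g'low r) // (gammaG _ Gy) rn.
have Em : m = n.+1 by apply/eqP; rewrite eqn_leq mn1.
subst m; have h2 : i + (1 + 1) = k by rewrite addrA h.
(* The modification enters linearly: two factors of weight n have total weight 2n > n + 1. *)
transitivity (ext Ccobar gamma q k (dif h' (chom s h x)) +
    cn *: Dz q k (dif h' (chom s h x))).
  have [I [Q [e [He -> _]]]] := ds_expand Ggr Gfin Ccobar h h' h2 Gx.
  rewrite !(rawB (@om_lin _ _ _ _ _ (ext Ccobar _) _ _)).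
  rewrite !(rawN (@om_lin _ _ _ _ _ (ext Ccobar _) _ _)).
  rewrite !(raw_sum (@om_lin _ _ _ _ _ (ext Ccobar _) _ _)).
  rewrite (rawB (der_lin DDz _ _)) (rawN (der_lin DDz _ _)) (raw_sum (der_lin DDz _ _)).
  rewrite !extE g'E Dzs -/z scalerBr scalerN opprD addrACA; congr (_ + _).
  rewrite -opprD; congr (- _).
  rewrite sum_addZ; apply: eq_bigr => p /He [r [t [rt r0 t0 Gr Gt]]].
  rewrite (der_term s _ _ DDz) !term_val_map !extE !g'E !Dzs -/z.
  rewrite (gammaG _ Gr) (gammaG _ Gt) (zG r) // (zG t) //.
  rewrite scalerA [cn * _]mulrC -scalerA -scalerDr; congr (_ *: _).
  have [rn|rn] := eqVneq r n.
    have t1 : t = 1%N by lia.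
    rewrite t1 in Gt *; rewrite rn ltnn n2 (ltn_eqF n2) scaler0 addr0 add0r.
    rewrite (raw0 (mu_linl (op_str WR) _ _ _)) (raw0 (mu_linr (op_str WR) _ _ _)).
    rewrite addr0 add0r (rawZ (mu_linl (op_str WR) _ _ _)).
    by rewrite (alpha1 Gt).
  have [tn|tn] := eqVneq t n.
    have r1 : r = 1%N by lia.
    rewrite r1 in Gr *; rewrite tn ltnn n2 scaler0 addr0 add0r.
    rewrite (raw0 (mu_linl (op_str WR) _ _ _)) (raw0 (mu_linr (op_str WR) _ _ _)).
    rewrite !add0r (rawZ (mu_linr (op_str WR) _ _ _)).
    by rewrite (alpha1 Gr).
  rewrite !scaler0 !addr0 (raw0 (mu_linl (op_str WR) _ _ _)).
  by rewrite (raw0 (mu_linr (op_str WR) _ _ _)) addr0 scaler0 addr0.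
have DzG r q' (i' j' : int) (h1 : i' + 1 = j') (y : P q' i') : G r y ->
    Dz q' j' (chom s h1 y) = if r == n then E q' j' (chom s h1 y) (n - 2)%N else 0.
  by move=> Gy; rewrite Dzs -/z (zG r).
rewrite -(der_diagonal h h' mn DE DDz Ec DzG Gx).
rewrite (Ed n.+1) //; last by lia.
rewrite (Fd_expand h h' _ Gx) ifT; last by lia.
have -> : (n - 2).+1 = (n - 1)%N by lia.
rewrite scalerA /cn mulNr mulVf ?scaleN1r ?addrN //.
by rewrite Num.Theory.pnatr_eq0; lia.
Qed.
End Euler.

(** * Formal operads *)

Section FormalCase.
Context {disp : Order.disp_t} {Xi : orderType disp}.

Lemma functional_operad_map (K : fieldType) (A B : operad Xi K)
    (R : forall q i, A q i -> B q i -> Prop) :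
  (forall q i x, exists y, R q i x y) ->
  (forall q i x y y', R q i x y -> R q i x y' -> y = y') ->
  (forall q i a x y x' y', R q i x y -> R q i x' y' -> R q i (a *: x + x') (a *: y + y')) ->
  (forall q s (hs : @colperm _ _ q s) i x y, R q i x y -> R q i (act hs x) (act hs y)) ->
  (forall q q1 q2 (t : tree2 q q1 q2) (i j k : int) (h : i + j = k) x y x' y',
     R q1 i x y -> R q2 j x' y' ->
     R q k (mu (op_str A) t h x x') (mu (op_str B) t h y y')) ->
  (forall c, R _ _ (oid (op_str A) c) (oid (op_str B) c)) ->
  exists f : operad_map A B, forall q i x, R q i x (f q i x).
Proof.
move=> Rtot Rfun Rlin Ract Rmu Roid.
pose f q i x := projT1 (cid (Rtot q i x)).
have fR q i x : R q i x (f q i x) := projT2 (cid (Rtot q i x)).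
have fl q i : linear (f q i) by move=> a x y; apply: Rfun (fR _ _ _) _; apply: Rlin.
have fa q t (ht : colperm t) i x : f q i (act ht x) = act ht (f q i x).
  by apply: Rfun (fR _ _ _) _; apply: Ract.
have fm q q1 q2 (t : tree2 q q1 q2) (i j k : int) (h : i + j = k) x y :
    f q k (mu (op_str A) t h x y) = mu (op_str B) t h (f q1 i x) (f q2 j y).
  by apply: Rfun (fR _ _ _) _; apply: Rmu.
have fo c : f _ _ (oid (op_str A) c) = oid (op_str B) c.
  by apply: Rfun (fR _ _ _) _; apply: Roid.
by exists (OperadMap fl fa fm fo).
Qed.

Lemma zero_dif_map (A B : dgOperad Xi rat)
    (A0 : forall q (i j : int) (h : i + 1 = j) (x : A q i), dif h x = 0)
    (B0 : forall q (i j : int) (h : i + 1 = j) (x : B q i), dif h x = 0)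
    (f : operad_map (dgo_operad A) (dgo_operad B)) :
  forall q (i j : int) (h : i + 1 = j) (x : A q i), f q j (dif h x) = dif h (f q i x).
Proof. by move=> q i j h x; rewrite A0 B0 (raw0 (om_lin f)). Qed.

Lemma zero_coboundary (K : fieldType) (B : dgOperad Xi K)
    (B0 : forall q (i j : int) (h : i + 1 = j) (x : B q i), dif h x = 0)
    q i (x : B q i) : coboundary x -> x = 0.
Proof. by move=> [j [h [y ->]]]; apply: B0. Qed.

Lemma zero_cocycle (K : fieldType) (B : dgOperad Xi K)
    (B0 : forall q (i j : int) (h : i + 1 = j) (x : B q i), dif h x = 0)
    q i (x : B q i) : x \in cocycle.
Proof. by rewrite cocycleE B0. Qed.

(** With zero differential on the target every element is a cocycle and boundaries vanish, so
    surjectivity on cohomology is surjectivity on the nose. *)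
Lemma weak_zero_fibration (A B : dgOperad Xi rat) (f : dg_map A B)
    (B0 : forall q (i j : int) (h : i + 1 = j) (x : B q i), dif h x = 0) :
  weak_equivalence f -> acyclic_fibration f.
Proof.
move=> [finj fsurj] q i j h b a' da fa.
have ca : a' \in cocycle by apply: cocycleE' da.
have [|k [hk [u Hu]]] := finj q j a' ca; first by rewrite fa; exists i, h, b.
have ki : k = i by apply: (addIr 1); rewrite hk h.
subst k; rewrite (eq_irrelevance hk h) in Hu.
have [v cv /(zero_coboundary B0)/eqP Hv] := fsurj q i (b - f q i u) (zero_cocycle B0 _).
exists (u + v); rewrite (rawD (dif_lin _)) -Hu (cocycleP _ cv) addr0; split=> //.
rewrite (rawD (om_lin f)); move: Hv; rewrite subr_eq0 => /eqP->.
by rewrite addrC subrK.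
Qed.

Variables (P : pseudoCooperad Xi rat) (G : nat -> collSet P).
Hypotheses (Ggr : is_grading G) (Gfin : forall k, findim_collSet (G k)).
Variables (C : dgOperad Xi rat) (s : collHom P C 1).
Hypothesis Ccobar : is_cobar s.
Variables (O : dgOperad Xi rat) (rho : dg_map C (coh_operad O)).
Hypothesis O_fin : forall q i, findim_set (@setT (O q i)).
Hypothesis rho_qiso : quasi_iso rho.
Hypothesis rho_van : forall k, (2 <= k)%N -> vanish_on (@G k) (push rho s).
Variables (K : fieldType) (phi : {rmorphism rat -> K}).
Local Notation OK := (base_change phi O).
Local Notation A0 := (res_dg phi OK).
Local Notation WR := (res_dg phi (coh_operad OK)).

Lemma coh0 (L : fieldType) (B : dgOperad Xi L) q (i j : int) (h : i + 1 = j)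
  (x : coh_operad B q i) : dif h x = 0.
Proof. by []. Qed.

Lemma WR0 q (i j : int) (h : i + 1 = j) (x : WR q i) : dif h x = 0.
Proof. by []. Qed.

Lemma coh_bc_mu q q1 q2 (t : tree2 q q1 q2) (i j k : int) (h : i + j = k)
   (x : coh O q1 i) (y : coh O q2 j) :
  coh_bc phi (coh_mu t h x y) = coh_mu t h (coh_bc phi x) (coh_bc phi y).
Proof.
have [u hu ->] := cohE x; have [v hv ->] := cohE y.
have E : coh_mu t h (cls u) (cls v) = cls (mu (dgo_str O) t h u v) := coh_muE t h hu hv.
rewrite E !(coh_bcE phi) ?mu_cocycle //.
have E' : coh_mu t h (cls (bc_in phi u : OK q1 i)) (cls (bc_in phi v : OK q2 j)) =
  cls (mu (dgo_str OK) t h (bc_in phi u) (bc_in phi v)) :=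
  coh_muE t h (bc_cocycle phi hu) (bc_cocycle phi hv).
rewrite E'; congr (cls _); exact: (esym (bc_muE phi t h u v)).
Qed.

Definition coh_incl : operad_map (dgo_operad (coh_operad O)) (dgo_operad WR) :=
  @OperadMap _ _ _ (dgo_operad (coh_operad O)) (dgo_operad WR)
    (fun q i x => coh_bc phi x) (kf_lin (coh_bc_kform phi O_fin))
    (kf_act (coh_bc_kform phi O_fin)) coh_bc_mu
    (fun c => coh_bcE phi (oid_cocycle O c)).

Variable alpha : collHom P O 1.
Hypothesis alpha_cocycle : forall q (i j : int) (h : i + 1 = j) (x : P q i), G 1%N x ->
  chom alpha h x \in cocycle.
Hypothesis alpha_proj : forall q i (x : P q i), G 1%N x -> forall (j : int) (h : i + 1 = j),
     cls (chom alpha h x) = rho q j (chom s h x).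

(** The zigzag relates O (x) K to its own cohomology, but on cohomology it induces an automorphism
    g. A sprout beta obtained in W thus has the right classes only after applying the inverse of g;
    it is extended there and moved back by g. *)
Lemma formal_extendable : formal OK ->
  extendable G (A := A0) (fun q (i j : int) (h : i + 1 = j) (x : P q i) (y : A0 q j) => y = bc_in phi (chom alpha h x)).
Proof.
move=> fO; have [R [RR Rext _]] := transfer_formal Ggr Gfin Ccobar phi fO.
apply: Rext => n n2 beta bs Hb.
have bcc (q : corolla) (i : int) (z : A0 q i) : z \in cocycle -> (z : OK q i) \in cocycle by [].
(* The graph of g: a class is related to whatever the zigzag relates to one of its
   representatives. *)
pose Gm q i (w w' : WR q i) := exists z : A0 q i,
  [/\ z \in cocycle, w = cls (z : OK q i) & R q i z w'].
have RB q i x y x' y' : R q i x y -> R q i x' y' -> R q i (x' - x) (y' - y).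
  by move=> H1 H2; have := cc_lin RR (-1) H1 H2; rewrite !scaleN1r addrC [_ + y']addrC.
have Gfun q i w w1 w2 : Gm q i w w1 -> Gm q i w w2 -> w1 = w2.
  move=> [z1 [c1 E1 R1]] [z2 [c2 E2 R2]]; apply/eqP; rewrite eq_sym -subr_eq0.
  apply/eqP/(zero_coboundary WR0)/(cc_bnd RR (RB _ _ _ _ _ _ R1 R2)).
  by apply/(@clsP _ _ _ OK) => //; rewrite -E1 -E2.
have Ginj q i w w1 w2 : Gm q i w1 w -> Gm q i w2 w -> w1 = w2.
  move=> [z1 [c1 -> R1]] [z2 [c2 -> R2]]; apply/(@clsP _ _ _ OK) => //.
  have := RB _ _ _ _ _ _ R2 R1; rewrite subrr => /(cc_bnd RR) [_]; apply.
  exact: coboundary0.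
have Gtot q i w : exists w', Gm q i w w'.
  have cz : (rep w : A0 q i) \in cocycle by exact: (rep_cocycle (w : coh OK q i)).
  have [w' Hw] := cc_total RR cz; exists w', (rep w); split=> //.
  by rewrite cls_rep.
have Gsurj q i w' : exists w, Gm q i w w'.
  have [z Rz] := cc_surj RR (zero_cocycle WR0 w').
  by exists (cls (z : OK q i)), z; split=> //; have [] := cc_cocycle RR Rz.
have Glin q i a x y x' y' : Gm q i x y -> Gm q i x' y' -> Gm q i (a *: x + x') (a *: y + y').
  move=> [z [c -> Rz]] [z' [c' -> Rz']]; exists (a *: z + z'); split.
  - by rewrite rpredD ?rpredZ.
  - exact: (esym (@cls_lin _ _ _ OK q i (phi a) z z' c c')).
  - exact: cc_lin.
have Gact q t (ht : colperm t) i x y : Gm q i x y -> Gm q i (act ht x) (act ht y).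
  move=> [z [c -> Rz]]; exists (act ht z); split; first exact: act_cocycle.
    exact: (@coh_actE _ _ _ OK).
  exact: cc_act.
have Gmu q q1 q2 (t : tree2 q q1 q2) (i j k : int) (h : i + j = k) x y x' y' :
    Gm q1 i x y -> Gm q2 j x' y' ->
    Gm q k (mu (dgo_str WR) t h x x') (mu (dgo_str WR) t h y y').
  move=> [z [c -> Rz]] [z' [c' -> Rz']].
  exists (mu (dgo_str A0) t h z z'); split; first exact: mu_cocycle.
    exact: (@coh_muE _ _ _ OK).
  exact: cc_mu.
have Goid c : Gm _ _ (oid (dgo_str WR) c) (oid (dgo_str WR) c).
  exists (oid (dgo_str A0) c); split=> //; first exact: oid_cocycle.
  exact: cc_oid.
have [g Hg] := functional_operad_map (A := dgo_operad WR) (B := dgo_operad WR)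
  (R := Gm) Gtot Gfun Glin Gact Gmu Goid.
have [f Hf] := functional_operad_map (A := dgo_operad WR) (B := dgo_operad WR)
  (R := fun q i w' w => Gm q i w w') Gsurj (fun q i w w1 w2 => @Ginj q i w w1 w2)
  (fun q i a x y x' y' => @Glin q i a y x y' x')
  (fun q t ht i x y => @Gact q t ht i y x)
  (fun q q1 q2 t i j k h x y x' y' => @Gmu q q1 q2 t i j k h y x y' x') Goid.
pose gd : dg_map WR WR := @DGMap _ _ _ WR WR g (zero_dif_map WR0 WR0 g).
pose fd : dg_map WR WR := @DGMap _ _ _ WR WR f (zero_dif_map WR0 WR0 f).
have gamma_s : is_sprout G n (push fd beta) := push_sprout Ggr Gfin Ccobar fd bs.
have gf q i w : g q i (f q i w) = w by apply: Gfun (Hg _ _ _) (Hf _ _ _).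
have gamma1 : eq_on (@G 1%N) (push fd beta) (push (operad_comp coh_incl rho) s).
  move=> q i x Gx j h; have [z [Ez Rz]] := Hb q i j h x Gx.
  transitivity (cls (bc_in phi (chom alpha h x) : OK q j)).
    apply: Ginj (Hf _ _ _) _; exists z; split=> //; last by rewrite Ez.
    by have [] := cc_cocycle RR Rz.
  rewrite -(coh_bcE phi (alpha_cocycle h Gx)) (alpha_proj Gx).
  by [].
have rho_af := weak_zero_fibration (@coh0 _ O) (quasi_iso_weak rho_qiso).
have [gamma' [g's g'E]] := euler_extension Ggr Gfin Ccobar rho_af (@coh0 _ O) rho_van
  (@coh0 _ OK) (coh_bc_kform phi O_fin : kform phi coh_incl) n2 gamma_s gamma1.
exists (push gd gamma'); split; first exact: (push_sprout Ggr Gfin Ccobar gd g's).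
move=> k kn q i x Gx j h.
by rewrite pushE (g'E k kn) // pushE; exact: gf.
Qed.
End FormalCase.

(** * Descent to the rational numbers *)

Section Perturbation.
Context {disp : Order.disp_t} {Xi : orderType disp}.
Variables (P : pseudoCooperad Xi rat) (G : nat -> collSet P).
Hypotheses (Ggr : is_grading G) (Gfin : forall k, findim_collSet (G k)).
Variables (C : dgOperad Xi rat) (s : collHom P C 1).
Hypothesis Ccobar : is_cobar s.

Definition hom_lincomb (A : gColl Xi rat) (c : rat) (f g : collHom P A 1) : collHom P A 1.
Proof.
refine (@CollHom _ _ _ P A 1 (fun q i j h x => c *: chom f h x + chom g h x) _ _).
- move=> q i j h a x y; rewrite !chom_lin !scalerDr !scalerA [a * c]mulrC.
  by rewrite addrACA.
- by move=> q t ht i j h x; rewrite !chom_act act_lin.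
Defined.

Definition below n (A : gColl Xi rat) (f : collHom P A 1) : collHom P A 1 :=
  precomp (trunc_proj_lin Ggr n) (trunc_proj_act Ggr n) f.

Lemma belowG n (A : gColl Xi rat) (f : collHom P A 1) k q (i j : int) (h : i + 1 = j)
  (x : P q i) : G k x -> chom (below n f) h x = if (k < n)%N then chom f h x else 0.
Proof.
move=> Gx; rewrite /= (trunc_projG Ggr n Gx); case: ifP => // _.
exact: (raw0 (chom_lin f _)).
Qed.

(** Projection onto weights n and n+1, those of the unknown components. *)
Definition top_proj n q i (x : P q i) := trunc_proj Ggr n.+2 x - trunc_proj Ggr n x.

Lemma top_proj_lin n q i : linear (@top_proj n q i).
Proof.
move=> a x y; rewrite /top_proj !trunc_proj_lin scalerBr opprD.
by rewrite addrACA.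
Qed.

Lemma top_proj_act n q t (ht : @colperm _ _ q t) i (x : P q i) :
  top_proj n (act ht x) = act ht (top_proj n x).
Proof. by rewrite /top_proj !trunc_proj_act (rawB (act_lin _)). Qed.

Definition top n (A : gColl Xi rat) (f : collHom P A 1) : collHom P A 1 :=
  precomp (top_proj_lin n) (top_proj_act n) f.

Lemma topG n (A : gColl Xi rat) (f : collHom P A 1) k q (i j : int) (h : i + 1 = j)
  (x : P q i) : G k x -> chom (top n f) h x = if (n <= k <= n.+1)%N then chom f h x else 0.
Proof.
move=> Gx; rewrite /= /top_proj !(trunc_projG Ggr _ Gx).
have [kn|kn] := ltnP k n; rewrite ltnS /=.
  by rewrite (leq_trans (ltnW kn)) // subrr (raw0 (chom_lin f _)).
by case: ifP => _; rewrite subr0 // (raw0 (chom_lin f _)).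
Qed.

Variables (n : nat).
Hypothesis n2 : (2 <= n)%N.

(* The part of the curvature quadratic in a lives in weights >= 2n > n + 1. *)
Lemma ext_perturb (A : dgOperad Xi rat) (f g a : collHom P A 1)
    (D : forall q i, C q i -> A q i) k q (i j l : int) (h : i + 1 = j) (h' : j + 1 = l)
    (x : P q i) :
  (forall r, (r < n)%N -> vanish_on (@G r) a) ->
  (forall r, (r <= n.+1)%N -> eq_on (@G r) g (hom_lincomb 1 a f)) ->
  is_der (A := dgo_operad A) (ext Ccobar (A := dgo_operad A) f) D ->
  (forall r, (r <= n.+1)%N -> forall q (i j : int) (h : i + 1 = j) (x : P q i), G r x ->
     D q j (chom s h x) = chom a h x) ->
  (k <= n.+1)%N -> G k x ->
  ext Ccobar (A := dgo_operad A) g q l (dif h' (chom s h x)) =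
  ext Ccobar (A := dgo_operad A) f q l (dif h' (chom s h x)) + D q l (dif h' (chom s h x)).
Proof.
move=> a0 gE DF Ds kn Gx; have h2 : i + (1 + 1) = l by rewrite addrA h.
set Fg := ext _ _; set Ff := ext _ _.
have FgE r q' (i' j' : int) (h1 : i' + 1 = j') (y : P q' i') : (r <= n.+1)%N -> G r y ->
    Fg q' j' (chom s h1 y) = Ff q' j' (chom s h1 y) + D q' j' (chom s h1 y).
  move=> rn Gy; rewrite /Fg /Ff !extE (gE r rn) // (Ds r rn) //=.
  by rewrite scale1r addrC.
have [I [Q [e [He -> _]]]] := ds_expand Ggr Gfin Ccobar h h' h2 Gx.
rewrite !(rawB (om_lin _)) !(rawN (om_lin _)).
rewrite (rawB (der_lin DF _ _)) (rawN (der_lin DF _ _)).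
rewrite (FgE k.-1); last exact: (G_dif_pred Ggr).
2: by rewrite (leq_trans (leq_pred _)).
rewrite opprD -!addrA; congr (_ + _); rewrite addrCA; congr (_ + _).
rewrite -opprD !(raw_sum (om_lin _)) (raw_sum (der_lin DF _ _)) -big_split.
congr (- _); apply: eq_bigr => p /He [r [t [rt r0 t0 Gr Gt]]] /=.
rewrite !term_val_map (der_term s _ _ DF) -scalerDr; congr (_ *: _).
rewrite (FgE r) //; last by lia.
rewrite (FgE t) //; last by lia.
rewrite (rawD (mu_linl (op_str (dgo_operad A)) _ _ _)).
rewrite !(rawD (mu_linr (op_str (dgo_operad A)) _ _ _)) -!addrA; congr (_ + _).
rewrite addrCA; congr (_ + _); rewrite -[RHS]addr0; congr (_ + _).
rewrite (Ds r _ _ _ _ _ _ Gr); last by lia.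
rewrite (Ds t _ _ _ _ _ _ Gt); last by lia.
have [rn|rn] := ltnP r n.
  by rewrite (a0 r rn _ _ _ Gr) (raw0 (mu_linl (op_str (dgo_operad A)) _ _ _)).
have tn : (t < n)%N by lia.
by rewrite (a0 t tn _ _ _ Gt) (raw0 (mu_linr (op_str (dgo_operad A)) _ _ _)).
Qed.

(** The sprout condition for f + a as an affine equation in a: the left side is linear in a, the
    right side is minus the curvature of f. *)
Lemma sprout_perturb (A : dgOperad Xi rat) (f g a : collHom P A 1)
    (D : forall q i, C q i -> A q i) :
  (forall r, (r < n)%N -> vanish_on (@G r) a) ->
  (forall r, (r <= n.+1)%N -> eq_on (@G r) g (hom_lincomb 1 a f)) ->
  is_der (A := dgo_operad A) (ext Ccobar (A := dgo_operad A) f) D ->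
  (forall r, (r <= n.+1)%N -> forall q (i j : int) (h : i + 1 = j) (x : P q i), G r x ->
     D q j (chom s h x) = chom a h x) ->
  is_sprout G n.+1 g <->
  forall m, (m <= n.+1)%N -> forall q (i j k : int) (h : i + 1 = j) (h' : j + 1 = k)
    (x : P q i), G m x ->
    dif h' (chom a h x) - D q k (dif h' (chom s h x)) =
    ext Ccobar (A := dgo_operad A) f q k (dif h' (chom s h x)) - dif h' (chom f h x).
Proof.
move=> a0 gE DF Ds.
have E m q (i j k : int) (h : i + 1 = j) (h' : j + 1 = k) (x : P q i) :
    (m <= n.+1)%N -> G m x ->
    dif h' (chom g h x) - ext Ccobar (A := dgo_operad A) g q k (dif h' (chom s h x)) =
    dif h' (chom a h x) - D q k (dif h' (chom s h x)) -
    (ext Ccobar (A := dgo_operad A) f q k (dif h' (chom s h x)) - dif h' (chom f h x)).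
  move=> mn Gx; rewrite (ext_perturb h h' a0 gE DF Ds mn Gx) (gE m mn) //= scale1r.
  by rewrite (rawD (dif_lin _)) opprB addrACA opprD [X in _ + X = _]addrC.
split.
  move/(sproutP Ggr Gfin Ccobar) => H m mn q i j k h h' x Gx.
  by apply/eqP; rewrite -subr_eq0 -(E m) // (H m) // subrr.
move=> H; apply/(sproutP Ggr Gfin Ccobar) => m mn q i j k h h' x Gx.
by apply/eqP; rewrite -subr_eq0 (E m) // (H m) // subrr.
Qed.
End Perturbation.

Section Descent.
Context {disp : Order.disp_t} {Xi : orderType disp}.
Variables (P : pseudoCooperad Xi rat) (G : nat -> collSet P).
Hypotheses (Ggr : is_grading G) (Gfin : forall k, findim_collSet (G k)).
Variables (C : dgOperad Xi rat) (s : collHom P C 1).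
Hypothesis Ccobar : is_cobar s.
Variables (K : fieldType) (phi : {rmorphism rat -> K}) (O : dgOperad Xi rat).
Hypothesis O_fin : forall q i, findim_set (@setT (O q i)).
Local Notation OK := (base_change phi O).
Local Notation A0 := (res_dg phi OK).

(** A rational affine system solvable over K is solvable over Q: in coordinates along [kappa] the
    solution splits into rational vectors solving the system with right side multiplied by [c l],
    and a nonzero [c l] can be divided out. *)
Lemma descent n (alpha : collHom P O 1) (a' : collHom P A0 1) : (2 <= n)%N ->
  is_sprout G n.+1 a' ->
  (forall k, (k < n)%N -> eq_on (@G k) a' (push (bc_incl phi O) alpha)) ->
  exists alpha' : collHom P O 1,
     is_sprout G n.+1 alpha' /\ forall k, (k < n)%N -> eq_on (@G k) alpha' alpha.
Proof.
move=> n2 a's a'E.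
have bk := bc_kform phi O_fin.
have [M [kappa [c [al [kf k1 alE]]]]] := decomposition bk Ggr Gfin a' n.+1.
pose f := below Ggr n alpha; pose fK := push (bc_incl phi O) f.
pose t l := top Ggr n (al l); pose tK : collHom P A0 1 := top Ggr n a'.
have fE q i (x : C q i) : ext Ccobar (A := dgo_operad A0) fK q i x =
    bc_in phi (ext Ccobar (A := dgo_operad O) f q i x).
  apply: (@ext_unique _ _ P C s Ccobar _ (ext Ccobar (A := dgo_operad A0) fK)
    (operad_comp (bc_incl phi O) (ext Ccobar (A := dgo_operad O) f))) => q' i' j' h y.
  by rewrite extE /= extE.
pose Dx l := der_ex Ccobar (A := dgo_operad O) f (t l).
pose D l := projT1 (cid (Dx l)).
have DF l : is_der (A := dgo_operad O) (ext Ccobar (A := dgo_operad O) f) (D l) :=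
  (projT2 (cid (Dx l))).1.
have Ds l q (i j : int) (h : i + 1 = j) (x : P q i) : D l q j (chom s h x) = chom (t l) h x :=
  (projT2 (cid (Dx l))).2 q i j h x.
pose DK q i (x : C q i) : A0 q i := ksum kappa (fun l => bc_in phi (D l q i x) : A0 q i).
have DKF : is_der (A := dgo_operad A0) (ext Ccobar (A := dgo_operad A0) fK) DK.
  apply: ksum_der => l; split.
  - by move=> q i a x y; rewrite (der_lin (DF l)); exact: bc_inP.
  - by move=> q u hu i x; rewrite (der_act (DF l)); exact: (esym (bc_actE _ _ _)).
  - move=> q q1 q2 u i j k h x y; rewrite (der_mu (DF l)) bc_inD !fE.
    by congr (_ + _); exact: (esym (bc_muE _ _ _ _ _)).
have DKs r : (r <= n.+1)%N -> forall q (i j : int) (h : i + 1 = j) (x : P q i), G r x ->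
    DK q j (chom s h x) = chom tK h x.
  move=> rn q i j h x Gx; rewrite /DK (topG _ _ _ _ Gx).
  case: ifP => [rn'|rn'].
    by rewrite (alE r rn) // /ksum; apply: eq_bigr => l _; rewrite Ds (topG _ _ _ _ Gx) rn'.
  rewrite /ksum big1 // => l _.
  by rewrite Ds (topG _ _ _ _ Gx) rn' bc_in0 (scaler0 (OK q j)).
have tK0 r : (r < n)%N -> vanish_on (@G r) tK.
  by move=> rn q i x Gx j h; rewrite (topG _ _ _ _ Gx) leqNgt rn.
have t0 l r : (r < n)%N -> vanish_on (@G r) (t l).
  by move=> rn q i x Gx j h; rewrite (topG _ _ _ _ Gx) leqNgt rn.
have sumE r : (r <= n.+1)%N -> eq_on (@G r) a' (hom_lincomb 1 tK fK).
  move=> rn q i x Gx j h; rewrite /= scale1r.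
  rewrite -[X in _ = X + _]/(chom tK h x) -[X in _ = _ + X]/(bc_in phi (chom f h x) : A0 q j).
  rewrite (topG _ _ _ _ Gx) (belowG _ _ _ _ Gx) rn andbT.
  case: ltnP => [rn'|rn']; first by rewrite (a'E r rn') // add0r.
  by rewrite bc_in0 addr0.
have /(sprout_perturb Ggr Gfin n2 tK0 sumE DKF DKs) HK := a's.
have [e eDef] : exists e : forall q (i j k : int), i + 1 = j -> j + 1 = k -> P q i -> O q k,
    forall q i j k h h' x, e q i j k h h' x =
    ext Ccobar (A := dgo_operad O) f q k (dif h' (chom s h x)) - dif h' (chom f h x).
  by eexists.
have HD m l q (i j k : int) (h : i + 1 = j) (h' : j + 1 = k) (x : P q i) :
    (m <= n.+1)%N -> G m x ->
    dif h' (chom (t l) h x) - D l q k (dif h' (chom s h x)) = c l *: e q i j k h h' x.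
  move=> mn Gx; apply/eqP; rewrite -subr_eq0; apply/eqP; move: l.
  apply: (kf_inj bk (q := q) (i := k) (v := fun l => dif h' (chom (t l) h x) -
    D l q k (dif h' (chom s h x)) - c l *: e q i j k h h' x) kf).
  under eq_bigr => l _ do rewrite !bc_inB !scalerBr.
  rewrite !sumrB.
  have eE : \sum_l kappa l *: (bc_in phi (c l *: e q i j k h h' x) : OK q k) =
      bc_in phi (e q i j k h h' x).
    rewrite -[RHS]scale1r k1 scaler_suml; apply: eq_bigr => l _.
    by rewrite bc_inZ; exact: (etrans (scalerA _ _ _) (congr1 (fun w => w *: _) (mulrC _ _))).
  have dE : \sum_l kappa l *: (bc_in phi (dif h' (chom (t l) h x)) : OK q k) =
      dif h' (chom tK h x) :> OK q k.
    rewrite -(DKs m) // /DK /ksum (raw_sum (dif_lin (d := A0) _)); apply: eq_bigr => l _.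
    rewrite -[RHS]/(@bc_dif _ _ _ _ phi O q j k h' _) Ds.
    by rewrite (rawZ (@bc_dif_lin _ _ _ _ phi O q j k h')) bc_difE.
  transitivity ((dif h' (chom tK h x) : OK q k) - DK q k (dif h' (chom s h x)) -
    (bc_in phi (e q i j k h h' x) : OK q k)).
    by congr (_ - _ - _); [exact: dE | exact: eE].
  have := HK m mn q i j k h h' x Gx; rewrite fE.
  have -> : dif h' (chom fK h x) = bc_in phi (dif h' (chom f h x)) :> A0 q k.
    exact: bc_difE.
  rewrite eDef bc_inB => <-.
  exact: subrr.
(* Not all coordinates of 1 vanish. *)
have [l0 cl0] : exists l, c l <> 0.
  apply: contrapT => H; have /eqP := k1; rewrite big1 ?oner_eq0 // => l _.
  have -> : c l = 0 by apply: contrapT => Hl; apply: H; exists l.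
  by rewrite rmorph0 mul0r.
have {}cl0 : c l0 != 0 by apply/eqP.
pose a := hom_lincomb (c l0)^-1 (t l0) (hom0 P O 1).
exists (hom_lincomb 1 a f); split; last first.
  move=> k kn q i x Gx j h; rewrite /= scale1r.
  rewrite -[X in (_ *: X + _) + _]/(chom (t l0) h x) (t0 l0 k kn) // scaler0 !add0r.
  by rewrite -[LHS]/(chom f h x) (belowG _ _ _ _ Gx) kn.
(* The inner combination - D + D is the zero derivation, matching the summand [hom0] of [a]. *)
have DaF := is_der_lincomb (c l0)^-1 (DF l0)
  (is_der_lincomb (-1) (DF l0) (DF l0)).
apply/(sprout_perturb Ggr Gfin n2 (f := f) (a := a) _ _ DaF).
- move=> r rn q i x Gx j h; rewrite /=.
  by rewrite -[X in _ *: X + _]/(chom (t l0) h x) (t0 l0 r rn) // scaler0 add0r.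
- by [].
- by move=> r rn q i j h x Gx; rewrite !Ds /= scaleN1r addNr.
move=> m mn q i j k h h' x Gx; rewrite -eDef.
rewrite scaleN1r addNr addr0 /= addr0 (rawZ (dif_lin _)) -scalerBr.
by rewrite -[X in dif h' X]/(chom (t l0) h x) (HD m) // scalerA mulVf // scale1r.
Qed.
End Descent.

(** * The linear system *)

Lemma rV_linear (K : fieldType) N M (f : 'rV[K]_N -> 'rV[K]_M) : linear f ->
  forall v, f v = v *m \matrix_l f (delta_mx 0 l).
Proof.
move=> fl v; rewrite {1}(row_sum_delta v) (raw_sum fl) mulmx_sum_row.
by apply: eq_bigr => l _; rewrite (rawZ fl) rowK.
Qed.

Lemma findim_rV (K : fieldType) M (S : set 'rV[K]_M) : findim_set S.
Proof.
exists [seq delta_mx 0 l | l <- enum 'I_M] => v _.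
have sz : size [seq (delta_mx 0 l : 'rV[K]_M) | l <- enum 'I_M] = M.
  by rewrite size_map size_enum_ord.
exists (fun l => v 0 (cast_ord sz l)); rewrite {1}(row_sum_delta v).
rewrite (reindex (cast_ord sz)) /=; last first.
  by apply: onW_bij; exists (cast_ord (esym sz)) => l; apply: val_inj.
apply: eq_bigr => l _.
congr (_ *: _); rewrite (tnth_nth 0) /= (nth_map (cast_ord sz l)); last first.
  by rewrite size_enum_ord; move: (ltn_ord l); rewrite [X in (_ < X)%N]sz.
congr (delta_mx _ _); apply: val_inj => /=.
by rewrite -[X in nth _ _ X]/(val (cast_ord sz l)) nth_ord_enum.
Qed.

Section Detection.
Context {disp : Order.disp_t} {Xi : orderType disp}.
Variables (P : pseudoCooperad Xi rat) (G : nat -> collSet P).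
Hypotheses (Ggr : is_grading G) (Gfin : forall k, findim_collSet (G k)).
Variable O : gColl Xi rat.
Hypothesis O_fin : forall q i, findim_set (@setT (O q i)).
Variable e : int.

(* ev is a system of linear coordinates for families of linear maps on the
   components of P selected by T. *)
Definition detects (T : nat -> @corolla _ Xi -> int -> Prop) M (ev : ghom P O e -> 'rV[rat]_M) :=
  (forall a (f g h : ghom P O e),
     (forall k q i, T k q i -> forall (j : int) (hh : i + e = j) x, G k x ->
        h q i j hh x = a *: f q i j hh x + g q i j hh x) ->
     ev h = a *: ev f + ev g) /\
  (forall f g : ghom P O e,
     (forall q (i j : int) (h : i + e = j), linear (f q i j h)) ->
     (forall q (i j : int) (h : i + e = j), linear (g q i j h)) ->
     ev f = ev g ->
     forall k q i, T k q i -> forall (j : int) (h : i + e = j) x, G k x ->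
       f q i j h x = g q i j h x).

Lemma detects_one k0 q0 i0 : exists M (ev : ghom P O e -> 'rV[rat]_M),
  detects (fun k q i => (k, q, i) = (k0, q0, i0)) ev.
Proof.
have [m [b [bG _ bE]]] := findim_basis ((Gfin k0).1 q0 i0).
have [p [u [co [_ _ uE colin]]]] := findim_coord (O_fin q0 (i0 + e))
  (fun _ _ _ _ _ => I).
exists _, (fun f : ghom P O e => mxvec (\matrix_l co (f q0 i0 (i0 + e) erefl (b l)))); split.
  move=> a f g h H; rewrite -linearP; congr mxvec.
  apply/matrixP => l c; rewrite !mxE (H k0 q0 i0 erefl _ _ _ (bG l)).
  by rewrite colin // !mxE.
move=> f g fl gl /(can_inj mxvecK) E k q i [-> -> ->] j h x Gx; subst j.
have [c ->] := bE x Gx; rewrite (raw_sum (fl _ _ _ _)) (raw_sum (gl _ _ _ _)).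
apply: eq_bigr => l _; rewrite (rawZ (fl _ _ _ _)) (rawZ (gl _ _ _ _)); congr (_ *: _).
rewrite (uE (f _ _ _ _ _)) // [RHS]uE //; apply: eq_bigr => r _.
by have /matrixP/(_ l r) := E; rewrite !mxE => ->.
Qed.

Lemma detects_list (L : seq (nat * @corolla _ Xi * int)) :
  exists M (ev : ghom P O e -> 'rV[rat]_M), detects (fun k q i => (k, q, i) \in L) ev.
Proof.
elim: L => [|[[k0 q0] i0] L [M [ev [evl evi]]]].
  exists 0%N, (fun _ => 0); split=> [a f g h _|//].
  by rewrite scaler0 addr0.
have [M1 [ev1 [evl1 evi1]]] := detects_one k0 q0 i0.
exists (M1 + M)%N, (fun f => row_mx (ev1 f) (ev f)); split.
  move=> a f g h H; rewrite scale_row_mx add_row_mx; congr row_mx.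
    by apply: evl1 => k q i [-> -> ->] *; apply: (H k0) => //; rewrite mem_head.
  by apply: evl => k q i kL *; apply: (H k) => //; rewrite inE kL orbT.
move=> f g fl gl /eq_row_mx [E1 E2] k q i; rewrite inE => /orP[/eqP|] E.
  exact: evi1 E.
exact: evi E.
Qed.

Lemma detects_upto N : exists M (ev : ghom P O e -> 'rV[rat]_M),
  detects (fun k _ _ => (k <= N)%N) ev.
Proof.
pose L k := projT1 (cid (Gfin k).2).
have HL k q i x : G k x -> x <> 0 -> (q, i) \in L k := projT2 (cid (Gfin k).2) q i x.
have [M [ev [evl evi]]] :=
  detects_list (flatten [seq [seq (k, p.1, p.2) | p <- L k] | k <- iota 0 N.+1]).
have inL k q i : (k <= N)%N -> (q, i) \in L k ->
    (k, q, i) \in flatten [seq [seq (k, p.1, p.2) | p <- L k] | k <- iota 0 N.+1].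
  move=> kN qiL; apply/flattenP; exists [seq (k, p.1, p.2) | p <- L k].
    by apply/mapP; exists k; rewrite ?mem_iota.
  by apply/mapP; exists (q, i).
exists M, ev; split.
  move=> a f g h H; apply: evl => k q i /flattenP[l /mapP[k' k'N ->] /mapP[[q' i'] _ [-> -> ->]]].
  by apply: H; move: k'N; rewrite mem_iota.
move=> f g fl gl E k q i kN j h x Gx; have [->|/eqP x0] := eqVneq x 0.
  by rewrite (raw0 (fl _ _ _ _)) (raw0 (gl _ _ _ _)).
by apply: (evi f g fl gl E k); first exact: inL kN (HL _ _ _ _ Gx x0).
Qed.
End Detection.

Section LinearSystem.
Context {disp : Order.disp_t} {Xi : orderType disp}.
Variables (P : pseudoCooperad Xi rat) (G : nat -> collSet P).
Hypotheses (Ggr : is_grading G) (Gfin : forall k, findim_collSet (G k)).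
Variables (C : dgOperad Xi rat) (s : collHom P C 1).
Hypothesis Ccobar : is_cobar s.
Variable O : dgOperad Xi rat.
Hypothesis O_fin : forall q i, findim_set (@setT (O q i)).

Lemma eq_on_weights (e : int) (f g : ghom P O e) :
  (forall q (i j : int) (h : i + e = j), linear (f q i j h)) ->
  (forall q (i j : int) (h : i + e = j), linear (g q i j h)) ->
  (forall k, eq_on (@G k) f g) -> forall q i j (h : i + e = j) x, f q i j h x = g q i j h x.
Proof.
move=> fl gl H q i j h x; have [n [y [yG ->]]] := G_dec Ggr x.
by rewrite (raw_sum (fl _ _ _ _)) (raw_sum (gl _ _ _ _)); apply: eq_bigr => k _; apply: H.
Qed.

Definition hom_sum N (be : 'I_N -> collHom P O 1) (v : 'rV[rat]_N) : collHom P O 1.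
Proof.
refine (@CollHom _ _ _ P O 1 (fun q i j h x => \sum_l v 0 l *: chom (be l) h x) _ _).
- move=> q i j h a x y; rewrite scaler_sumr -big_split; apply: eq_bigr => l _ /=.
  by rewrite chom_lin scalerDr !scalerA mulrC.
- move=> q t ht i j h x; rewrite (raw_sum (act_lin _)).
  by apply: eq_bigr => l _; rewrite chom_act (rawZ (act_lin _)).
Defined.

Lemma hom_sum_lin N (be : 'I_N -> collHom P O 1) a v w q (i j : int) (h : i + 1 = j) x :
  chom (hom_sum be (a *: v + w)) h x = a *: chom (hom_sum be v) h x + chom (hom_sum be w) h x :> O q j.
Proof.
rewrite /= scaler_sumr -big_split; apply: eq_bigr => l _ /=.
by rewrite !mxE scalerDl scalerA.
Qed.

Lemma hom_sum_delta N (be : 'I_N -> collHom P O 1) l q (i j : int) (h : i + 1 = j) x :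
  chom (hom_sum be (delta_mx 0 l)) h x = chom (be l) h x :> O q j.
Proof.
rewrite /= (bigD1 l) //= big1 ?addr0 => [|m ml]; rewrite mxE !eqxx ?scale1r //.
by rewrite (negbTE ml) scale0r.
Qed.

(** Unknowns are coordinates in a basis of the maps supported in weights n and n+1, a finite
    dimensional space as [ev1] embeds it into row vectors. The equations are those of
    [sprout_perturb], read through the coordinates [ev]. *)
Lemma sprout_linear_system n (alpha : collHom P O 1) : (2 <= n)%N ->
  linear_system G n alpha.
Proof.
move=> n2.
pose S0 (be : collHom P O 1) := forall k, k != n -> k != n.+1 -> vanish_on (@G k) be.
have [M1 [ev1 [ev1l ev1i]]] := detects_upto Gfin O_fin 1 n.+1.
have [N [b [bS bf bE]]] := findim_basis
  (@findim_rV rat M1 (fun w : 'rV[rat]_M1 => exists2 be, S0 be & ev1 be = w)).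
pose be l := s2val (cid2 (bS l)).
have beS l : S0 (be l) := s2valP (cid2 (bS l)).
have beE l : ev1 (be l) = b l := s2valP' (cid2 (bS l)).
pose Phi := hom_sum be.
have PhiS v : S0 (Phi v).
  move=> k k1 k2 q i x Gx j h; rewrite /= big1 // => l _.
  by rewrite (beS l k) // scaler0.
have ev1_ext (f g : ghom P O 1) : (forall q (i j : int) (h : i + 1 = j) x, f q i j h x = g q i j h x) ->
    ev1 f = ev1 g.
  move=> E; have H0 : ev1 (fun _ _ _ _ _ => 0) = 0.
    have : ev1 (fun _ _ _ _ _ => 0) = 1 *: ev1 (fun _ _ _ _ _ => 0) + ev1 (fun _ _ _ _ _ => 0).
      by apply: ev1l => *; rewrite scaler0 addr0.
    by rewrite scale1r => /eqP; rewrite -subr_eq subrr => /eqP.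
  have := ev1l 1 g (fun _ _ _ _ _ => 0) f; rewrite H0 scale1r addr0; apply=> *.
  by rewrite E scale1r addr0.
have ev1Phi v : ev1 (Phi v) = \sum_l v 0 l *: b l.
  rewrite (rV_linear (f := fun v => ev1 (Phi v))).
    rewrite mulmx_sum_row; apply: eq_bigr => l _; rewrite rowK -beE; congr (_ *: _).
    by apply: ev1_ext => *; apply: hom_sum_delta.
  by move=> a u w; apply: ev1l => *; apply: hom_sum_lin.
pose f := below Ggr n alpha.
pose Dx (a : collHom P O 1) := der_ex Ccobar (A := dgo_operad O) f a.
pose D a := projT1 (cid (Dx a)).
have DF a : is_der (A := dgo_operad O) (ext Ccobar (A := dgo_operad O) f) (D a) :=
  (projT2 (cid (Dx a))).1.
have Ds (a : collHom P O 1) q (i j : int) (h : i + 1 = j) (x : P q i) :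
  D a q j (chom s h x) = chom a h x := (projT2 (cid (Dx a))).2 q i j h x.
have [M [ev [evl evi]]] := detects_upto Gfin O_fin (1 + 1) n.+1.
(* The two sides of the affine equation, as families of degree 2; linearity in x is what allows [ev]
   to detect their equality. *)
pose L (a : collHom P O 1) : ghom P O (1 + 1) := fun q i j h x =>
  dif (deg_hom h) (chom a erefl x) - D a q j (dif (deg_hom h) (chom s erefl x)).
pose R : ghom P O (1 + 1) := fun q i j h x =>
  ext Ccobar (A := dgo_operad O) f q j (dif (deg_hom h) (chom s erefl x)) -
  dif (deg_hom h) (chom f erefl x).
have Llin a q (i j : int) (h : i + (1 + 1) = j) : linear (L a q i j h).
  move=> c x y; rewrite /L !chom_lin !dif_lin (der_lin (DF a)) scalerBr opprD.
  by rewrite addrACA.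
have Rlin q (i j : int) (h : i + (1 + 1) = j) : linear (R q i j h).
  move=> c x y; rewrite /R !chom_lin !dif_lin (om_lin _) scalerBr opprD.
  by rewrite addrACA.
(* The derivation [D a] is chosen separately for each [a], so its linear dependence on [a] is
   recovered from the values on generators. *)
have LPhi : linear (fun v => ev (L (Phi v))).
  move=> c v w; apply: evl => k q i kn j h x Gx; rewrite /L hom_sum_lin dif_lin.
  have -> : D (Phi (c *: v + w)) q j (dif (deg_hom h) (chom s erefl x)) =
      c *: D (Phi v) q j (dif (deg_hom h) (chom s erefl x)) +
      D (Phi w) q j (dif (deg_hom h) (chom s erefl x)).
    apply: (der_local Ggr Gfin Ccobar _ _ (DF _)
      (is_der_lincomb c (DF (Phi v)) (DF (Phi w))) Gx) => r _ q' i' j' h' y Gy.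
    by rewrite !Ds hom_sum_lin.
  by rewrite scalerBr opprD addrACA.
exists N, M, Phi, (\matrix_l ev (L (Phi (delta_mx 0 l)))), (ev R); split.
- by move=> *; apply: hom_sum_lin.
- exact: PhiS.
- move=> beta bS0; have [|c Hc] := bE (ev1 beta); first by exists beta.
  exists c; split=> [|v Hv].
    apply: (eq_on_weights (f := Phi c) (g := beta)).
    + by move=> *; apply: chom_lin.
    + by move=> *; apply: chom_lin.
    + move=> k; have [kn|nk] := leqP k n.+1.
        move=> q i x Gx j h; apply: (ev1i (Phi c) beta) Gx => //.
        * by move=> *; apply: chom_lin.
        * by move=> *; apply: chom_lin.
        * by rewrite ev1Phi.
      move=> q i x Gx j h; rewrite (PhiS c k _ _ _ _ _ Gx) ?(bS0 k _ _ _ _ _ Gx) //;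
        by rewrite neq_ltn ?nk ?(ltn_trans (ltnSn n) nk) orbT.
  apply/eqP; rewrite -subr_eq0; apply/eqP/bf.
  under eq_bigr => l _ do rewrite !mxE scalerBl.
  by rewrite sumrB -Hc -ev1Phi (ev1_ext _ beta Hv) subrr.
- move=> v alpha' a'1 a'2 a'3; rewrite -(rV_linear LPhi).
  have Phi0 r : (r < n)%N -> vanish_on (@G r) (Phi v).
    by move=> rn; apply: PhiS; rewrite neq_ltn ?rn ?(ltn_trans rn).
  have sumE r : (r <= n.+1)%N -> eq_on (@G r) alpha' (hom_lincomb 1 (Phi v) f).
    move=> rn q i x Gx j h; rewrite -[RHS]/(1 *: chom (Phi v) h x + chom f h x) scale1r.
    rewrite (belowG _ _ _ _ Gx); case: ltnP => [rn'|rn'].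
      by rewrite (Phi0 r rn' _ _ _ Gx) add0r (a'1 r).
    rewrite addr0; move: rn; rewrite leq_eqVlt ltnS => /orP[/eqP E|rn].
      by subst r; apply: a'3.
    have E : r = n by apply/eqP; rewrite eqn_leq rn rn'.
    by subst r; apply: a'2.
  rewrite (sprout_perturb Ggr Gfin n2 Phi0 sumE (DF (Phi v)) (fun r _ q i j h x _ => Ds (Phi v) q i j h x)).
  split=> [H|H m mn q i j k h h' x Gx].
    have := evl 0 R R (L (Phi v)); have := evl 0 R R R.
    rewrite !scale0r !add0r => _; apply=> k q i kn j h x Gx.
    by rewrite scale0r add0r; apply: (H k kn _ _ _ _ erefl (deg_hom h) x Gx).
  subst j; have h2 : i + (1 + 1) = k by rewrite addrA.
  have := evi _ _ (Llin _) Rlin H m q i mn k h2 x Gx; rewrite /L /R.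
  by rewrite (_ : deg_hom h2 = h') //; exact: eq_irrelevance.
Qed.
End LinearSystem.

Theorem theorem2p14
  (disp : Order.disp_t) (Xi : orderType disp)
  (Xi_ordinal : well_founded (fun c c' : Xi => (c < c')%O))
  (O : dgOperad Xi rat) (P : pseudoCooperad Xi rat)
  (C : dgOperad Xi rat) (s : collHom P C 1) (C_cobar : is_cobar s)
  (rho : dg_map C (coh_operad O)) (rho_qiso : quasi_iso rho)
  (G : nat -> collSet P) (G_grading : is_grading G)
  (G_fin : forall k, findim_collSet (G k))
  (O_fin : forall q i, findim_set (@setT (O q i)))
  (H_gen : @generated _ _ _ (dgo_operad (coh_operad O))
     (fun q j z => exists (i : int) (h : i + 1 = j) (x : P q i),
        G 1%N q i x /\ z = rho q j (chom s h x)))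
  (rho_vanish : forall k, (2 <= k)%N -> vanish_on (G k) (twisting s rho))
  (K : fieldType) (phi : {rmorphism rat -> K})
  (OK_formal : formal (base_change phi O))
  (n : nat) (n_ge2 : (2 <= n)%N) (alpha : collHom P O 1)
  (alpha_sum : forall k, (n < k)%N -> vanish_on (G k) alpha)
  (alpha_sprout : is_sprout G n alpha)
  (alpha_proj : forall q i x, G 1%N q i x -> forall (j : int) (h : i + 1 = j),
     cls (chom alpha h x) = twisting s rho h x) :
  (exists alpha' : collHom P O 1,
     is_sprout G n.+1 alpha' /\
     forall k, (k < n)%N -> eq_on (G k) alpha' alpha) /\
  linear_system G n alpha.
Proof.
have alpha_cocycle q (i j : int) (h : i + 1 = j) (x : P q i) : G 1%N q i x ->
    chom alpha h x \in cocycle.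
  exact: (sprout_cocycle G_grading G_fin C_cobar h (ltnW n_ge2) alpha_sprout).
split; last exact: (sprout_linear_system G_grading G_fin C_cobar O_fin).
have a_ext := formal_extendable G_grading G_fin C_cobar O_fin rho_qiso rho_vanish
  alpha_cocycle alpha_proj OK_formal.
have alphaK_sprout := push_sprout G_grading G_fin C_cobar (bc_incl phi O) alpha_sprout.
have [//|a' [a's a'E]] := a_ext n n_ge2 _ alphaK_sprout.
exact: (descent G_grading G_fin C_cobar O_fin n_ge2 a's a'E).
Qed.
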